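(* Let $m\ge0$ and let $\Sigma$ be a spacelike surface near the future null-infinity of Schwarzschild spacetime of mass $m$, given as the graph $\{\bar v=-P(\mathbf y,s)\}$ of a function $P$ on $\mathbb S^2\times(0,s_0]$ which is smooth up to $s=0$, and suppose that the mean curvature of $\Sigma$ is $H=1+\mathcal O(s^3)$. Let $G$ be the metric induced on $\Sigma$ by $g_{\mathrm{Sch}}$, let $\mathring A$ be the traceless part of the second fundamental form of $\Sigma$, and let $\mathcal S$ be the scalar curvature of $(\Sigma,G)$. Then $|\mathring A|_G=O(s)$. Moreover: (a) The following statements are equivalent: (i) $|\mathring A|_G=O(s^2)$; (ii) $P|_{s=0}$ is a linear combination of the first four eigenfunctions of the Laplacian of $\mathbb S^2$ with respect to the standard metric (i.e. of the constants and the three coordinate functions $x^1,x^2,x^3$ restricted to $\mathbb S^2$); (iii) $|\mathring A|_G=O(s^3)$. In case $H=1$, they are equivalent to $|\mathcal S+6|=O(s^6)$. (b) If $m>0$, then the following two statements are equivalent: (i) $|\mathring A|_G=O(s^4)$; (ii) at $s=0$, $P$ is constant and $P_{ssss}=-\frac{9m}{2}$.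
   Context: $\mathbb S^2\subset\mathbb R^3$ is the unit sphere with standard metric $\sigma$. For $m\ge0$ put $h(r)=1-\frac{2m}{r}$. The Schwarzschild metric on $r>2m$ is $g_{\mathrm{Sch}}=-h\,dt^2+h^{-1}dr^2+r^2\sigma$ (Minkowski if $m=0$), with $\partial_t$ future directed. Let $r_*=r+2m\log|\frac r{2m}-1|$ ($r_*=r$ if $m=0$), $\bar v=t-r_*$ and $s=r^{-1}$. In the coordinates $(\mathbf y,s,\bar v)$, $g_{\mathrm{Sch}}=s^{-2}\bar g$ with $\bar g=-s^2(1-2ms)d\bar v^2+2\,d\bar v\,ds+\sigma$; the future null-infinity $\mathcal I^+$ is $\{s=0\}$. A surface is the graph of $P=P(\mathbf y,s)$ if it is $\{\bar v=-P(\mathbf y,s)\}$; equivalently it is $t=u(\mathbf y,r)$ with $P=r_*-u$. The mean curvature is one third of the trace of the second fundamental form with respect to the future directed unit normal $\mathbf n$, $H=\frac13\mathrm{div}\,\mathbf n$ (so $t=\sqrt{1+|\mathbf x|^2}$ in Minkowski spacetime has $H=1$). $\phi=\mathcal O(s^k)$ means that $s^{-k}\phi$ extends smoothly to $s=0$. $O(s^k)$ is the usual bound as $s\to0$ (uniform on $\mathbb S^2$). *)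

(* Defs.v *)
From HB Require Import structures.
From mathcomp Require Import all_boot all_order all_algebra.
From mathcomp Require Import all_classical all_reals all_analysis.

Set Implicit Arguments.
Unset Strict Implicit.
Unset Printing Implicit Defensive.

Import Order.TTheory GRing.Theory Num.Theory.
Import numFieldNormedType.Exports.

Local Open Scope classical_set_scope.
Local Open Scope ring_scope.

(* C^oo on a neighbourhood of X: every iterated directional derivative of f
   is Frechet differentiable on an open set containing X. A smooth function on
   a closed subset X such as S^2 x [0, s0] is the restriction to X of such an
   f. *)
Definition smooth_near (R : realType) (V : normedModType R) (X : set V)
    (f : V -> R) : Prop :=
  exists U : set V, [/\ open U, X `<=` U &
    forall (vs : seq V) (x : V), U x ->
      differentiable (foldr (fun v g => fun z => 'D_v g z) f vs) x].

(* The norm `|x| on 'rV_n is the sup norm, hence the explicit Euclidean one. *)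
Definition eucl (R : realType) (n : nat) (x : 'rV[R]_n) : R :=
  Num.sqrt (\sum_i x 0 i ^+ 2).

Definition sphere2 (R : realType) : set 'rV[R]_3 := [set y | eucl y = 1].

Definition collar (R : realType) (s0 : R) : set ('rV[R]_3 * R) :=
  [set p | sphere2 p.1 /\ 0 <= p.2 <= s0].

(* On S^2, f is a linear combination of the first four eigenfunctions of the
   Laplacian: the constants and the restrictions of x^1, x^2, x^3. *)
Definition in_first_eigenspan (R : realType) (f : 'rV[R]_3 -> R) : Prop :=
  exists (a : R) (b : 'rV[R]_3), forall y, sphere2 y ->
    f y = a + \sum_i b 0 i * y 0 i.

(* phi = \mathcal O(s^k): s^(-k) phi extends smoothly to s = 0. *)
Definition smoothO (R : realType) (s0 : R) (k : nat)
    (phi : 'rV[R]_3 -> R -> R) : Prop :=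
  exists2 psi : 'rV[R]_3 * R -> R, smooth_near (collar s0) psi &
    forall (y : 'rV[R]_3) (s : R), sphere2 y -> 0 < s <= s0 -> s ^- k * phi y s = psi (y, s).

(* phi = O(s^k): the usual bound as s -> 0+, uniform on S^2. *)
Definition boundO (R : realType) (k : nat) (phi : 'rV[R]_3 -> R -> R) : Prop :=
  exists C : R, \forall s \near 0^'+,
    forall y, sphere2 y -> `|phi y s| <= C * s ^+ k.

(* Pseudo-Riemannian geometry in a global coordinate chart: a metric is a
   matrix-valued function of the coordinates, the index set is 'I_n.+1. *)

Definition ebase (R : realType) (n : nat) (i : 'I_n.+1) : 'rV[R]_n.+1 :=
  delta_mx 0 i.

Definition partial (R : realType) (n : nat) (i : 'I_n.+1)
    (f : 'rV[R]_n.+1 -> R) (x : 'rV[R]_n.+1) : R := 'D_(ebase R i) f x.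

(* Gamma^k_{ij} *)
Definition christoffel (R : realType) (n : nat)
    (g : 'rV[R]_n.+1 -> 'M[R]_n.+1) (k i j : 'I_n.+1) (x : 'rV[R]_n.+1) : R :=
  2^-1 * \sum_l invmx (g x) k l *
    (partial i (fun z => g z j l) x + partial j (fun z => g z i l) x
     - partial l (fun z => g z i j) x).

Definition ricci (R : realType) (n : nat)
    (g : 'rV[R]_n.+1 -> 'M[R]_n.+1) (i j : 'I_n.+1) (x : 'rV[R]_n.+1) : R :=
  \sum_k (partial k (christoffel g k i j) x - partial j (christoffel g k i k) x)
  + \sum_k \sum_l (christoffel g k k l x * christoffel g l i j x
                   - christoffel g k j l x * christoffel g l i k x).

Definition scalar_curvature (R : realType) (n : nat)
    (g : 'rV[R]_n.+1 -> 'M[R]_n.+1) (x : 'rV[R]_n.+1) : R :=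
  \sum_i \sum_j invmx (g x) i j * ricci g i j x.

(* |B|_G, with |B|_G^2 = G^{ik} G^{jl} B_{ij} B_{kl}. *)
Definition tensor_norm (R : realType) (n : nat) (G B : 'M[R]_n) : R :=
  Num.sqrt (\sum_i \sum_j \sum_k \sum_l
    invmx G i k * invmx G j l * B i j * B k l).

Definition inner (R : realType) (n : nat) (g : 'M[R]_n) (v w : 'rV[R]_n) : R :=
  (v *m g *m w^T) 0 0.

Definition posdef (R : realType) (n : nat) (G : 'M[R]_n) : Prop :=
  forall v : 'rV[R]_n, v != 0 -> 0 < inner G v v.

(* Pullback of g by F, in the chart x of the hypersurface. *)
Definition induced_metric (R : realType) (n p : nat)
    (g : 'rV[R]_p.+1 -> 'M[R]_p.+1) (F : 'rV[R]_n.+1 -> 'rV[R]_p.+1)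
    (x : 'rV[R]_n.+1) : 'M[R]_n.+1 :=
  \matrix_(i, j) inner (g (F x)) ('D_(ebase R i) F x) ('D_(ebase R j) F x).

(* Covariant derivative along d_i F of a vector field V along F. *)
Definition cov_deriv (R : realType) (n p : nat)
    (g : 'rV[R]_p.+1 -> 'M[R]_p.+1) (F V : 'rV[R]_n.+1 -> 'rV[R]_p.+1)
    (i : 'I_n.+1) (x : 'rV[R]_n.+1) : 'rV[R]_p.+1 :=
  \row_c ('D_(ebase R i) V x 0 c
    + \sum_a \sum_b christoffel g c a b (F x)
                    * 'D_(ebase R i) F x 0 a * V x 0 b).

(* A(X, Y) = g(nabla_X N, Y), so that tr A = div N. *)
Definition second_form (R : realType) (n p : nat)
    (g : 'rV[R]_p.+1 -> 'M[R]_p.+1) (F N : 'rV[R]_n.+1 -> 'rV[R]_p.+1)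
    (x : 'rV[R]_n.+1) : 'M[R]_n.+1 :=
  \matrix_(i, j) inner (g (F x)) (cov_deriv g F N i x) ('D_(ebase R j) F x).

(* Schwarzschild spacetime r > 2m in the global coordinates
   (t, x^1, x^2, x^3) with x = r y, y in S^2: since
   |dx|^2 = dr^2 + r^2 sigma and r dr = x . dx,
   g_Sch = - h dt^2 + |dx|^2 + (h^-1 - 1) r^-2 (x . dx)^2. *)

Definition lapse (R : realType) (m r : R) : R := 1 - 2 * m / r.

(* For m = 0 the second term vanishes and r_* = r. *)
Definition tortoise (R : realType) (m r : R) : R :=
  r + 2 * m * ln `|r / (2 * m) - 1|.

Definition event (R : realType) (t : R) (x : 'rV[R]_3) : 'rV[R]_4 :=
  row_mx (t%:M : 'rV[R]_1) x.

Definition spatial (R : realType) (p : 'rV[R]_4) : 'rV[R]_3 :=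
  @rsubmx R 1 1 3 p.

Definition schwarzschild (R : realType) (m : R) (p : 'rV[R]_4) : 'M[R]_4 :=
  let x := spatial p in
  let r := eucl x in
  let h := lapse m r in
  @block_mx R 1 3 1 3 (- h)%:M 0 0
    (1%:M + ((h^-1 - 1) / r ^+ 2) *: (x^T *m x)).

(* The surface {vbar = - P(y, s)}, written as t = u(x) with u = r_* - P,
   y = x / r, s = 1 / r, and parametrized by x. *)

Definition height (R : realType) (m : R) (P : 'rV[R]_3 * R -> R)
    (x : 'rV[R]_3) : R :=
  let r := eucl x in tortoise m r - P (r^-1 *: x, r^-1).

Definition surface (R : realType) (m : R) (P : 'rV[R]_3 * R -> R)
    (x : 'rV[R]_3) : 'rV[R]_4 := event (height m P x) x.

(* The differential of tau = t - u(x). *)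
Definition conormal (R : realType) (m : R) (P : 'rV[R]_3 * R -> R)
    (x : 'rV[R]_3) : 'rV[R]_4 :=
  event 1 (- \row_(i < 3) partial i (height m P) x).

(* n = - grad tau / sqrt (- g(grad tau, grad tau)); it is future directed as
   its t-component has the sign of - g^{tt} = h^-1. *)
Definition unit_normal (R : realType) (m : R) (P : 'rV[R]_3 * R -> R)
    (x : 'rV[R]_3) : 'rV[R]_4 :=
  let ginv := invmx (schwarzschild m (surface m P x)) in
  let w := conormal m P x in
  - (Num.sqrt (- inner ginv w w))^-1 *: (w *m ginv).

Definition metricG (R : realType) (m : R) (P : 'rV[R]_3 * R -> R)
    (x : 'rV[R]_3) : 'M[R]_3 :=
  induced_metric (schwarzschild m) (surface m P) x.

Definition secondA (R : realType) (m : R) (P : 'rV[R]_3 * R -> R)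
    (x : 'rV[R]_3) : 'M[R]_3 :=
  second_form (schwarzschild m) (surface m P) (unit_normal m P) x.

Definition mean_curvature (R : realType) (m : R) (P : 'rV[R]_3 * R -> R)
    (x : 'rV[R]_3) : R :=
  3^-1 * \tr (invmx (metricG m P x) *m secondA m P x).

Definition tracelessA (R : realType) (m : R) (P : 'rV[R]_3 * R -> R)
    (x : 'rV[R]_3) : 'M[R]_3 :=
  secondA m P x - mean_curvature m P x *: metricG m P x.

(* The point of the chart with spherical coordinates (y, s). *)
Definition pt (R : realType) (y : 'rV[R]_3) (s : R) : 'rV[R]_3 := s^-1 *: y.

Definition spacelike (R : realType) (m s0 : R) (P : 'rV[R]_3 * R -> R) : Prop :=
  forall (y : 'rV[R]_3) (s : R), sphere2 y -> 0 < s <= s0 -> posdef (metricG m P (pt y s)).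

Definition Hys (R : realType) (m : R) P (y : 'rV[R]_3) (s : R) : R :=
  mean_curvature m P (pt y s).

Definition normAo (R : realType) (m : R) P (y : 'rV[R]_3) (s : R) : R :=
  tensor_norm (metricG m P (pt y s)) (tracelessA m P (pt y s)).

Definition Sys (R : realType) (m : R) P (y : 'rV[R]_3) (s : R) : R :=
  scalar_curvature (metricG m P) (pt y s).

(* Main.v *)
Require Import Defs.
From mathcomp Require Import all_boot all_order all_algebra.
From mathcomp Require Import all_classical all_reals all_analysis.
From mathcomp Require Import ring lra.

(** Write T for the gradient along the spheres s = const, a subscript s for
    d/ds, and h = 1 - 2ms. In the chart x = y / s the induced metric and the
    second fundamental form of the graph are explicit in the first two
    derivatives of P ([metricG_entry], [secondA_entry]). Referred to the basis
    (e, f, y / s), where (y, e, f) is an orthonormal frame, they are, up to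
    powers of s and of
    F = - 2 P_s - |T P|^2 - s^2 h P_s^2,
    polynomials in m, s and the 2-jet of P that make sense at s = 0; F is the
    determinant of the metric, and 3 F^(3/2) times the traceless part of A is a
    matrix [Tj] of such polynomials. As soon as F is bounded below near s = 0,
    the norm of the traceless part is O(s^k) if and only if the entries of [Tj]
    are ([normAo_unifO]), and for k <= 4 this says that their Taylor
    coefficients of order less than k vanish at s = 0, for every frame.

    That Sigma is spacelike only gives F > 0 for s > 0. At infinity one uses the
    mean curvature, in the form ([Thj_conformal])
    3 F^(3/2) H = 3 F N - s (F N_s - N F_s / 2 + F Lap P - <T P, T F> / 2),
    with N = 1 + s^2 h P_s. At a minimum of F along the spheres where F_s >= 0
    it gives F^(1/2) H >= 2/3 for s small, so that F cannot be small there
    ([lapF_critical]); if F vanished at a point of s = 0, such a minimum, with a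
    small value of F, would exist ([F0_gt0]). The leading order is now
    F^(3/2) = F, hence F = 1 and 2 P_s = - (1 + |T P|^2) at s = 0 ([F0_eq1]),
    and with this the coefficients of order 0 of [Tj] vanish.

    The coefficients of order 1 are the traceless part of the Hessian of P on
    the sphere s = 0 ([T_order1]); it vanishes only for P = a + b.y
    ([pure_hessian_affine]). In that case, H = 1 + O(s^3) determines P_ss and
    P_sss at s = 0 as polynomials in b.y ([affine_t1], [affine_t2]), as for the
    translates of a hyperboloid of Minkowski spacetime, and the coefficients of
    order 2 vanish as well ([affine_T2]). This is part (a); the statement on
    the scalar curvature S is the contracted Gauss equation in vacuum, which for
    H = 1 reads S + 6 = |A0|^2 ([scalar_curvature_graph], [Sys_frame]).

    The mass enters at order 3: the tangential components of [Tj] then contain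
    - 9 m times the traceless part of the projection of b (x) b ([affine_T3]),
    so that b = 0 if m > 0; and for b = 0 all the coefficients of order 3 are
    multiples of P_ssss + 9 m / 2 ([round_T3]), which is part (b). *)

Set Implicit Arguments.
Unset Strict Implicit.
Unset Printing Implicit Defensive.

Import Order.TTheory GRing.Theory Num.Theory.
Import numFieldNormedType.Exports.

Local Open Scope classical_set_scope.
Local Open Scope ring_scope.

(** * First derivatives along a direction *)

Section DirectionalDerivative.
Context {R : realType} {V : normedModType R}.
Implicit Types (f g : V -> R) (x v : V).

(** Differentiability is kept with the value, so that the rules of calculus
    compose without side conditions. *)
Definition dder f x v (d : R) : Prop := differentiable f x /\ 'D_v f x = d.

Lemma dderE f x v : differentiable f x -> dder f x v ('D_v f x).
Proof. by []. Qed.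

Lemma dder_eq f x v d d' : dder f x v d -> d = d' -> dder f x v d'.
Proof. by move=> ? <-. Qed.

Lemma dder_ext f g x v d : f =1 g -> dder f x v d -> dder g x v d.
Proof. by move=> /funext ->. Qed.

Lemma dder_cst c x v : dder (fun=> c) x v 0.
Proof. by split; [exact: differentiable_cst|exact: (derive_cst c)]. Qed.

Lemma dderD f g x v d e : dder f x v d -> dder g x v e ->
  dder (fun z => f z + g z) x v (d + e).
Proof.
move=> [fx <-] [gx <-]; split; first exact: (differentiableD fx gx).
by rewrite -deriveD//; apply: diff_derivable.
Qed.

Lemma dderN f x v d : dder f x v d -> dder (fun z => - f z) x v (- d).
Proof.
move=> [fx <-]; split; first exact: (differentiableN fx).
by rewrite -deriveN//; apply: diff_derivable.
Qed.

Lemma dderB f g x v d e : dder f x v d -> dder g x v e ->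
  dder (fun z => f z - g z) x v (d - e).
Proof. by move=> fd ge; apply: dderD => //; exact: dderN. Qed.

Lemma dderM f g x v d e : dder f x v d -> dder g x v e ->
  dder (fun z => f z * g z) x v (f x * e + g x * d).
Proof.
move=> [fx <-] [gx <-]; split; first exact: (differentiableM fx gx).
have -> : (fun z => f z * g z) = f * g by [].
by rewrite deriveM//; apply: diff_derivable.
Qed.

Lemma dderX f n x v d : dder f x v d ->
  dder (fun z => f z ^+ n) x v (n%:R * f x ^+ n.-1 * d).
Proof.
move=> fd; elim: n => [|n IH].
  apply: dder_eq (dder_cst 1 x v) _; by rewrite !mul0r.
have -> : (fun z => f z ^+ n.+1) = (fun z => f z * f z ^+ n).
  by apply/funext => z; rewrite exprS.
apply: dder_eq (dderM fd IH) _.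
case: n {IH} => [|n] /=; first by rewrite expr0; ring.
rewrite !exprS -(natr1 n.+1); ring.
Qed.

Lemma dder_sum n (f : 'I_n -> V -> R) x v d : (forall i, dder (f i) x v (d i)) ->
  dder (fun z => \sum_i f i z) x v (\sum_i d i).
Proof.
elim: n f d => [|n IH] f d fd.
  have -> : (fun z => \sum_i f i z) = (fun=> 0).
    by apply/funext => z; rewrite big_ord0.
  by rewrite big_ord0; exact: dder_cst.
have -> : (fun z => \sum_i f i z) =
    (fun z => f ord0 z + \sum_(i < n) f (lift ord0 i) z).
  by apply/funext => z; rewrite big_ord_recl.
by rewrite big_ord_recl; apply: dderD => //; apply: IH.
Qed.

Lemma dder_comp1 (g : R -> R) f x v d e : dder f x v d ->
  is_derive (f x) 1 g e -> dder (fun z => g (f z)) x v (e * d).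
Proof.
move=> [fx <-] ge.
have gx : differentiable g (f x) by apply/derivable1_diffP; apply: ex_derive.
split; first exact: (differentiable_comp fx gx).
have -> : (fun z => g (f z)) = g \o f by [].
rewrite deriveE; last exact: differentiable_comp.
rewrite diff_comp//= -(deriveE v fx) (diff1E gx) derive1E.
by rewrite (@derive_val _ _ _ _ _ _ _ ge) mulrC.
Qed.

Lemma dderV f x v d : dder f x v d -> f x != 0 ->
  dder (fun z => (f z)^-1) x v (- (f x) ^- 2 * d).
Proof.
move=> fd fx0; apply: (dder_comp1 (g := GRing.inv) fd).
apply: is_derive_eq; first exact: (@is_deriveV _ id (f x) 1 1 fx0 _).
by rewrite /= [_ *: _]mulr1.
Qed.

Lemma dder_sqrt f x v d : dder f x v d -> 0 < f x ->
  dder (fun z => Num.sqrt (f z)) x v ((2 * Num.sqrt (f x))^-1 * d).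
Proof. by move=> fd fx0; apply: (dder_comp1 fd); exact: is_derive1_sqrt. Qed.

Lemma dder_near f g x v d : (\near x, f x = g x) -> dder f x v d ->
  dder g x v d.
Proof.
move=> fg [fx <-]; split; last by apply: near_eq_derive; near do apply/esym.
have e : f x = g x by exact: nbhs_singleton fg.
have /diff_locallyP[c h] := fx.
have gx : g \o shift x = cst (g x) + 'd f x +o_ 0 id.
  apply/eqaddoP => _/posnumP[eps].
  have hf := (eqaddoP _ _ _ _).1 h _ [gt0 of eps%:num].
  have fg0 : \forall z \near (0 : V), f (z + x) = g (z + x).
    by move: fg; rewrite (near_shift (0:V) x) /=; apply: filterS => z; rewrite subr0.
  near=> z; have fgz : f (z + x) = g (z + x) by near: z.
  suff -> : (g \o shift x - (cst (g x) + 'd f x)) z =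
      (f \o shift x - (cst (f x) + 'd f x)) z by near: z.
  by rewrite -[LHS]/(g (z + x) - (g x + 'd f x z)) -fgz -e.
have dg := diff_unique c gx.
by apply/diff_locallyP; rewrite dg.
Unshelve. all: by end_near. Qed.

End DirectionalDerivative.

(** * Lines, the mean value theorem and the symmetry of second derivatives *)

Section Lines.
Context {R : realType} {V : normedModType R}.
Implicit Types (f g : V -> R) (x v w : V).

Lemma is_derive_line f x v (t : R) : differentiable f (x + t *: v) ->
  is_derive t 1 (fun t : R => f (x + t *: v)) ('D_v f (x + t *: v)).
Proof.
move=> fx.
have e (h : R) : f (x + (h *: 1 + t) *: v) = f (h *: v + (x + t *: v)).
  by rewrite [h *: 1]mulr1 scalerDl addrCA.
have fd : derivable f (x + t *: v) v by exact: diff_derivable.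
have e2 : (fun h : R => h^-1 *: (f (x + (h *: 1 + t) *: v) - f (x + t *: v))) =
    (fun h : R => h^-1 *: (f (h *: v + (x + t *: v)) - f (x + t *: v))).
  by apply/funext => h; rewrite e.
by apply: DeriveDef; rewrite /derivable /derive e2.
Qed.

Lemma MVT_line f x v (h : R) : 0 < h ->
  (forall t, 0 <= t <= h -> differentiable f (x + t *: v)) ->
  exists2 t, 0 < t < h & f (x + h *: v) - f x = h * 'D_v f (x + t *: v).
Proof.
move=> h0 fd.
have [||t t01 e] := @MVT R (fun t => f (x + t *: v))
  (fun t => 'D_v f (x + t *: v)) 0 h h0.
- by move=> t; rewrite in_itv /= => /andP[t0 th]; apply: is_derive_line;
    apply: fd; rewrite !ltW.
- apply: derivable_within_continuous => t; rewrite in_itv /= => tI.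
  by have /is_derive_line[] := fd _ tI.
exists t; first by move: t01; rewrite in_itv.
by rewrite scale0r addr0 subr0 in e; rewrite e mulrC.
Qed.

Let sdiff f x v w := f (x + v + w) - f (x + v) - (f (x + w) - f x).

Lemma sdiff_mvt f x v w (h : R) : 0 < h ->
  (forall a b, 0 <= a <= h -> 0 <= b <= h ->
     differentiable f (x + a *: v + b *: w) /\
     differentiable ('D_v f) (x + a *: v + b *: w)) ->
  exists a b, [/\ 0 <= a <= h, 0 <= b <= h &
    sdiff f x (h *: v) (h *: w) =
      h * h * 'D_w ('D_v f) (x + a *: v + b *: w)].
Proof.
move=> h0 fd.
have hI : 0 <= h <= h by rewrite lexx ltW.
have zI : 0 <= (0 : R) <= h by rewrite lexx ltW.
pose F (t : R) := f ((x + h *: w) + t *: v) - f (x + t *: v).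
have [||a aI e] := @MVT R F
  (fun t => 'D_v f ((x + h *: w) + t *: v) - 'D_v f (x + t *: v)) 0 h h0.
- move=> t; rewrite in_itv /= => /andP[t0 th].
  have tI : 0 <= t <= h by rewrite !ltW.
  apply: is_deriveB; apply: is_derive_line.
    by have [] := fd _ _ tI hI; rewrite addrAC.
  by have [] := fd _ _ tI zI; rewrite scale0r addr0.
- apply: derivable_within_continuous => t; rewrite in_itv /= => tI.
  apply: derivableB.
    have /is_derive_line[] // : differentiable f (x + h *: w + t *: v).
    by have [] := fd _ _ tI hI; rewrite addrAC.
  have /is_derive_line[] // : differentiable f (x + t *: v).
  by have [] := fd _ _ tI zI; rewrite scale0r addr0.
have {}aI : 0 <= a <= h by move: aI; rewrite in_itv /= => /andP[/ltW-> /ltW->].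
have [|b bI e2] := @MVT_line ('D_v f) (x + a *: v) w h h0.
  by move=> t tI; have [] := fd _ _ aI tI.
exists a, b; split=> //; first by case/andP: bI => /ltW-> /ltW->.
rewrite -mulrA -e2 -(addrAC x (h *: w)); rewrite subr0 mulrC in e; rewrite -e.
by rewrite /F /sdiff !scale0r !addr0 (addrAC x (h *: w)).
Qed.

Let close_eq (A B C D e : R) : A = B ->
  `|C - A| < e / 2 -> `|D - B| < e / 2 -> `|C - D| <= e.
Proof.
move=> <- CA DA; rewrite -(subrK A C) -addrA.
apply: le_trans (ler_normD _ _) _; rewrite [`|A - D|]distrC.
by rewrite (splitr e) lerD// ltW.
Qed.

(** Both mixed derivatives are limits of the same second difference sdiff,
    which is symmetric in v and w. *)
Lemma derive_comm f x v w :
  (\near x, differentiable f x /\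
     differentiable ('D_v f) x /\ differentiable ('D_w f) x) ->
  {for x, continuous ('D_w ('D_v f))} -> {for x, continuous ('D_v ('D_w f))} ->
  'D_w ('D_v f) x = 'D_v ('D_w f) x.
Proof.
move=> fd c1 c2.
apply/eqP; rewrite -subr_eq0 -normr_le0; apply/ler_addgt0Pl => e e0.
rewrite addr0.
have e20 : 0 < e / 2 by rewrite divr_gt0.
have := c1; move/cvgrPdist_lt/(_ _ e20) => {}c1.
have := c2; move/cvgrPdist_lt/(_ _ e20) => {}c2.
have /nbhs_ballP[d /= d0 dP] : nbhs x [set z |
    (differentiable f z /\ differentiable ('D_v f) z /\
     differentiable ('D_w f) z) /\
    `|'D_w ('D_v f) x - 'D_w ('D_v f) z| < e / 2 /\
    `|'D_v ('D_w f) x - 'D_v ('D_w f) z| < e / 2].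
  exact: filterI fd (filterI c1 c2).
pose M := `|v| + `|w| + 1.
have M0 : 0 < M by rewrite ltr_wpDl// addr_ge0.
pose h := d / 2 / M.
have h0 : 0 < h by rewrite !divr_gt0.
have hin (v' w' : V) a b : `|v'| + `|w'| <= `|v| + `|w| ->
    0 <= a <= h -> 0 <= b <= h -> ball x d (x + a *: v' + b *: w').
  move=> vw /andP[a0 ah] /andP[b0 bh]; rewrite -ball_normE /= -!addrA opprD.
  rewrite addrA subrr add0r normrN.
  apply: le_lt_trans (ler_normD _ _) _; rewrite !normrZ !ger0_norm//.
  apply: (@le_lt_trans _ _ (h * (`|v'| + `|w'|))).
    by rewrite mulrDr lerD// ler_wpM2r.
  apply: (@le_lt_trans _ _ (h * M)).
    by rewrite ler_wpM2l ?(ltW h0)// (le_trans vw)// lerDl.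
  by rewrite /h divfK ?gt_eqF// ltr_pdivrMr// ltr_pMr// ltr1n.
have [|a [b [aI bI e1]]] := @sdiff_mvt f x v w h h0.
  move=> a b aI bI; have [] := dP _ (hin v w a b (lexx _) aI bI).
  by move=> [? [? ?]] _.
have [|a' [b' [aI' bI' e2]]] := @sdiff_mvt f x w v h h0.
  move=> a' b' aI' bI'.
  have [] := dP _ (hin w v a' b' _ aI' bI'); first by rewrite addrC.
  by move=> [? [? ?]] _.
have [_ [/= k1 _]] := dP _ (hin v w a b (lexx _) aI bI).
have [|_ [/= _ k2]] := dP _ (hin w v a' b' _ aI' bI'); first by rewrite addrC.
have sym : sdiff f x (h *: v) (h *: w) = sdiff f x (h *: w) (h *: v).
  rewrite /sdiff (addrAC x (h *: w)).
  by rewrite !opprB addrACA [RHS]addrACA [in RHS](addrC (- f _) (- f _)).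
have hh : h * h != 0 by rewrite mulf_neq0// gt_eqF.
have E := mulfI hh (etrans (etrans (esym e1) sym) e2).
exact: close_eq E k1 k2.
Unshelve. all: by end_near. Qed.

End Lines.

(** * Smooth functions on an open set *)

Section Smooth.
Context {R : realType} {V : normedModType R}.
Variables (U : set V) (U_open : open U).
Implicit Types (f g : V -> R) (x v w : V).

(** Smoothness as a hereditary property of order n, which is the form in which
   closure under products is proved. *)
Fixpoint Cn (n : nat) f : Prop :=
  (forall x, U x -> differentiable f x) /\
  (if n is k.+1 then forall v, Cn k ('D_v f) else True).

Definition Cinf f := forall n, Cn n f.

Lemma Cinf_iter f :
  (forall (vs : seq V) x, U x ->
    differentiable (foldr (fun v g => fun z => 'D_v g z) f vs) x) -> Cinf f.
Proof.
move=> fs n; elim: n f fs => [|n IH] f fs; split; [exact: (fs [::])|by []|exact: (fs [::])|].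
by move=> v; apply: IH => vs x Ux; have := fs (rcons vs v) x Ux;
    rewrite -cats1 foldr_cat.
Qed.

Lemma Cinf_diff f x : Cinf f -> U x -> differentiable f x.
Proof. by move=> fs Ux; have [fd _] := fs 0%N; exact: fd. Qed.

Lemma Cinf_cont f x : Cinf f -> U x -> {for x, continuous f}.
Proof. by move=> fs Ux; apply: differentiable_continuous; exact: Cinf_diff. Qed.

Lemma Cinf_derive f v : Cinf f -> Cinf ('D_v f).
Proof. by move=> fs n; have [_ fD] := fs n.+1; exact: fD. Qed.

Lemma near_open x : U x -> \near x, U x.
Proof. by move=> Ux; exact: open_nbhs_nbhs. Qed.

Lemma Cn_ext n f g : (forall x, U x -> f x = g x) -> Cn n f -> Cn n g.
Proof.
have near_ext (h k : V -> R) x : (forall x, U x -> h x = k x) -> U x ->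
    \near x, h x = k x.
  by move=> hk /near_open; apply: filterS.
have ext (h k : V -> R) : (forall x, U x -> h x = k x) ->
    (forall x, U x -> differentiable h x) -> forall x, U x -> differentiable k x.
  move=> hk hd x Ux; have [//] := @dder_near _ _ h k x 0 _ (near_ext _ _ _ hk Ux)
    (dderE 0 (hd _ Ux)).
elim: n f g => [|n IH] f g fg [fd fD]; split=> //; try exact: ext fd.
move=> v; apply: IH (fD v) => x Ux.
by apply: near_eq_derive; exact: near_ext.
Qed.

Lemma Cinf_ext f g : (forall x, U x -> f x = g x) -> Cinf f -> Cinf g.
Proof. by move=> fg fs n; exact: Cn_ext fg (fs n). Qed.

Lemma CnW n f : Cn n.+1 f -> Cn n f.
Proof.
elim: n f => [|n IH] f [fd fD]; split=> // v; exact: IH (fD v).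
Qed.

Lemma Cn_cst n c : Cn n (fun=> c).
Proof.
elim: n c => [|n IH] c; split=> //; try (by move=> *; exact: differentiable_cst).
move=> v; apply: Cn_ext (IH 0) => x _; by rewrite (derive_cst c).
Qed.

Lemma CnD n f g : Cn n f -> Cn n g -> Cn n (fun z => f z + g z).
Proof.
elim: n f g => [|n IH] f g [fd fD] [gd gD].
  by split=> // x Ux; have [] := dderD (dderE 0 (fd _ Ux)) (dderE 0 (gd _ Ux)).
split=> [x Ux|v].
  by have [] := dderD (dderE 0 (fd _ Ux)) (dderE 0 (gd _ Ux)).
apply: Cn_ext (IH _ _ (fD v) (gD v)) => x Ux.
by have [_ ->] := dderD (dderE v (fd _ Ux)) (dderE v (gd _ Ux)).
Qed.

Lemma CnM n f g : Cn n f -> Cn n g -> Cn n (fun z => f z * g z).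
Proof.
elim: n f g => [|n IH] f g fs gs.
  have [fd _] := fs; have [gd _] := gs.
  by split=> // x Ux; have [] := dderM (dderE 0 (fd _ Ux)) (dderE 0 (gd _ Ux)).
have [fd fD] := fs; have [gd gD] := gs.
split=> [x Ux|v].
  by have [] := dderM (dderE 0 (fd _ Ux)) (dderE 0 (gd _ Ux)).
apply: Cn_ext (CnD (IH _ _ (CnW fs) (gD v)) (IH _ _ (CnW gs) (fD v))) => x Ux.
by have [_ ->] := dderM (dderE v (fd _ Ux)) (dderE v (gd _ Ux)).
Qed.

Lemma Cinf_cst c : Cinf (fun=> c).
Proof. by move=> n; exact: Cn_cst. Qed.

Lemma CinfD f g : Cinf f -> Cinf g -> Cinf (fun z => f z + g z).
Proof. by move=> fs gs n; apply: CnD. Qed.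

Lemma CinfM f g : Cinf f -> Cinf g -> Cinf (fun z => f z * g z).
Proof. by move=> fs gs n; apply: CnM. Qed.

Lemma CinfN f : Cinf f -> Cinf (fun z => - f z).
Proof.
by move=> /(CinfM (Cinf_cst (-1))); apply: Cinf_ext => x _; rewrite mulN1r.
Qed.

Lemma CinfB f g : Cinf f -> Cinf g -> Cinf (fun z => f z - g z).
Proof. by move=> fs gs; apply: CinfD => //; exact: CinfN. Qed.

Lemma CinfX f n : Cinf f -> Cinf (fun z => f z ^+ n).
Proof.
move=> fs; elim: n => [|n IH]; first exact: Cinf_cst 1.
by apply: Cinf_ext (CinfM fs IH) => x _; rewrite exprS.
Qed.

Lemma Cinf_sum n (f : 'I_n -> V -> R) : (forall i, Cinf (f i)) ->
  Cinf (fun z => \sum_i f i z).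
Proof.
elim: n f => [|n IH] f fs.
  by apply: Cinf_ext (Cinf_cst 0) => x _; rewrite big_ord0.
apply: Cinf_ext (CinfD (fs ord0) (IH (fun i => f (lift ord0 i)) _)) => // x _.
by rewrite big_ord_recl.
Qed.

(** For the coordinate functions. *)
Lemma Cinf_lin f : (forall x, differentiable f x) ->
  (forall v, exists c, forall x, 'D_v f x = c) -> Cinf f.
Proof.
move=> fd fD [|n]; split=> // v; have [c e] := fD v.
by apply: Cn_ext (Cn_cst n c) => x _; rewrite e.
Qed.

Lemma derive_comm_Cinf f v w x : Cinf f -> U x ->
  'D_v ('D_w f) x = 'D_w ('D_v f) x.
Proof.
move=> fs Ux; apply: derive_comm.
- apply: filterS (near_open Ux) => z Uz; split; [|split];
    apply: Cinf_diff Uz => //; exact: Cinf_derive.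
- by apply: Cinf_cont Ux; do 2!apply: Cinf_derive.
- by apply: Cinf_cont Ux; do 2!apply: Cinf_derive.
Qed.

End Smooth.

(** * Functions on the sphere at infinity and on the chart *)

Section Hat.
Context {R : realType}.
Notation V3 := 'rV[R]_3.
Notation W := ('rV[R]_3 * R)%type.

Definition dot n (u v : 'rV[R]_n) : R := \sum_i u 0 i * v 0 i.

Lemma eucl_sq n (x : 'rV[R]_n) : eucl x ^+ 2 = dot x x.
Proof.
rewrite /eucl sqr_sqrtr; first by apply: eq_bigr => i _; rewrite expr2.
by apply: sumr_ge0 => i _; exact: sqr_ge0.
Qed.

Lemma eucl_gt0 n (x : 'rV[R]_n) : x != 0 -> 0 < eucl x.
Proof.
move=> x0; rewrite sqrtr_gt0 lt_neqAle sumr_ge0 ?andbT => [|i _]; last first.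
  exact: sqr_ge0.
apply: contra x0; rewrite eq_sym psumr_eq0 => [/allP h|i _]; last exact: sqr_ge0.
apply/eqP/rowP => i; rewrite mxE; apply/eqP.
by have := h i (mem_index_enum i); rewrite /= sqrf_eq0.
Qed.

Lemma eucl0 n : eucl (0 : 'rV[R]_n) = 0.
Proof.
by rewrite /eucl big1 ?sqrtr0// => i _; rewrite mxE expr2 mul0r.
Qed.

Lemma euclZ n (c : R) (x : 'rV[R]_n) : 0 <= c -> eucl (c *: x) = c * eucl x.
Proof.
move=> c0; rewrite /eucl -{2}(ger0_norm c0) -sqrtr_sqr -sqrtrM ?sqr_ge0//.
by congr Num.sqrt; rewrite mulr_sumr; apply: eq_bigr => i _; rewrite mxE exprMn.
Qed.

Lemma sphere_neq0 (y : V3) : sphere2 y -> y != 0.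
Proof.
move=> ys; apply/eqP => y0; move: ys; rewrite /sphere2 /= y0 eucl0 => /eqP.
by rewrite eq_sym oner_eq0.
Qed.

Lemma sphere_dot (y : V3) : sphere2 y -> dot y y = 1.
Proof. by move=> ys; rewrite -eucl_sq ys expr1n. Qed.

Lemma normalize_sphere (x : V3) : x != 0 -> sphere2 ((eucl x)^-1 *: x).
Proof.
move=> x0; have r0 := eucl_gt0 x0.
by rewrite /sphere2 /= euclZ ?invr_ge0 ?ltW// mulVf// gt_eqF.
Qed.

Lemma dder_coord n (x v : 'rV[R]_n) i : dder (fun z : 'rV[R]_n => z 0 i) x v (v 0 i).
Proof.
split; first exact: differentiable_coord.
have id1 : derivable (id : 'rV[R]_n -> 'rV[R]_n) x v by exact: derivable_id.
have := derive_mx id1.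
by rewrite derive_id => /matrixP/(_ 0 i); rewrite mxE.
Qed.

Lemma dder_eucl n (x v : 'rV[R]_n) : x != 0 ->
  dder (@eucl R n) x v ((eucl x)^-1 * dot x v).
Proof.
move=> x0; have r0 := eucl_gt0 x0.
apply: dder_eq.
  apply: (dder_sqrt (f := fun z : 'rV[R]_n => \sum_i z 0 i ^+ 2)).
    by apply: dder_sum => i; apply: dderX; apply: dder_coord.
  by move: r0; rewrite sqrtr_gt0.
rewrite -/(eucl x) /dot !mulr_sumr; apply: eq_bigr => i _ /=; rewrite expr1.
by move: (eucl x) r0 => r /lt0r_neq0 r0; field.
Qed.

Lemma vder_row (V : normedModType R) n (F : V -> 'rV[R]_n) x v (d : 'rV[R]_n) :
  (forall i, dder (fun z => F z 0 i) x v (d 0 i)) ->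
  differentiable F x /\ 'D_v F x = d.
Proof.
move=> Fd.
have Fx : differentiable F x.
  have -> : F = \sum_(i < n) (fun z => F z 0 i *: delta_mx 0 i).
    apply/funext => z; rewrite fct_sumE; exact: row_sum_delta.
  apply: differentiable_sum => i; apply: differentiableZl.
  by have [] := Fd i.
split=> //; rewrite derive_mx; last exact: diff_derivable.
by apply/rowP => i; rewrite !mxE; have [_ ->] := Fd i.
Qed.

Definition ez (i : 'I_3) : W := (ebase R i, 0).
Definition es : W := (0, 1).
Definition ds (f : W -> R) : W -> R := 'D_es f.

(** The i-th component, in R^3, of the gradient of f along the spheres
    s = const. *)
Definition tang (i : 'I_3) (f : W -> R) (p : W) : R :=
  'D_(ez i) f p - p.1 0 i * \sum_k p.1 0 k * 'D_(ez k) f p.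

(** The i-th partial derivative in the chart x = y / s, where r = 1 / s and
    y = x / r; [dder_hat] justifies the formula. *)
Definition Lop (i : 'I_3) (f : W -> R) (p : W) : R :=
  p.2 * tang i f p - p.2 ^+ 2 * p.1 0 i * ds f p.

Definition sph (x : V3) : W := ((eucl x)^-1 *: x, (eucl x)^-1).

Lemma derive_prod (f : W -> R) p (a : V3) (b : R) : differentiable f p ->
  'D_(a, b) f p = \sum_k a 0 k * 'D_(ez k) f p + b * ds f p.
Proof.
move=> fp; rewrite /ds !deriveE//.
have -> : (a, b) = \sum_k a 0 k *: ez k + b *: es.
  apply: injective_projections => /=.
    rewrite raddf_sum /= scaler0 addr0.
    by rewrite [LHS]row_sum_delta; apply: eq_bigr.
  rewrite raddf_sum /= [_ *: 1]mulr1 big1 ?add0r// => i _.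
  by rewrite /= scaler0.
rewrite linearD linear_sum linearZZ /=; congr (_ + _).
by apply: eq_bigr => k _; rewrite linearZZ /= deriveE.
Qed.

(** The differential of z |-> z / |z| is |z|^-1 times the projection onto the
    tangent plane of the sphere. *)
Lemma dder_sphere (f : W -> R) (w : V3 -> R) (x : V3) i b : x != 0 ->
  dder w x (ebase R i) b ->
  differentiable f ((eucl x)^-1 *: x, w x) ->
  dder (fun z => f ((eucl z)^-1 *: z, w z)) x (ebase R i)
    ((eucl x)^-1 * tang i f ((eucl x)^-1 *: x, w x)
     + b * ds f ((eucl x)^-1 *: x, w x)).
Proof.
move=> x0 [wx wD] fx; have r0 := eucl_gt0 x0; have rn0 := lt0r_neq0 r0.
set s := (eucl x)^-1; set y := s *: x; rewrite -/y -/s in fx *.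
pose a : V3 := \row_k (s * ((i == k)%:R - y 0 i * y 0 k)).
have [Fx FD] : differentiable (fun z : V3 => (eucl z)^-1 *: z) x /\
    'D_(ebase R i) (fun z : V3 => (eucl z)^-1 *: z) x = a.
  apply: vder_row => k.
  have -> : (fun z : V3 => ((eucl z)^-1 *: z) 0 k) =
      (fun z : V3 => (eucl z)^-1 * z 0 k) by apply/funext => z; rewrite mxE.
  apply: dder_eq.
    by apply: dderM; [apply: dderV (dder_eucl _ x0) _|apply: dder_coord].
  have -> : dot x (ebase R i) = x 0 i.
    rewrite /dot (bigD1 i)//= big1 ?addr0 => [|j ji]; rewrite !mxE eqxx /=.
      by rewrite eqxx mulr1.
    by rewrite (negbTE ji) mulr0.
  rewrite !mxE eqxx /= -exprVn -/s (eq_sym k i).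
  by move: (i == k) => c; ring.
have px : differentiable (fun z : V3 => ((eucl z)^-1 *: z, w z)) x.
  exact: differentiable_pair.
split; first exact: (differentiable_comp px fx).
have -> : (fun z => f ((eucl z)^-1 *: z, w z)) =
  f \o (fun z : V3 => ((eucl z)^-1 *: z, w z)) by [].
rewrite deriveE; last exact: differentiable_comp.
rewrite diff_comp// /= diff_pair//= -!deriveE// FD wD derive_prod//.
congr (_ + _); rewrite /tang mulrBr !mulr_sumr.
have -> : s * 'D_(ez i) f (y, w x) =
    \sum_k s * (i == k)%:R * 'D_(ez k) f (y, w x).
  rewrite (bigD1 i)//= eqxx mulr1 big1 ?addr0// => k ki.
  by rewrite eq_sym (negbTE ki) mulr0 mul0r.
by rewrite -sumrB; apply: eq_bigr => k _; rewrite !mxE /=; ring.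
Qed.

Lemma dder_hat (f : W -> R) (x : V3) i : x != 0 -> differentiable f (sph x) ->
  dder (fun z => f (sph z)) x (ebase R i) (Lop i f (sph x)).
Proof.
move=> x0 fx; have rn0 := lt0r_neq0 (eucl_gt0 x0).
apply: dder_eq (dder_sphere x0 (dderV (dder_eucl _ x0) rn0) fx) _.
rewrite /Lop /sph /=; congr (_ + _).
have -> : dot x (ebase R i) = x 0 i.
  rewrite /dot (bigD1 i)//= big1 ?addr0 => [|j ji]; rewrite !mxE eqxx /=.
    by rewrite eqxx mulr1.
  by rewrite (negbTE ji) mulr0.
by rewrite -exprVn mxE; ring.
Qed.

(** Functions of degree 0 carry the tangential derivatives of f on the slice
    s = c, which reduces the calculus on the sphere to that of R^3. *)
Lemma dder_hat0 (f : W -> R) (c : R) (x : V3) i : x != 0 ->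
  differentiable f ((eucl x)^-1 *: x, c) ->
  dder (fun z => f ((eucl z)^-1 *: z, c)) x (ebase R i)
    ((eucl x)^-1 * tang i f ((eucl x)^-1 *: x, c)).
Proof.
move=> x0 fx.
apply: dder_eq (dder_sphere x0 (dder_cst c x (ebase R i)) fx) _.
by rewrite mul0r addr0.
Qed.

Lemma dder_fst (p v : W) k : dder (fun q : W => q.1 0 k) p v (v.1 0 k).
Proof.
have fc : continuous (fst : W -> V3) by move=> q; exact: cvg_fst.
have fd : differentiable (fst : W -> V3) p by exact: linear_differentiable.
split; first exact: (differentiable_comp fd (differentiable_coord _ _ _)).
have -> : (fun q : W => q.1 0 k) = (fun z : V3 => z 0 k) \o fst by [].
rewrite deriveE; last exact: (differentiable_comp fd (differentiable_coord _ _ _)).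
rewrite diff_comp//=; last exact: differentiable_coord.
rewrite -deriveE; last exact: differentiable_coord.
by rewrite diff_lin//; have [_ ->] := dder_coord p.1 v.1 k.
Qed.

Lemma dder_snd (p v : W) : dder (fun q : W => q.2) p v v.2.
Proof.
have fc : continuous (snd : W -> R) by move=> q; exact: cvg_snd.
have fd : differentiable (snd : W -> R) p by exact: linear_differentiable.
by split=> //; rewrite deriveE// diff_lin.
Qed.

Variables (U : set W) (U_open : open U).

Lemma Cinf_fst k : Cinf U (fun q : W => q.1 0 k).
Proof.
apply: Cinf_lin => // [x|v]; first by have [] := dder_fst x 0 k.
by exists (v.1 0 k) => x; have [] := dder_fst x v k.
Qed.

Lemma Cinf_snd : Cinf U (fun q : W => q.2).
Proof.
apply: Cinf_lin => // [x|v]; first by have [] := dder_snd x 0.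
by exists v.2 => x; have [] := dder_snd x v.
Qed.

Lemma Cinf_tang f i : Cinf U f -> Cinf U (tang i f).
Proof.
move=> fs; apply: CinfB => //; first exact: Cinf_derive.
apply: CinfM => //; first exact: Cinf_fst.
apply: Cinf_sum => // k; apply: CinfM => //; first exact: Cinf_fst.
exact: Cinf_derive.
Qed.

Lemma Cinf_Lop f i : Cinf U f -> Cinf U (Lop i f).
Proof.
move=> fs; apply: CinfB => //; apply: CinfM => //.
- exact: Cinf_snd.
- exact: Cinf_tang.
- by apply: CinfM => //; [apply: CinfX => //; exact: Cinf_snd|exact: Cinf_fst].
- exact: Cinf_derive.
Qed.

End Hat.

(** * The Schwarzschild metric in the chart *)

Section Ambient.
Context {R : realType}.
Notation V3 := 'rV[R]_3.
Notation V4 := 'rV[R]_4.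
Implicit Types (x v w : V3) (X Y Z : V4).

Lemma eventE0 (t : R) x : event t x 0 (lshift 3 (0 : 'I_1)) = t.
Proof. by rewrite /event (@row_mxEl _ 1 1 3) mxE eqxx mulr1n. Qed.

Lemma eventES (t : R) x k : event t x 0 (rshift 1 k) = x 0 k.
Proof. by rewrite /event (@row_mxEr _ 1 1 3). Qed.

Lemma row4P (X Y : V4) : X 0 (lshift 3 (0 : 'I_1)) = Y 0 (lshift 3 (0 : 'I_1)) ->
  (forall k : 'I_3, X 0 (rshift 1 k) = Y 0 (rshift 1 k)) -> X = Y.
Proof.
move=> e0 eS; apply/rowP => c; case: (@split_ordP 1 3 c) => k -> //.
by rewrite (ord1 k).
Qed.

Lemma eventN (t : R) x : - event t x = event (- t) (- x).
Proof. by apply: row4P => [|k]; rewrite mxE ?eventE0 ?eventES ?mxE. Qed.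

Lemma eventZ (c t : R) x : c *: event t x = event (c * t) (c *: x).
Proof. by apply: row4P => [|k]; rewrite mxE ?eventE0 ?eventES ?mxE. Qed.

Lemma spatial_event (t : R) x : spatial (event t x) = x.
Proof. by rewrite /spatial /event (@row_mxKr _ 1 1 3). Qed.

Lemma sum4 (F : 'I_4 -> R) :
  \sum_i F i = F (lshift 3 (0 : 'I_1)) + \sum_(k < 3) F (rshift 1 k).
Proof. by rewrite (@big_split_ord _ _ _ 1 3) /= big_ord1. Qed.

Lemma dotE n (u v : 'rV[R]_n) : (u *m v^T) 0 0 = dot u v.
Proof. by rewrite mxE; apply: eq_bigr => i _; rewrite mxE. Qed.

Lemma dotC n (u v : 'rV[R]_n) : dot u v = dot v u.
Proof. by apply: eq_bigr => i _; rewrite mulrC. Qed.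

Lemma dotDl n (u v w : 'rV[R]_n) : dot (u + v) w = dot u w + dot v w.
Proof. by rewrite -big_split; apply: eq_bigr => i _; rewrite mxE mulrDl. Qed.

Lemma dotZl n c (u v : 'rV[R]_n) : dot (c *: u) v = c * dot u v.
Proof. by rewrite mulr_sumr; apply: eq_bigr => i _; rewrite mxE mulrA. Qed.

Lemma dotNl n (u v : 'rV[R]_n) : dot (- u) v = - dot u v.
Proof. by rewrite -scaleN1r dotZl mulN1r. Qed.

Lemma dotDr n (u v w : 'rV[R]_n) : dot u (v + w) = dot u v + dot u w.
Proof. by rewrite dotC dotDl !(dotC u). Qed.

Lemma dotZr n c (u v : 'rV[R]_n) : dot u (c *: v) = c * dot u v.
Proof. by rewrite dotC dotZl dotC. Qed.

Lemma dotNr n (u v : 'rV[R]_n) : dot u (- v) = - dot u v.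
Proof. by rewrite dotC dotNl dotC. Qed.

Lemma dot_ebase n (u : 'rV[R]_n.+1) i : dot u (ebase R i) = u 0 i.
Proof.
rewrite /dot (bigD1 i)//= big1 ?addr0 => [|j ji]; rewrite !mxE eqxx /=.
  by rewrite eqxx mulr1.
by rewrite (negbTE ji) mulr0.
Qed.

Lemma ebaseE n (i j : 'I_n.+1) : ebase R i 0 j = (i == j)%:R.
Proof. by rewrite !mxE eqxx /= eq_sym. Qed.

Lemma event_dot (t t' : R) v w : (event t v *m (event t' w)^T) 0 0 = t * t' + dot v w.
Proof.
rewrite (@dotE 4) /dot sum4 !eventE0; congr (_ + _).
by apply: eq_bigr => k _; rewrite !eventES.
Qed.

(** The function kappa(r) of the spatial part 1 + kappa x^T x of the metric. *)
Definition kap (m r : R) : R := ((lapse m r)^-1 - 1) / r ^+ 2.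

Lemma schwarzschild_mul (m : R) (p : V4) (t : R) v :
  let x := spatial p in
  event t v *m schwarzschild m p =
  event (- lapse m (eucl x) * t) (v + (kap m (eucl x) * dot v x) *: x).
Proof.
move=> x; rewrite /event /schwarzschild -/x (@mul_row_block R 1 1 3 1 3).
rewrite !mulmx0 addr0 add0r.
apply: (f_equal2 (@row_mx R 1 1 3)); first by rewrite -scalar_mxM mulrC.
rewrite mulmxDr mulmx1 -scalemxAr mulmxA -/(kap m (eucl x)); congr (_ + _).
by rewrite (mx11_scalar (v *m _)) dotE mul_scalar_mx scalerA.
Qed.

Lemma inner_schwarzschild (m : R) (p : V4) (t t' : R) v w :
  let x := spatial p in
  inner (schwarzschild m p) (event t v) (event t' w) =
  - lapse m (eucl x) * t * t' + (dot v w + kap m (eucl x) * dot x v * dot x w).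
Proof.
move=> x; rewrite /inner schwarzschild_mul -/x /event.
rewrite (@tr_row_mx _ 1 1 3) (@mul_row_col _ 1 1 3) mxE; congr (_ + _).
  by rewrite tr_scalar_mx -scalar_mxM mxE eqxx mulr1n.
by rewrite dotE dotDl dotZl (dotC v x).
Qed.

Lemma eventK (X : V4) : event (X 0 (lshift 3 (0 : 'I_1))) (spatial X) = X.
Proof.
rewrite /event /spatial -[RHS](@hsubmxK _ 1 1 3).
apply: (f_equal2 (@row_mx R 1 1 3)) => //.
by rewrite [RHS]mx11_scalar mxE.
Qed.

Lemma schwarzschild_unit (m : R) (p : V4) :
  eucl (spatial p) != 0 -> lapse m (eucl (spatial p)) != 0 ->
  schwarzschild m p \in unitmx.
Proof.
move=> r0 h0; set x := spatial p in r0 h0 *; set r := eucl x in r0 h0 *.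
pose G := @block_mx R 1 3 1 3 (- (lapse m r)^-1)%:M 0 0
    (1%:M + ((lapse m r - 1) / r ^+ 2) *: (x^T *m x)).
suff e : schwarzschild m p *m G = 1%:M by case: (mulmx1_unit e).
rewrite /schwarzschild /G -/x -/r (@mulmx_block _ 1 3 1 3 1 3).
rewrite !mulmx0 !mul0mx !addr0 !add0r.
apply: (etrans _ (esym (@scalar_mx_block R 1 3 1))); congr block_mx.
  by rewrite -scalar_mxM mulrNN divff.
rewrite mulmxDl mul1mx mulmxDr mulmx1 -scalemxAl -scalemxAr.
have -> : x^T *m x *m (x^T *m x) = r ^+ 2 *: (x^T *m x).
  by rewrite mulmxA -(mulmxA x^T) (mx11_scalar (x *m x^T)) dotE -eucl_sq mul_mx_scalar scalemxAl.
rewrite -[RHS]addr0 -addrA; congr (_ + _).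
rewrite !scalerA -scalerDl -scalerDl; set c := (X in X *: _).
have -> : c = 0 by rewrite /c; field; apply/andP.
by rewrite scale0r.
Qed.

Lemma schwarzschild_sym (m : R) (p : V4) :
  (schwarzschild m p)^T = schwarzschild m p.
Proof.
rewrite /schwarzschild (@tr_block_mx _ 1 3 1 3) tr_scalar_mx !trmx0.
have e c (x : V3) : (1%:M + c *: (x^T *m x))^T = 1%:M + c *: (x^T *m x) :> 'M[R]_3.
  by rewrite [LHS]raddfD /= [(c *: _)^T]linearZ /= trmx_mul trmxK tr_scalar_mx.
by rewrite e.
Qed.

(** The derivative along X of z |-> g_z(A, B) for constant vectors A and B. *)
Definition dmetric (m : R) x (X A B : V4) : R :=
  let r := eucl x in let h := lapse m r in
  let X' := spatial X in let A' := spatial A in let B' := spatial B in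
  let T := lshift 3 (0 : 'I_1) : 'I_4 in
  - (2 * m / r ^+ 2) * (dot x X' / r) * A 0 T * B 0 T
  + ((- (2 * m / r ^+ 2) / (h ^+ 2 * r ^+ 2) - 2 * (h^-1 - 1) / r ^+ 3)
      * (dot x X' / r) * dot x A' * dot x B'
  + kap m r * (dot X' A' * dot x B' + dot x A' * dot X' B')).

Lemma spatialE (X : V4) k : spatial X 0 k = X 0 (rshift 1 k).
Proof. by rewrite mxE. Qed.

Lemma dder_inner (m : R) (p X A B : V4) :
  spatial p != 0 -> lapse m (eucl (spatial p)) != 0 ->
  dder (fun z => inner (schwarzschild m z) A B) p X
    (dmetric m (spatial p) X A B).
Proof.
move=> x0 h0; set x := spatial p in x0 h0 *.
have r0 := eucl_gt0 x0; have rn0 := lt0r_neq0 r0.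
pose T := lshift 3 (0 : 'I_1) : 'I_4.
have -> : (fun z => inner (schwarzschild m z) A B) = fun z =>
  - lapse m (eucl (spatial z)) * A 0 T * B 0 T +
  (dot (spatial A) (spatial B) + kap m (eucl (spatial z))
     * dot (spatial z) (spatial A) * dot (spatial z) (spatial B)).
  by apply/funext => z; rewrite -{1}(eventK A) -{1}(eventK B)
    inner_schwarzschild.
have rd : dder (fun z : V4 => eucl (spatial z)) p X
    ((eucl x)^-1 * dot x (spatial X)).
  apply: dder_eq.
    apply: (dder_sqrt (f := fun z : V4 => \sum_i spatial z 0 i ^+ 2)).
      apply: (@dder_sum _ _ 3 (fun i (z : V4) => spatial z 0 i ^+ 2)) => i.
      apply: dderX.
      have -> : (fun z : V4 => spatial z 0 i) = (fun z : V4 => z 0 (rshift 1 i)).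
        by apply/funext => z; rewrite spatialE.
      exact: dder_coord.
    by move: r0; rewrite sqrtr_gt0.
  rewrite -/(eucl _) -/x /dot !mulr_sumr; apply: eq_bigr => i _ /=.
  rewrite expr1 -spatialE.
  by move: (eucl x) rn0 => r rn0; field.
have dd (C : V3) : dder (fun z : V4 => dot (spatial z) C) p X
    (dot (spatial X) C).
  apply: dder_eq.
    apply: dder_sum => i; apply: dderM; last exact: dder_cst.
    have -> : (fun z : V4 => spatial z 0 i) = (fun z : V4 => z 0 (rshift 1 i)).
      by apply/funext => z; rewrite spatialE.
    exact: dder_coord.
  by apply: eq_bigr => i _; rewrite mulr0 add0r mulrC spatialE.
have hd : dder (fun z : V4 => lapse m (eucl (spatial z))) p X
    (2 * m / eucl x ^+ 2 * (dot x (spatial X) / eucl x)).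
  apply: dder_eq.
    apply: dderB; first exact: dder_cst.
    apply: dderM; first exact: dder_cst.
    exact: dderV rd rn0.
  rewrite -/x; move: (eucl x) (dot _ _) rn0 => r d rn0; field.
  by rewrite rn0.
have kd : dder (fun z : V4 => kap m (eucl (spatial z))) p X
   ((- (2 * m / eucl x ^+ 2) / (lapse m (eucl x) ^+ 2 * eucl x ^+ 2)
     - 2 * ((lapse m (eucl x))^-1 - 1) / eucl x ^+ 3)
      * (dot x (spatial X) / eucl x)).
  apply: dder_eq.
    apply: dderM.
      apply: dderB; last exact: dder_cst.
      by apply: dderV; [exact: hd|exact: h0].
    apply: dderV; first by apply: dderX; exact: rd.
    by rewrite -/x expf_neq0.
  rewrite -/x /= expr1.
  move: (lapse m (eucl x)) h0 => h h0; move: (eucl x) (dot _ _) rn0 => r d rn0.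
  by field; rewrite rn0 h0.
apply: dder_eq.
  apply: dderD.
    apply: dderM; last exact: dder_cst.
    apply: dderM; last exact: dder_cst.
    by apply: dderN; exact: hd.
  apply: dderD; first exact: dder_cst.
  apply: dderM; last exact: dd.
  by apply: dderM; [exact: kd|exact: dd].
rewrite /dmetric -/x -/T.
move: (dot x (spatial X)) (dot x (spatial A)) (dot x (spatial B)) => a b c.
move: (dot (spatial X) (spatial A)) (dot (spatial X) (spatial B)) => d e.
move: (kap m (eucl x)) (lapse m (eucl x)) (eucl x) => k h r; ring.
Qed.

(** Lowering the index of the Christoffel symbols turns the connection term
    of the second fundamental form into three derivatives of g_z(A, B). *)
Lemma inner_cov_deriv n p (g : 'rV[R]_p.+1 -> 'M[R]_p.+1)
    (F N : 'rV[R]_n.+1 -> 'rV[R]_p.+1) i (x : 'rV[R]_n.+1) (Y : 'rV[R]_p.+1) :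
  (g (F x))^T = g (F x) -> g (F x) \in unitmx ->
  (forall a b, differentiable (fun z => g z a b) (F x)) ->
  let X := 'D_(ebase R i) F x in
  inner (g (F x)) (cov_deriv g F N i x) Y =
  inner (g (F x)) ('D_(ebase R i) N x) Y +
  2^-1 * ('D_X (fun z => inner (g z) (N x) Y) (F x)
        + 'D_(N x) (fun z => inner (g z) X Y) (F x)
        - 'D_Y (fun z => inner (g z) X (N x)) (F x)).
Proof.
move=> gT gU gd X.
have innerE (G : 'M[R]_p.+1) A B :
    inner G A B = \sum_c \sum_d A 0 c * G c d * B 0 d.
  rewrite /inner mxE exchange_big; apply: eq_bigr => d _ /=.
  by rewrite !mxE mulr_suml; apply: eq_bigr => c _.
have DE (f : 'rV[R]_p.+1 -> R) C : differentiable f (F x) ->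
    'D_C f (F x) = \sum_a C 0 a * partial a f (F x).
  move=> fd; rewrite deriveE// {1}(row_sum_delta C) linear_sum.
  by apply: eq_bigr => a _; rewrite linearZZ /partial deriveE.
have DI A B C : 'D_C (fun z => inner (g z) A B) (F x) =
    \sum_a \sum_c \sum_d
      C 0 a * A 0 c * B 0 d * partial a (fun z => g z c d) (F x).
  have -> : (fun z => inner (g z) A B) =
      (fun z => \sum_c \sum_d A 0 c * g z c d * B 0 d).
    by apply/funext => z; rewrite innerE.
  have D (v : 'rV[R]_p.+1) : dder (fun z => \sum_c \sum_d A 0 c * g z c d * B 0 d) (F x) v
     (\sum_c \sum_d A 0 c * B 0 d * 'D_v (fun z => g z c d) (F x)).
    apply: dder_sum => c; apply: dder_sum => d.
    apply: dder_eq.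
      apply: dderM; last exact: dder_cst.
      by apply: dderM; [exact: dder_cst|exact: dderE].
    by rewrite /=; ring.
  rewrite DE; last by have [] := D 0.
  apply: eq_bigr => a _; rewrite /partial; have [_ ->] := D (ebase R a).
  rewrite mulr_sumr; apply: eq_bigr => c _; rewrite mulr_sumr.
  by apply: eq_bigr => d _; rewrite !mulrA.
have -> : cov_deriv g F N i x = 'D_(ebase R i) N x +
    \row_c \sum_a \sum_b christoffel g c a b (F x) * X 0 a * N x 0 b.
  by apply/rowP => c; rewrite !mxE.
have innerD (G : 'M[R]_p.+1) A B C : inner G (A + B) C = inner G A C + inner G B C.
  by rewrite /inner !mulmxDl mxE.
rewrite innerD; congr (_ + _).
pose K a b d := partial a (fun z => g z b d) (F x)
  + partial b (fun z => g z a d) (F x) - partial d (fun z => g z a b) (F x).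
have low a b d : \sum_c christoffel g c a b (F x) * g (F x) c d = 2^-1 * K a b d.
  under eq_bigr do rewrite /christoffel -mulrA mulr_suml.
  rewrite -mulr_sumr; congr (_ * _); rewrite exchange_big /=.
  have gg l : \sum_c invmx (g (F x)) c l * g (F x) c d = (l == d)%:R.
    have := mulVmx gU => /matrixP/(_ l d); rewrite !mxE => <-.
    apply: eq_bigr => c _; congr (_ * _).
    by rewrite -[in RHS]gT -trmx_inv [RHS]mxE.
  under eq_bigr => l _.
    under eq_bigr do rewrite mulrAC.
    rewrite -mulr_suml gg; over.
  rewrite (bigD1 d)//= eqxx mul1r big1 ?addr0// => l ld.
  by rewrite (negbTE ld) mul0r.
transitivity (\sum_a \sum_b \sum_d X 0 a * N x 0 b * Y 0 d * (2^-1 * K a b d)).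
  rewrite innerE exchange_big /=.
  transitivity (\sum_d \sum_a \sum_b X 0 a * N x 0 b * Y 0 d * (2^-1 * K a b d)).
    apply: eq_bigr => d _.
    under [RHS]eq_bigr do under eq_bigr do rewrite -low mulr_sumr.
    under [RHS]eq_bigr do rewrite exchange_big /=.
    rewrite [RHS]exchange_big /=; apply: eq_bigr => c _.
    rewrite mxE !mulr_suml; apply: eq_bigr => a _.
    by rewrite !mulr_suml; apply: eq_bigr => b _; ring.
  by rewrite exchange_big; apply: eq_bigr => a _; rewrite exchange_big.
rewrite !DI [X in _ = _ * (_ + X - _)]exchange_big /=.
rewrite [X in _ = _ * (_ - X)]exchange_big /=.
rewrite -big_split -sumrB mulr_sumr /=; apply: eq_bigr => a _.
rewrite [X in _ = _ * (_ - X)]exchange_big /=.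
rewrite -big_split -sumrB mulr_sumr /=; apply: eq_bigr => b _.
rewrite -big_split -sumrB mulr_sumr /=; apply: eq_bigr => d _.
by rewrite /K; ring.
Qed.

End Ambient.

(** * The graph: induced metric, unit normal and second fundamental form *)

Section Graph.
Context {R : realType}.
Notation V3 := 'rV[R]_3.
Notation W := ('rV[R]_3 * R)%type.
Variables (m : R) (m_ge0 : 0 <= m) (U : set W) (U_open : open U)
  (P : W -> R) (P_smooth : Cinf U P).
Implicit Types (x v w : V3) (i j k : 'I_3).

Definition hfun (p : W) : R := 1 - 2 * m * p.2.
Lemma hfunE p : hfun p = 1 - 2 * m * p.2. Proof. by []. Qed.

Definition radial (p : W) : R := \sum_k p.1 0 k * Lop k P p.
Definition gradsq (p : W) : R := \sum_k Lop k P p ^+ 2.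
(** - g(grad tau, grad tau), where tau = t - u; it is also the determinant of
    the induced metric in the chart. *)
Definition lapsq (p : W) : R :=
  2 * radial p - gradsq p + 2 * m * p.2 * radial p ^+ 2.

Lemma lapsqE p :
  lapsq p = 2 * radial p - gradsq p + 2 * m * p.2 * radial p ^+ 2.
Proof. by []. Qed.

(** Points of the exterior region over which the graph is spacelike. *)
Definition good x : Prop :=
  [/\ x != 0, 2 * m < eucl x, U (sph x) & 0 < lapsq (sph x)].

Lemma Cinf_radial : Cinf U radial.
Proof.
apply: Cinf_sum => // k; apply: CinfM => //; first exact: Cinf_fst.
exact: Cinf_Lop.
Qed.

Lemma Cinf_gradsq : Cinf U gradsq.
Proof. by apply: Cinf_sum => // k; apply: CinfX => //; exact: Cinf_Lop. Qed.

Lemma Cinf_lapsq : Cinf U lapsq.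
Proof.
apply: CinfD => //.
  apply: CinfB => //; last exact: Cinf_gradsq.
  by apply: CinfM => //; [exact: Cinf_cst|exact: Cinf_radial].
apply: CinfM => //; last by apply: CinfX => //; exact: Cinf_radial.
by apply: CinfM => //; [exact: Cinf_cst|exact: Cinf_snd].
Qed.

Lemma hat_dder f x i : Cinf U f -> x != 0 -> U (sph x) ->
  dder (fun z => f (sph z)) x (ebase R i) (Lop i f (sph x)).
Proof. by move=> fs x0 Ux; apply: dder_hat => //; exact: Cinf_diff Ux. Qed.

Lemma sph_sphere x : x != 0 -> sphere2 (sph x).1.
Proof. exact: normalize_sphere. Qed.

Lemma dder_y x i k : x != 0 ->
  dder (fun z => (sph z).1 0 k) x (ebase R i)
   ((sph x).2 * ((i == k)%:R - (sph x).1 0 i * (sph x).1 0 k)).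
Proof.
move=> x0; set p := sph x.
have fd : differentiable (fun q : W => q.1 0 k) (sph x).
  by have [] := dder_fst (sph x) 0 k.
apply: dder_eq (dder_hat i x0 fd) _.
rewrite /Lop /tang /ds -/p.
have -> : 'D_es (fun q : W => q.1 0 k) p = 0.
  by have [_ ->] := dder_fst p es k; rewrite mxE.
have D l : 'D_(ez l) (fun q : W => q.1 0 k) p = (l == k)%:R.
  by have [_ ->] := dder_fst p (ez l) k; rewrite ebaseE.
rewrite mulr0 subr0 D; congr (_ * (_ - _ * _)).
rewrite (bigD1 k)//= D eqxx mulr1 big1 ?addr0// => l lk.
by rewrite D (negbTE lk) mulr0.
Qed.

Lemma dder_s x i : x != 0 ->
  dder (fun z => (sph z).2) x (ebase R i) (- ((sph x).2 ^+ 2 * (sph x).1 0 i)).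
Proof.
move=> x0; set p := sph x.
have fd : differentiable (fun q : W => q.2) (sph x).
  by have [] := dder_snd (sph x) 0.
apply: dder_eq (dder_hat i x0 fd) _.
rewrite /Lop /tang /ds -/p.
have -> : 'D_es (fun q : W => q.2) p = 1 by have [_ ->] := dder_snd p es.
have D l : 'D_(ez l) (fun q : W => q.2) p = 0 by have [_ ->] := dder_snd p (ez l).
rewrite D big1 ?mulr0 => [|l _]; last by rewrite D mulr0.
by rewrite subr0 mulr0 sub0r mulr1.
Qed.

Lemma hfun_gt0 x : x != 0 -> 2 * m < eucl x -> 0 < hfun (sph x).
Proof.
by move=> x0 mx; rewrite /hfun /sph /= subr_gt0 ltr_pdivrMr ?mul1r// eucl_gt0.
Qed.

Lemma sph_cont x : x != 0 -> {for x, continuous (@sph R)}.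
Proof.
move=> x0; apply: differentiable_continuous; apply: differentiable_pair.
  have [] // := @vder_row _ _ _ (fun z => (sph z).1) x (ebase R 0)
    (\row_k ((sph x).2 * ((0 == k)%:R - (sph x).1 0 0 * (sph x).1 0 k))).
  by move=> k; rewrite mxE; exact: dder_y.
by have [] := dder_s 0 x0.
Qed.

Lemma eucl_cont x : x != 0 -> {for x, continuous (@eucl R 3)}.
Proof.
by move=> x0; apply: differentiable_continuous; have [] := dder_eucl 0 x0.
Qed.

Lemma near_sph x : x != 0 -> U (sph x) -> \near x, x != 0 /\ U (sph x).
Proof.
move=> x0 Ux; have ec := eucl_cont x0; have sc := sph_cont x0.
have near_x0 : \near x, x != 0.
  have : \near x, 0 < eucl x by exact: (ec [set z | 0 < z] (lt_nbhsr (eucl_gt0 x0))).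
  apply: filterS => z z0; apply: contraTneq z0 => ->.
  by rewrite eucl0 ltxx.
have near_U : \near x, U (sph x) by exact: (sc U (near_open U_open Ux)).
by near=> z; split; near: z.
Unshelve. all: by end_near. Qed.

Lemma near_good x : good x -> \near x, good x.
Proof.
move=> [x0 mx Ux wx].
have ec := eucl_cont x0; have sc := sph_cont x0.
have near_xU := near_sph x0 Ux.
have near_m : \near x, 2 * m < eucl x.
  exact: (ec [set z | 2 * m < z] (lt_nbhsr mx)).
have near_w : \near x, 0 < lapsq (sph x).
  have lc := Cinf_cont Cinf_lapsq Ux.
  exact: (sc [set p | 0 < lapsq p] (lc [set z | 0 < z] (lt_nbhsr wx))).
near=> z; have [z0 Uz] : z != 0 /\ U (sph z) by near: z.
by split; [exact: z0|near: z|exact: Uz|near: z].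
Unshelve. all: by end_near. Qed.

Lemma is_derive_tortoise (r : R) : 2 * m < r ->
  is_derive r 1 (tortoise m) (lapse m r)^-1.
Proof.
move=> mr; have r0 : 0 < r by apply: le_lt_trans mr; rewrite mulr_ge0.
have rn0 := lt0r_neq0 r0.
have [m0|m0] := eqVneq m 0.
  have -> : tortoise m = id.
    by apply/funext => z; rewrite /tortoise m0 mulr0 mul0r addr0.
  by rewrite /lapse m0 mulr0 mul0r subr0 invr1; exact: is_derive_id.
have mp : 0 < m by rewrite lt_neqAle eq_sym m0.
have q0 (z : R) : 2 * m < z -> 0 < z / (2 * m) - 1.
  by move=> mz; rewrite subr_gt0 ltr_pdivlMr ?mul1r// mulr_gt0.
suff D : is_derive r 1 (fun z => z + 2 * m * ln (z / (2 * m) - 1)) (lapse m r)^-1.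
  apply: near_eq_is_derive D.
  have : \forall z \near r, 2 * m < z by exact: lt_nbhsr.
  by apply: filterS => z mz; rewrite /tortoise ger0_norm// ltW// q0.
have idd : dder (fun z : R => z) r 1 1.
  by split; [apply/derivable1_diffP; exact: derivable_id|exact: derive_id].
have [d e] : dder (fun z : R => z + 2 * m * ln (z / (2 * m) - 1)) r 1
    (lapse m r)^-1.
  apply: dder_eq.
    apply: dderD; first exact: idd.
    apply: dderM; first exact: dder_cst.
    apply: (dder_comp1 (g := @ln R)).
      apply: dderB; last exact: dder_cst.
      by apply: dderM; [exact: idd|exact: dder_cst].
    exact: is_derive1_ln (q0 _ mr).
  rewrite /lapse /=; field.
  by rewrite m0 rn0 !subr_eq0 !gt_eqF.
by move/derivable1_diffP: d => d; exact: DeriveDef d e.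
Qed.

Definition ucomp (p : W) i : R := (hfun p)^-1 * p.1 0 i - Lop i P p.

Lemma dder_height x i : x != 0 -> 2 * m < eucl x -> U (sph x) ->
  dder (height m P) x (ebase R i) (ucomp (sph x) i).
Proof.
move=> x0 mx Ux.
apply: dder_eq.
  apply: dderB; last exact: hat_dder.
  exact: (dder_comp1 (g := tortoise m) (dder_eucl _ x0) (is_derive_tortoise mx)).
by rewrite dot_ebase /ucomp /= mxE.
Qed.

Lemma vder_surface x i : x != 0 -> 2 * m < eucl x -> U (sph x) ->
  differentiable (surface m P) x /\
  'D_(ebase R i) (surface m P) x = event (ucomp (sph x) i) (ebase R i).
Proof.
move=> x0 mx Ux; apply: vder_row => c.
case: (@split_ordP 1 3 c) => k ->.
  have -> : k = 0 by rewrite (ord1 k).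
  rewrite eventE0; apply: (dder_ext (f := height m P)); last exact: dder_height.
  by move=> z; rewrite /surface eventE0.
rewrite eventES; apply: (dder_ext (f := fun z : V3 => z 0 k)).
  by move=> z; rewrite /surface eventES.
exact: dder_coord.
Qed.

Lemma kapE x : x != 0 -> 2 * m < eucl x ->
  kap m (eucl x) = ((hfun (sph x))^-1 - 1) * (sph x).2 ^+ 2.
Proof. by move=> x0 mx; rewrite /kap /= -exprVn. Qed.

Lemma metricG_entry x i j : x != 0 -> 2 * m < eucl x -> U (sph x) ->
  let p := sph x in
  metricG m P x i j = (i == j)%:R - p.1 0 i * p.1 0 j
    + p.1 0 i * Lop j P p + Lop i P p * p.1 0 j
    - hfun p * Lop i P p * Lop j P p.
Proof.
move=> x0 mx Ux p; rewrite /metricG /induced_metric mxE.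
have [_ ->] := vder_surface i x0 mx Ux; have [_ ->] := vder_surface j x0 mx Ux.
rewrite inner_schwarzschild /surface spatial_event kapE// -/p.
rewrite !dot_ebase ebaseE /ucomp -/p.
have h0 : hfun p != 0 by rewrite gt_eqF// hfun_gt0.
have -> : lapse m (eucl x) = hfun p by [].
have xE k : x 0 k = eucl x * p.1 0 k.
  by rewrite mxE mulrA mulfV ?mul1r// gt_eqF// eucl_gt0.
have sE : p.2 = (eucl x)^-1 by [].
rewrite !xE sE; move: (p.1 0 i) (p.1 0 j) (Lop i P p) (Lop j P p) => yi yj pi pj.
have := lt0r_neq0 (eucl_gt0 x0); move: (eucl x) ((i == j)%:R) => r d r0.
by move: (hfun p) h0 => h h0; field; rewrite h0 r0.
Qed.

(** The spatial components of - grad tau. *)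
Definition nu (p : W) k : R :=
  (1 + 2 * m * p.2 * radial p) * p.1 0 k - Lop k P p.

Lemma nu_def p k :
  nu p k = (1 + 2 * m * p.2 * radial p) * p.1 0 k - Lop k P p.
Proof. by []. Qed.

Definition nuvec (p : W) : V3 := \row_k nu p k.

Lemma unit_normalE x : good x ->
  unit_normal m P x =
  (Num.sqrt (lapsq (sph x)))^-1 *: event (hfun (sph x))^-1 (nuvec (sph x)).
Proof.
move=> [x0 mx Ux wx]; set p := sph x in Ux wx *.
have r0 := lt0r_neq0 (eucl_gt0 x0).
have h0 : hfun p != 0 by rewrite gt_eqF// hfun_gt0.
have hE : lapse m (eucl x) = hfun p by [].
have yy : dot p.1 p.1 = 1 by apply: sphere_dot; exact: sph_sphere.
have xE : x = eucl x *: p.1 by rewrite scalerA mulfV ?scale1r.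
have sE : p.2 = (eucl x)^-1 by [].
pose q : V3 := \row_k Lop k P p.
have qE k : q 0 k = Lop k P p by rewrite mxE.
have rE : radial p = dot p.1 q by apply: eq_bigr => k _; rewrite qE.
have gE : gradsq p = dot q q by apply: eq_bigr => k _; rewrite qE expr2.
have conE : conormal m P x = event 1 (- ((hfun p)^-1 *: p.1 - q)).
  rewrite /conormal; congr (event _ (- _)); apply/rowP => k.
  rewrite mxE /partial; have [_ ->] := dder_height k x0 mx Ux.
  by rewrite [RHS]mxE [X in _ = X + _]mxE [X in _ = _ + X]mxE qE.
have nuE : nuvec p = (1 + 2 * m * p.2 * radial p) *: p.1 - q.
  apply/rowP => k; rewrite mxE /nu.
  by rewrite [RHS]mxE [X in _ = X + _]mxE [X in _ = _ + X]mxE qE.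
set g := schwarzschild m (surface m P x).
have gU : g \in unitmx.
  by apply: schwarzschild_unit; rewrite /surface spatial_event.
have mE : 2 * m * p.2 = 1 - hfun p by rewrite /hfun; ring.
rewrite mE in nuE.
have nx : dot (nuvec p) x = eucl x * (1 + (1 - hfun p) * radial p - radial p).
  rewrite nuE {1}xE dotZr; congr (_ * _).
  by rewrite dotDl dotZl dotNl (dotC q) -rE yy mulr1.
have wg : conormal m P x *m invmx g = - event (hfun p)^-1 (nuvec p).
  apply: (canLR (mulmxK gU)); rewrite eventN schwarzschild_mul /surface spatial_event.
  rewrite conE hE mulrNN mulfV//; congr event.
  rewrite kapE// -/p dotNl nx sE {3}xE nuE.
  move: (p.1) (q : V3) (radial p) => y q' a.
  move: (hfun p) (eucl x) h0 r0 => h r h0 r0.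
  by apply/rowP => k; rewrite !mxE; field; rewrite h0 r0.
have ww : inner (invmx g) (conormal m P x) (conormal m P x) = - lapsq p.
  rewrite /inner wg conE eventN event_dot mulr1.
  rewrite /lapsq mE gE nuE; move: (p.1) yy rE => y yy rE.
  rewrite !(dotDl, dotDr, dotNl, dotNr, dotZl, dotZr) yy (dotC q y) -rE -gE.
  by move: (radial p) (gradsq p) (hfun p) h0 => a b h h0; field.
by rewrite /unit_normal -/g ww opprK wg scaleNr scalerN opprK.
Qed.

End Graph.

Arguments sph : simpl never.

Section SecondForm.
Context {R : realType}.
Notation V3 := 'rV[R]_3.
Notation W := ('rV[R]_3 * R)%type.
Variables (m : R) (m_ge0 : 0 <= m) (U : set W) (U_open : open U)
  (P : W -> R) (P_smooth : Cinf U P).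
Implicit Types (x v w : V3) (i j k : 'I_3).
Local Notation hfun := (hfun m).
Local Notation radial := (radial P).
Local Notation lapsq := (lapsq m P).
Local Notation nu := (nu m P).
Local Notation nuvec := (nuvec m P).
Local Notation good := (good m U P).

Lemma inner_ebase n (G : 'M[R]_n.+1) a b : inner G (ebase R a) (ebase R b) = G a b.
Proof. by rewrite /inner /ebase trmx_delta -rowE -colE !mxE. Qed.

Lemma dder_radial x i : x != 0 -> U (sph x) ->
  let p := sph x in
  dder (fun z => radial (sph z)) x (ebase R i)
    (\sum_k p.1 0 k * Lop i (Lop k P) p
      + p.2 * (Lop i P p - p.1 0 i * radial p)).
Proof.
move=> x0 Ux p.
have D k : dder (fun z => (sph z).1 0 k * Lop k P (sph z)) x (ebase R i)
    (p.1 0 k * Lop i (Lop k P) p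
     + Lop k P p * (p.2 * ((i == k)%:R - p.1 0 i * p.1 0 k))).
  apply: dderM; first exact: dder_y.
  by apply: (hat_dder i _ x0 Ux); exact: Cinf_Lop.
apply: dder_eq (dder_sum D) _.
rewrite big_split; congr (_ + _); move: p {D} => p.
transitivity (p.2 * \sum_k (Lop k P p * (i == k)%:R - p.1 0 i * (p.1 0 k * Lop k P p))).
  by rewrite mulr_sumr; apply: eq_bigr => k _; ring.
rewrite sumrB -mulr_sumr; congr (_ * (_ - _)).
rewrite (bigD1 i)//= eqxx mulr1 big1 ?addr0// => k ki.
by rewrite eq_sym (negbTE ki) mulr0.
Qed.

Definition dnu (p : W) (A : R) i k : R :=
  A * p.1 0 k
  + (1 + 2 * m * p.2 * radial p) * (p.2 * ((i == k)%:R - p.1 0 i * p.1 0 k))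
  - Lop i (Lop k P) p.

(** The left-hand side is [inner_cov_deriv] for the graph, written out in
    components. The derivative dl of the factor l that normalizes the normal
    drops out, since the normal is orthogonal to the surface. *)
Lemma second_form_algebra (r h yi yj pi pj pr d hij q l dl : R) :
  r != 0 -> h != 0 ->
  let s := r^-1 in let m := (1 - h) * r / 2 in let k := (h^-1 - 1) * s ^+ 2 in
  let ui := h^-1 * yi - pi in let uj := h^-1 * yj - pj in
  let A := 2 * m * (- (s ^+ 2 * yi)) * pr + 2 * m * s * (q + s * (pi - yi * pr)) in
  let b := 1 + 2 * m * s * pr in
  let ni := b * yi - pi in let nj := b * yj - pj in
  let ny := b - pr in
  let dh := - (2 * m * s ^+ 2 * yi) / h ^+ 2 in
  let c1 := - (2 * m / r ^+ 2) / (h ^+ 2 * r ^+ 2) - 2 * (h^-1 - 1) / r ^+ 3 in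
  - h * (dl * h^-1 + l * dh) * uj
    + (dl * nj + l * (A * yj + b * (s * (d - yi * yj)) - hij)
       + k * (r * (dl * ny + l * (A - q))) * (r * yj))
  + 2^-1 * (
    (- (2 * m / r ^+ 2) * (r * yi / r) * (l * h^-1) * uj
     + (c1 * (r * yi / r) * (l * (r * ny)) * (r * yj)
        + k * (l * ni * (r * yj) + l * (r * ny) * d)))
    + (- (2 * m / r ^+ 2) * (l * (r * ny) / r) * ui * uj
     + (c1 * (l * (r * ny) / r) * (r * yi) * (r * yj)
        + k * (l * ni * (r * yj) + (r * yi) * (l * nj))))
    - (- (2 * m / r ^+ 2) * (r * yj / r) * ui * (l * h^-1)
     + (c1 * (r * yj / r) * (r * yi) * (l * (r * ny))
        + k * (d * (l * (r * ny)) + (r * yi) * (l * nj)))))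
  = l * (s * (d - yi * yj) * b - hij
     - m * s ^+ 2 * (pr * (yi * pj + pi * yj) + (1 - h * pr) * pi * pj)).
Proof. by move=> r0 h0; cbv zeta; field; rewrite r0 h0. Qed.

Lemma dder_nu x i k : x != 0 -> U (sph x) ->
  let p := sph x in
  let A := 2 * m * (- (p.2 ^+ 2 * p.1 0 i)) * radial p
    + 2 * m * p.2 * (\sum_k p.1 0 k * Lop i (Lop k P) p
                     + p.2 * (Lop i P p - p.1 0 i * radial p)) in
  dder (fun z => nu (sph z) k) x (ebase R i) (dnu p A i k).
Proof.
move=> x0 Ux p A.
have Ds := dder_s i x0; rewrite -/p in Ds.
have Dr := dder_radial i x0 Ux; rewrite -/p in Dr.
have Dy := dder_y i k x0; rewrite -/p in Dy.
have DL : dder (fun z => Lop k P (sph z)) x (ebase R i) (Lop i (Lop k P) p).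
  by apply: (hat_dder i _ x0 Ux); exact: Cinf_Lop.
have D := dderB (dderM (dderD (dder_cst 1 x (ebase R i))
  (dderM (dderM (dder_cst (2 * m) x (ebase R i)) Ds) Dr)) Dy) DL.
apply: dder_eq D _; rewrite /dnu /A -/p.
by move: (sph x) p {A} Ds Dr Dy DL => ? p *; ring.
Qed.

Lemma vder_unit_normal x i : good x ->
  let p := sph x in
  let A := 2 * m * (- (p.2 ^+ 2 * p.1 0 i)) * radial p
    + 2 * m * p.2 * (\sum_k p.1 0 k * Lop i (Lop k P) p
                     + p.2 * (Lop i P p - p.1 0 i * radial p)) in
  let l := (Num.sqrt (lapsq p))^-1 in
  exists dl, 'D_(ebase R i) (unit_normal m P) x =
    event (dl * (hfun p)^-1 + l * (- (2 * m * p.2 ^+ 2 * p.1 0 i) / hfun p ^+ 2))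
     (dl *: nuvec p + l *: \row_k dnu p A i k).
Proof.
move=> gx p A l; have [x0 mx Ux wx] := gx.
have h0 : hfun p != 0 by rewrite gt_eqF// hfun_gt0.
have Dw : dder (fun z => lapsq (sph z)) x (ebase R i) (Lop i lapsq p).
  by apply: (hat_dder i _ x0 Ux); exact: Cinf_lapsq.
have ln0 : Num.sqrt (lapsq p) != 0 by rewrite gt_eqF// sqrtr_gt0.
have Dl := dderV (dder_sqrt Dw wx) ln0; set dl := (X in dder _ _ _ X) in Dl.
exists dl.
have Dh : dder (fun z => (hfun (sph z))^-1) x (ebase R i)
    (- (2 * m * p.2 ^+ 2 * p.1 0 i) / hfun p ^+ 2).
  apply: dder_eq (dderV (dderB (dder_cst 1 x (ebase R i))
    (dderM (dder_cst (2 * m) x (ebase R i)) (dder_s i x0))) h0) _.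
  rewrite -/p -/(hfun p); move: (hfun p) h0 (p.2) (p.1 0 i) => h h0 s y.
  by field.
have NE : \near x, event ((Num.sqrt (lapsq (sph x)))^-1 * (hfun (sph x))^-1)
      ((Num.sqrt (lapsq (sph x)))^-1 *: nuvec (sph x)) = unit_normal m P x.
  apply: filterS (near_good U_open P_smooth gx) => z gz.
  by rewrite (unit_normalE m_ge0 P_smooth gz) eventZ.
rewrite -(near_eq_derive _ NE).
pose Nf (z : V3) := event ((Num.sqrt (lapsq (sph z)))^-1 * (hfun (sph z))^-1)
      ((Num.sqrt (lapsq (sph z)))^-1 *: nuvec (sph z)).
suff [_ //] : differentiable Nf x /\ 'D_(ebase R i) Nf x =
    event (dl * (hfun p)^-1 + l * (- (2 * m * p.2 ^+ 2 * p.1 0 i) / hfun p ^+ 2))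
     (dl *: nuvec p + l *: \row_k dnu p A i k).
apply: vder_row => c; case: (@split_ordP 1 3 c) => k ->.
  have -> : k = 0 by rewrite (ord1 k).
  rewrite eventE0; apply: (dder_ext (f := fun z =>
    (Num.sqrt (lapsq (sph z)))^-1 * (hfun (sph z))^-1)).
    by move=> z; rewrite eventE0.
  by apply: dder_eq (dderM Dl Dh) _; rewrite addrC mulrC.
rewrite eventES; apply: (dder_ext (f := fun z =>
    (Num.sqrt (lapsq (sph z)))^-1 * nu (sph z) k)).
  by move=> z; rewrite eventES !mxE.
apply: dder_eq (dderM Dl (dder_nu i k x0 Ux)) _.
have -> : (dl *: nuvec p + l *: \row_k dnu p A i k) 0 k =
    dl * nu p k + l * dnu p A i k by rewrite !mxE.
by rewrite [LHS]addrC; congr (_ + _); exact: mulrC.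
Qed.

(** The second fundamental form of the graph before normalization; the
    inverse powers of h, singular on the horizon, have cancelled. *)
Definition Wsecond (p : W) i j : R :=
  p.2 * ((i == j)%:R - p.1 0 i * p.1 0 j) * (1 + 2 * m * p.2 * radial p)
  - Lop i (Lop j P) p
  - m * p.2 ^+ 2 * (radial p * (p.1 0 i * Lop j P p + Lop i P p * p.1 0 j)
      + (1 - hfun p * radial p) * Lop i P p * Lop j P p).

Lemma secondA_entry x i j : good x ->
  secondA m P x i j = (Num.sqrt (lapsq (sph x)))^-1 * Wsecond (sph x) i j.
Proof.
move=> gx; have [x0 mx Ux wx] := gx.
set p := sph x in Ux wx *.
have r0 := lt0r_neq0 (eucl_gt0 x0).
have h0 : hfun p != 0 by rewrite gt_eqF// hfun_gt0.
have hE : lapse m (eucl x) = hfun p by [].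
have sxE : spatial (surface m P x) = x by rewrite /surface spatial_event.
have hl0 : lapse m (eucl (spatial (surface m P x))) != 0 by rewrite sxE hE.
have hx0 : spatial (surface m P x) != 0 by rewrite sxE.
have [_ DF] := vder_surface m_ge0 P_smooth i x0 mx Ux.
have [_ DFj] := vder_surface m_ge0 P_smooth j x0 mx Ux.
have [dl DN] := vder_unit_normal i gx; rewrite -/p in DN.
set A := (X in \row_k dnu p X i k) in DN.
set l := (Num.sqrt (lapsq p))^-1 in DN.
rewrite /secondA /second_form mxE inner_cov_deriv.
- rewrite DF DFj DN.
  rewrite (unit_normalE m_ge0 P_smooth gx) eventZ -/p -/l inner_schwarzschild sxE.
  have [_ ->] := dder_inner (event (ucomp m P p i) (ebase R i))
    (event (l * (hfun p)^-1) (l *: nuvec p)) (event (ucomp m P p j) (ebase R j))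
    hx0 hl0.
  have [_ ->] := dder_inner (event (l * (hfun p)^-1) (l *: nuvec p))
    (event (ucomp m P p i) (ebase R i)) (event (ucomp m P p j) (ebase R j))
    hx0 hl0.
  have [_ ->] := dder_inner (event (ucomp m P p j) (ebase R j))
    (event (ucomp m P p i) (ebase R i)) (event (l * (hfun p)^-1) (l *: nuvec p))
    hx0 hl0.
  rewrite /dmetric !sxE !spatial_event !eventE0 hE.
  have yy : dot p.1 p.1 = 1 by apply: sphere_dot; exact: sph_sphere.
  have xE : x = eucl x *: p.1 by rewrite scalerA mulfV ?scale1r.
  have xdot v : dot x v = eucl x * dot p.1 v by rewrite {1}xE dotZl.
  have sE : p.2 = (eucl x)^-1 by [].
  have mE : m = (1 - hfun p) * eucl x / 2 by rewrite hfunE sE; field.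
  have kE : kap m (eucl x) = ((hfun p)^-1 - 1) * (eucl x)^-1 ^+ 2.
    by rewrite kapE// -sE.
  have nuE k : nuvec p 0 k = nu p k by rewrite mxE.
  have dnuE k : (\row_k dnu p A i k) 0 k = dnu p A i k by rewrite mxE.
  rewrite -/p; clearbody p.
  have ynu : dot p.1 (nuvec p) = 1 + 2 * m * p.2 * radial p - radial p.
    rewrite /dot; transitivity (\sum_k ((1 + 2 * m * p.2 * radial p)
        * (p.1 0 k * p.1 0 k) - p.1 0 k * Lop k P p)).
      by apply: eq_bigr => k _; rewrite nuE nu_def; ring.
    by rewrite sumrB -mulr_sumr -/(dot p.1 p.1) yy mulr1.
  have ydnu : dot p.1 (\row_k dnu p A i k) =
      A - \sum_k p.1 0 k * Lop i (Lop k P) p.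
    rewrite /dot; transitivity (\sum_k ((A - (1 + 2 * m * p.2 * radial p)
         * p.2 * p.1 0 i) * (p.1 0 k * p.1 0 k)
        + (1 + 2 * m * p.2 * radial p) * p.2 * (p.1 0 k * (i == k)%:R)
        - p.1 0 k * Lop i (Lop k P) p)).
      by apply: eq_bigr => k _; rewrite dnuE /dnu; ring.
    rewrite sumrB big_split /= -!mulr_sumr -/(dot p.1 p.1) yy.
    have -> : \sum_k p.1 0 k * (i == k)%:R = p.1 0 i.
      by rewrite -(dot_ebase p.1 i); apply: eq_bigr => k _; rewrite ebaseE.
    by ring.
  move: (nuvec p) (\row_k dnu p A i k) nuE dnuE ynu ydnu => nv dv nuE dnuE ynu ydnu.
  rewrite !xdot !(dotDl, dotDr, dotZl, dotZr) ynu ydnu.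
  rewrite (dotC (ebase R i) nv) !dot_ebase.
  rewrite (dotC (ebase R j) nv) !dot_ebase !ebaseE.
  rewrite !nuE !dnuE /dnu !nu_def /Wsecond /ucomp kE /A sE.
  move: (p.1 0 i) (p.1 0 j) (Lop i P p) (Lop j P p) (radial p) => yi yj pi pj pr.
  rewrite ?(eq_sym j i).
  move: ((i == j)%:R) (Lop i (Lop j P) p) => d hij.
  move: (\sum_k _) l dl {DN} => q l dl.
  have := @second_form_algebra (eucl x) (hfun p) yi yj pi pj pr d hij q l dl r0 h0.
  cbv zeta; rewrite -mE => H.
  rewrite -[RHS]H; move: (hfun p) (eucl x) h0 r0 {H} => h r h0 r0.
  by field; rewrite r0 h0.
- exact: schwarzschild_sym.
- by apply: schwarzschild_unit; rewrite sxE ?hE.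
- move=> a b; have -> : (fun z => schwarzschild m z a b) =
    (fun z => inner (schwarzschild m z) (ebase R a) (ebase R b)).
    by apply/funext => z; rewrite inner_ebase.
  by have [] := dder_inner 0 (ebase R a) (ebase R b) hx0 hl0.
Qed.

End SecondForm.

(** * Scalar curvature *)

Section Curvature.
Context {R : realType}.
Variables (n : nat) (g : 'rV[R]_n.+1 -> 'M[R]_n.+1) (x : 'rV[R]_n.+1).
Notation I := 'I_n.+1.
(** C and dC are the Christoffel symbols of the first kind and their
    derivatives at x, given independently of the inverse metric. *)
Variables (C : I -> I -> I -> 'rV[R]_n.+1 -> R) (dC : I -> I -> I -> I -> R).
Hypothesis g_sym : forall z, (g z)^T = g z.
Hypothesis g_unit : \near x, g x \in unitmx.
Hypothesis g_diff : forall i j, differentiable (fun z => g z i j) x.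
Hypothesis C_first_kind : \near x, forall l i j,
  partial i (fun z => g z j l) x + partial j (fun z => g z i l) x
  - partial l (fun z => g z i j) x = 2 * C l i j x.
Hypothesis Gam_diff : forall k i j, differentiable (christoffel g k i j) x.
Hypothesis C_der : forall a l i j,
  dder (C l i j) x (ebase R a) (dC a l i j).

Local Notation Q := (invmx (g x)).
Local Notation Gam k i j := (christoffel g k i j x).

Let gx_unit : g x \in unitmx. Proof. exact: nbhs_singleton g_unit. Qed.

Let lower z l i j : g z \in unitmx ->
  (forall l i j, partial i (fun z => g z j l) z + partial j (fun z => g z i l) z
    - partial l (fun z => g z i j) z = 2 * C l i j z) ->
  \sum_k g z l k * christoffel g k i j z = C l i j z.
Proof.
move=> gU CE; under eq_bigr => k _.
  rewrite /christoffel mulrCA; under eq_bigr do rewrite CE; over.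
rewrite -mulr_sumr; under eq_bigr do rewrite mulr_sumr.
rewrite exchange_big /=.
have gg q : \sum_k g z l k * invmx (g z) k q = (l == q)%:R.
  by have := mulmxV gU => /matrixP/(_ l q); rewrite !mxE.
under eq_bigr => q _.
  under eq_bigr do rewrite mulrA.
  rewrite -mulr_suml gg; over.
rewrite (bigD1 l)//= eqxx mul1r big1 ?addr0.
  by rewrite mulrA mulVf ?mul1r// pnatr_eq0.
by move=> q ql; rewrite eq_sym (negbTE ql) mul0r.
Qed.

Let Cx l i j : partial i (fun z => g z j l) x + partial j (fun z => g z i l) x
    - partial l (fun z => g z i j) x = 2 * C l i j x.
Proof. by have := nbhs_singleton C_first_kind; exact. Qed.

Let dg a l k : partial a (fun z => g z l k) x = C l a k x + C k a l x.
Proof.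
have sym i j : (fun z => g z i j) = (fun z => g z j i).
  by apply/funext => z; rewrite -{1}(g_sym z) mxE.
have two : (2 : R) != 0 by rewrite pnatr_eq0.
apply: (mulfI two); rewrite mulrDr -!Cx (sym l k) (sym a l) (sym a k) (sym l a).
rewrite (sym k a); ring.
Qed.

Let dGam a k i j := partial a (christoffel g k i j) x.

Let dlower a l i j :
  \sum_k g x l k * dGam a k i j =
  dC a l i j - \sum_k (C l a k x + C k a l x) * Gam k i j.
Proof.
have near_eq : \near x, \sum_k g x l k * christoffel g k i j x = C l i j x.
  near=> z; apply: lower; near: z => //.
have D : dder (fun z => \sum_k g z l k * christoffel g k i j z) x (ebase R a)
   (\sum_k (g x l k * dGam a k i j + Gam k i j * partial a (fun z => g z l k) x)).
  by apply: dder_sum => k; apply: dderM; exact: dderE.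
have [_ e1] := D; have [_ e2] := C_der a l i j.
have e3 : 'D_(ebase R a) (fun z => \sum_k g z l k * christoffel g k i j z) x =
    'D_(ebase R a) (C l i j) x by apply: near_eq_derive.
rewrite -e2 -e3 e1 big_split /= -addrA; apply/eqP.
rewrite -subr_eq0 opprD addrA subrr add0r oppr_eq0 subr_eq0; apply/eqP.
by apply: eq_bigr => k _; rewrite dg mulrC.
Unshelve. all: by end_near. Qed.

Let raise (F : I -> R) k : \sum_l Q k l * (\sum_q g x l q * F q) = F k.
Proof.
under eq_bigr do rewrite mulr_sumr.
rewrite exchange_big /=.
have gg q : \sum_l Q k l * g x l q = (k == q)%:R.
  by have := mulVmx gx_unit => /matrixP/(_ k q); rewrite !mxE.
under eq_bigr => q _.
  under eq_bigr do rewrite mulrA.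
  rewrite -mulr_suml gg; over.
rewrite (bigD1 k)//= eqxx mul1r big1 ?addr0// => q qk.
by rewrite eq_sym (negbTE qk) mul0r.
Qed.

Let raiseC k i j : \sum_l Q k l * C l i j x = Gam k i j.
Proof.
rewrite -(raise (fun k => Gam k i j)); apply: eq_bigr => l _; congr (_ * _).
by rewrite lower.
Qed.

(** The Riemann tensor with all its indices lowered. *)
Definition riem (l i k j : I) : R := dC k l i j - dC j l i k
  - \sum_q (C q k l x * Gam q i j - C q j l x * Gam q i k).

Let dGamE a k i j : dGam a k i j =
  \sum_l Q k l * (dC a l i j - \sum_q C q a l x * Gam q i j)
  - \sum_q Gam k a q * Gam q i j.
Proof.
rewrite -[LHS](raise (fun k => dGam a k i j)).
under eq_bigr do rewrite dlower.
have -> : \sum_q Gam k a q * Gam q i j =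
    \sum_l Q k l * \sum_q C l a q x * Gam q i j.
  under [RHS]eq_bigr do rewrite mulr_sumr.
  rewrite exchange_big; apply: eq_bigr => q _ /=.
  rewrite -(raiseC k a q) mulr_suml; apply: eq_bigr => l _.
  exact: esym (mulrA _ _ _).
rewrite -sumrB; apply: eq_bigr => l _; rewrite -mulrBr; congr (_ * _).
rewrite -addrA -opprD -big_split; congr (_ - _); apply: eq_bigr => q _ /=.
by rewrite mulrDl addrC.
Qed.

(** Differentiating g Gamma = C eliminates the derivatives of the inverse
    metric from the definition of the Ricci tensor. *)
Lemma scalar_curvature_riem :
  scalar_curvature g x = \sum_i \sum_j \sum_k \sum_l Q i j * Q k l * riem l i k j.
Proof.
apply: eq_bigr => i _; apply: eq_bigr => j _.
suff -> : ricci g i j x = \sum_k \sum_l Q k l * riem l i k j.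
  rewrite mulr_sumr; apply: eq_bigr => k _; rewrite mulr_sumr.
  by apply: eq_bigr => l _; rewrite mulrA.
rewrite /ricci -big_split /=; apply: eq_bigr => k _.
rewrite -/(dGam k k i j) -/(dGam j k i k) !dGamE.
rewrite sumrB opprD opprK.
set a := \sum_l Q k l * _; set b := \sum_q _; set c := \sum_l Q k l * _.
set d := \sum_q _; transitivity (a - c); first by ring.
rewrite /a /c -sumrB; apply: eq_bigr => l _; rewrite -mulrBr /riem sumrB.
by congr (_ * _); ring.
Qed.

End Curvature.

(** * Linear algebra of the induced metric *)

Section InverseMetric.
Context {R : realType}.
Notation V3 := 'rV[R]_3.
Notation M3 := 'M[R]_3.
Variables (y q : V3) (h : R).
Hypothesis yy1 : dot y y = 1.
Local Notation pr := (dot y q).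
Local Notation n2 := (dot q q).

(** The matrix of the induced metric, with y = x / r and q the gradient of P in
    the chart. *)
Definition gmx : M3 :=
  1%:M - y^T *m y + (y^T *m q + q^T *m y) - h *: (q^T *m q).
Definition wdet : R := 2 * pr - n2 + (1 - h) * pr ^+ 2.
Hypothesis w0 : wdet != 0.

(** The vectors y and q with raised index, by [Yup_gmx] and [Qup_gmx]. *)
Definition Yup : V3 := wdet^-1 *: ((1 + pr - h * n2) *: y - (1 - h * pr) *: q).
Definition Qup : V3 := wdet^-1 *: ((pr - n2) *: y + pr *: q).

Lemma mul_rank1 n (u v z : 'rV[R]_n) : u *m (v^T *m z) = dot u v *: z.
Proof. by rewrite mulmxA (mx11_scalar (u *m _)) dotE mul_scalar_mx. Qed.

Lemma mul_gmx (u : V3) : u *m gmx =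
  u - dot u y *: y + (dot u y *: q + dot u q *: y) - (h * dot u q) *: q.
Proof.
by rewrite /gmx mulmxBr !mulmxDr mulmxN mulmx1 -scalemxAr !mul_rank1 scalerA.
Qed.

Lemma Yup_gmx : Yup *m gmx = y.
Proof.
have e : (wdet *: Yup) *m gmx = wdet *: y.
  rewrite scalerA mulfV// scale1r mul_gmx.
  rewrite !(dotDl, dotNl, dotZl) !(dotC q y) yy1.
  by apply/rowP => k; rewrite !mxE /wdet; ring.
by apply: (scalerI w0); rewrite -e -scalemxAl.
Qed.

Lemma Qup_gmx : Qup *m gmx = q.
Proof.
have e : (wdet *: Qup) *m gmx = wdet *: q.
  rewrite scalerA mulfV// scale1r mul_gmx.
  rewrite !(dotDl, dotNl, dotZl) !(dotC q y) yy1.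
  by apply/rowP => k; rewrite !mxE /wdet; ring.
by apply: (scalerI w0); rewrite -e -scalemxAl.
Qed.

Lemma gmx_sym : gmx^T = gmx.
Proof.
apply/matrixP => i j; rewrite !mxE !big_ord1 !mxE eq_sym; ring.
Qed.

Lemma gmx_unit : gmx \in unitmx.
Proof.
suff e : (1%:M + y^T *m (Yup - Qup) + q^T *m (h *: Qup - Yup)) *m gmx = 1%:M.
  by case: (mulmx1_unit e).
rewrite !mulmxDl -!mulmxA !mulmxBl -(scalemxAl h) Yup_gmx Qup_gmx mul1mx.
by apply/matrixP => i j; rewrite !mxE !big_ord1 !mxE; ring.
Qed.

Lemma mul_invgmx_y : y *m invmx gmx = Yup.
Proof. by apply: (canLR (mulmxK gmx_unit)); rewrite Yup_gmx. Qed.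

Lemma mul_invgmx_q : q *m invmx gmx = Qup.
Proof. by apply: (canLR (mulmxK gmx_unit)); rewrite Qup_gmx. Qed.

Lemma invgmx_sym : (invmx gmx)^T = invmx gmx.
Proof. by rewrite trmx_inv gmx_sym. Qed.

Lemma dot_Yup_y : dot Yup y = (1 - h * n2 + h * pr ^+ 2) / wdet.
Proof.
rewrite dotZl dotDl dotNl !dotZl (dotC q y) yy1; by field.
Qed.

Lemma dot_Yup_q : dot Yup q = (pr + pr ^+ 2 - n2) / wdet.
Proof. rewrite dotZl dotDl dotNl !dotZl; by field. Qed.

Lemma dot_Qup_y : dot Qup y = (pr + pr ^+ 2 - n2) / wdet.
Proof. rewrite dotZl dotDl !dotZl (dotC q y) yy1; by field. Qed.

Lemma dot_Qup_q : dot Qup q = pr ^+ 2 / wdet.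
Proof. rewrite dotZl dotDl !dotZl; by field. Qed.

End InverseMetric.

Section Kulkarni.
Context {R : realType} (n : nat) (Q : 'M[R]_n).
Implicit Types (T V : 'M[R]_n).

(** The double trace of the Kulkarni-Nomizu type product
    T_lk V_ij - T_lj V_ik. *)
Definition kul T V : R := \tr (Q *m T) * \tr (Q *m V) - \tr (Q *m T *m Q *m V).

Lemma kulC T V : kul T V = kul V T.
Proof. by rewrite /kul mulrC -mulmxA (mxtrace_mulC (Q *m T)) mulmxA. Qed.

Lemma kulDl T1 T2 V : kul (T1 + T2) V = kul T1 V + kul T2 V.
Proof. by rewrite /kul mulmxDr !mulmxDl !mxtraceD; ring. Qed.

Lemma kulZl c T V : kul (c *: T) V = c * kul T V.
Proof. by rewrite /kul -!(scalemxAr, scalemxAl) !mxtraceZ; ring. Qed.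

Lemma kulNl T V : kul (- T) V = - kul T V.
Proof. by rewrite -scaleN1r kulZl mulN1r. Qed.

Lemma kulDr T V1 V2 : kul T (V1 + V2) = kul T V1 + kul T V2.
Proof. by rewrite kulC kulDl !(kulC T). Qed.

Lemma kulZr c T V : kul T (c *: V) = c * kul T V.
Proof. by rewrite kulC kulZl kulC. Qed.

Definition quad (u v : 'rV[R]_n) : R := dot (u *m Q) v.

Lemma trace_rank1 (u v : 'rV[R]_n) : \tr (Q *m (u^T *m v)) = quad v u.
Proof.
by rewrite mulmxA mxtrace_mulC mulmxA /mxtrace big_ord1 dotE.
Qed.

Lemma kul_rank1 (u v a b : 'rV[R]_n) : kul (u^T *m v) (a^T *m b) =
  quad v u * quad b a - quad v a * quad b u.
Proof.
rewrite /kul !trace_rank1; congr (_ - _).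
rewrite -(mulmxA (Q *m _) Q) mxtrace_mulC.
have -> : Q *m (a^T *m b) *m (Q *m (u^T *m v)) =
    quad b u *: (Q *m (a^T *m v)).
  rewrite -!mulmxA (mulmxA b Q) (mulmxA (b *m Q)) (mx11_scalar (b *m Q *m _)).
  by rewrite dotE mul_scalar_mx -!scalemxAr.
by rewrite mxtraceZ trace_rank1 mulrC.
Qed.

Lemma kul_sum T V : Q^T = Q ->
  \sum_i \sum_j \sum_k \sum_l Q i j * Q k l * (T l k * V i j - T l j * V i k) =
  kul T V.
Proof.
move=> Qs; have Qij i j : Q i j = Q j i by rewrite -{1}Qs mxE.
have E1 : \tr (Q *m T) = \sum_k \sum_l Q k l * T l k.
  by apply: eq_bigr => k _; rewrite mxE.
have E2 : \tr (Q *m V) = \sum_i \sum_j Q i j * V i j.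
  rewrite exchange_big; apply: eq_bigr => k _; rewrite mxE.
  by apply: eq_bigr => l _; rewrite Qij.
have E3 : \tr (Q *m T *m Q *m V) =
    \sum_i \sum_j \sum_k \sum_l Q i j * Q k l * (T l j * V i k).
  have -> : \tr (Q *m T *m Q *m V) = \tr (V *m (Q *m T *m Q)) by rewrite mxtrace_mulC.
  apply: eq_bigr => i _; rewrite mxE exchange_big /=; apply: eq_bigr => k _.
  rewrite !mxE mulr_sumr; apply: eq_bigr => j _.
  rewrite mxE mulr_suml mulr_sumr; apply: eq_bigr => l _.
  by rewrite (Qij j i); ring.
rewrite /kul E1 E2 E3 mulrC big_distrl -sumrB /=; apply: eq_bigr => i _.
rewrite big_distrl -sumrB /=; apply: eq_bigr => j _.
rewrite big_distrr -sumrB /=; apply: eq_bigr => k _.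
rewrite big_distrr -sumrB /=; apply: eq_bigr => l _; ring.
Qed.

End Kulkarni.

(** The bookkeeping part of the contracted Gauss equation: D stands for q^T q
    and C for y^T q + q^T y. *)
Lemma gauss_table {R : realType} (Q G C D H : 'M[R]_3) (s h p w a b d : R) :
  let K := kul Q in
  let eta := (1 - h) / (2 * s) * s ^+ 2 in
  let r := s *: G - s *: C + (s * h) *: D in
  let M := H - r + eta *: D in
  let N := r - h *: H - eta *: C in
  let B := (1 + (1 - h) * p) *: r - H - eta *: (p *: C + (1 - h * p) *: D) in
  let n2 := 2 * p + (1 - h) * p ^+ 2 - w in
  w != 0 -> s != 0 ->
  a = (1 - h * n2 + h * p ^+ 2) / w -> b = (p + p ^+ 2 - n2) / w ->
  d = p ^+ 2 / w ->
  K G G = 6 -> K G C = 4 * b -> K G D = 2 * d ->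
  K C C = - 2 * (a * d - b ^+ 2) -> K C D = 0 -> K D D = 0 ->
  K r M + K H N - 2 * eta * s * (a * d - b ^+ 2) - eta * K C H
  + 2 * eta * s * (b ^+ 2 - a * d) + eta * K D r
  - a * K M M - b * (K M N + K N M) - d * K N N = - K B B / w.
Proof.
move=> K eta r M N B n2 w0 s0 aE bE dE GG GC GD CC CD DD.
have CG : K C G = 4 * b by rewrite /K kulC.
have DG : K D G = 2 * d by rewrite /K kulC.
have DC : K D C = 0 by rewrite /K kulC.
have HG : K H G = K G H by rewrite /K kulC.
have HC : K H C = K C H by rewrite /K kulC.
have HD : K H D = K D H by rewrite /K kulC.
have e1 (u v z X : 'M[R]_3) c1 c2 c3 : K (c1 *: u - c2 *: v + c3 *: z) X =
    c1 * K u X - c2 * K v X + c3 * K z X.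
  by rewrite /K !kulDl kulNl !kulZl.
have e2 (u v z X : 'M[R]_3) c1 c2 : K (u - c1 *: v - c2 *: z) X =
    K u X - c1 * K v X - c2 * K z X.
  by rewrite /K !kulDl !kulNl !kulZl.
have e3 (u v z X : 'M[R]_3) c : K (u - v + c *: z) X = K u X - K v X + c * K z X.
  by rewrite /K !kulDl kulNl !kulZl.
have e4 (u v z t X : 'M[R]_3) c1 c2 c3 c4 :
    K (c1 *: u - v - c2 *: (c3 *: z + c4 *: t)) X =
    c1 * K u X - K v X - c2 * (c3 * K z X + c4 * K t X).
  by rewrite /K !kulDl !kulNl !kulZl kulDl !kulZl.
have Kr X : K r X = s * K G X - s * K C X + s * h * K D X by exact: e1.
have KM X : K M X = K H X - K r X + eta * K D X by exact: e3.
have KN X : K N X = K r X - h * K H X - eta * K C X by exact: e2.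
have KB X : K B X = (1 + (1 - h) * p) * K r X - K H X
    - eta * (p * K C X + (1 - h * p) * K D X) by exact: e4.
have sym X Y : K X Y = K Y X by rewrite /K kulC.
clearbody r M N B.
have Hr : K H r = s * K G H - s * K C H + s * h * K D H by rewrite sym Kr.
have rG : K r G = s * 6 - s * (4 * b) + s * h * (2 * d).
  by rewrite Kr GG CG DG.
have rC : K r C = s * (4 * b) - s * (- 2 * (a * d - b ^+ 2)).
  by rewrite Kr GC CC DC; ring.
have rD : K r D = s * (2 * d) by rewrite Kr GD CD DD; ring.
have rr : K r r = s * K r G - s * K r C + s * h * K r D.
  by rewrite {1}Kr (sym G) (sym C) (sym D).
have rH : K r H = s * K G H - s * K C H + s * h * K D H by rewrite Kr.
have MM : K M M = K H H - 2 * K r H + K r r + 2 * eta * K D H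
    - 2 * eta * K r D + eta ^+ 2 * K D D.
  rewrite KM (sym H M) (sym r M) (sym D M) !KM (sym H r) HD (sym D r); ring.
have MN : K M N = K r H - K r r + eta * K r D
   - h * (K H H - K r H + eta * K D H) - eta * (K C H - K r C + eta * K C D).
  rewrite sym KN (sym r M) (sym H M) (sym C M) !KM.
  rewrite (sym H r) HC (sym D r) (sym D H) DC CD; ring.
have NN : K N N = K r r - 2 * h * K r H - 2 * eta * K r C
   + h ^+ 2 * K H H + 2 * h * eta * K C H + eta ^+ 2 * K C C.
  rewrite KN (sym r N) (sym H N) (sym C N) !KN (sym H r) HC (sym C r); ring.
have rM : K r M = K r H - K r r + eta * K r D.
  rewrite sym KM (sym H r) (sym D r); ring.
have HN : K H N = K r H - h * K H H - eta * K C H by rewrite sym KN.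
have BB : K B B = (1 + (1 - h) * p) ^+ 2 * K r r
   - 2 * (1 + (1 - h) * p) * K r H + K H H
   - 2 * (1 + (1 - h) * p) * eta * (p * K r C + (1 - h * p) * K r D)
   + 2 * eta * (p * K C H + (1 - h * p) * K D H)
   + eta ^+ 2 * (p ^+ 2 * K C C + 2 * p * (1 - h * p) * K C D
                 + (1 - h * p) ^+ 2 * K D D).
  rewrite KB (sym r B) (sym H B) (sym C B) (sym D B) !KB.
  rewrite (sym H r) (sym C r) (sym D r) HC HD DC CD; ring.
rewrite (sym N M) (sym D r) MM MN NN BB rM HN rr rG rC rD rH CC CD DD.
rewrite aE bE dE /eta /n2.
move: (K G H) (K C H) (K D H) (K H H) => x1 x2 x3 x4.
by field; rewrite w0 s0.
Qed.

Section GaussAlgebra.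
Context {R : realType}.
Notation V3 := 'rV[R]_3.
Variables (y q : V3) (h s : R) (H : 'M[R]_3).
Hypothesis yy1 : dot y y = 1.
Local Notation w := (wdet y q h).
Hypothesis (w0 : w != 0) (s0 : s != 0).
Local Notation G := (gmx y q h).
Local Notation K := (kul (invmx G)).

(** The contracted Gauss equation. The left-hand side is the double trace of
    the intrinsic curvature; that the result has no other term than the second
    fundamental form B / sqrt w uses the mass function h = 1 - 2ms of a vacuum. *)
Lemma gauss_algebra :
  let pr := dot y q in
  let eta := (1 - h) / (2 * s) * s ^+ 2 in
  let c := y^T *m q + q^T *m y in let qq := q^T *m q in
  let r := s *: (1%:M - y^T *m y) in
  let M := H - r + eta *: qq in
  let N := r - h *: H - eta *: c in
  let B := (1 + (1 - h) * pr) *: r - H - eta *: (pr *: c + (1 - h * pr) *: qq) in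
  K r M + K H N - 2 * eta * s * K (y^T *m y) qq - eta * K (y^T *m q) H
  - eta * K (q^T *m y) H + 2 * eta * s * K (q^T *m y) (y^T *m q)
  + eta * K qq r - dot (Yup y q h) y * K M M
  - dot (Yup y q h) q * (K M N + K N M) - dot (Qup y q h) q * K N N
  = - K B B / w.
Proof.
move=> pr eta c qq r M N B.
have Gu := gmx_unit yy1 w0.
have rE : r = s *: G - s *: c + (s * h) *: qq.
  rewrite -scalerA -scalerBr -scalerDr; congr (_ *: _).
  by rewrite /gmx -/c -/qq; apply/matrixP => i j; rewrite !mxE; ring.
have KGG : K G G = 6.
  by rewrite /kul mulVmx// mul1mx mulVmx// mxtrace1; ring.
have KGT T : K G T = 2 * \tr (invmx G *m T).
  by rewrite /kul mulVmx// mul1mx mxtrace1; ring.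
have qyy : quad (invmx G) y y = dot (Yup y q h) y.
  by rewrite /quad mul_invgmx_y.
have qyq : quad (invmx G) y q = dot (Yup y q h) q.
  by rewrite /quad mul_invgmx_y.
have qqy : quad (invmx G) q y = dot (Yup y q h) q.
  by rewrite /quad mul_invgmx_q// dot_Qup_y// dot_Yup_q.
have qqq : quad (invmx G) q q = dot (Qup y q h) q.
  by rewrite /quad mul_invgmx_q.
set YY := dot _ y in qyy *; set YP := dot (Yup y q h) q in qyq qqy *.
set PP := dot _ q in qqq *.
have trc : \tr (invmx G *m c) = 2 * YP.
  by rewrite /c mulmxDr mxtraceD !trace_rank1 qyq qqy; ring.
have trqq : \tr (invmx G *m qq) = PP by rewrite trace_rank1 qqq.
have Kcc : K c c = - 2 * (YY * PP - YP ^+ 2).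
  by rewrite /c !(kulDl, kulDr) !kul_rank1 qyy qyq qqy qqq; ring.
have Kcq : K c qq = 0.
  by rewrite /c !(kulDl, kulDr) !kul_rank1 qyq qqy qqq; ring.
have Kqq : K qq qq = 0 by rewrite kul_rank1 qqq; ring.
have Kyq : K (y^T *m y) qq = YY * PP - YP ^+ 2.
  by rewrite kul_rank1 qyy qqq qyq qqy; ring.
have Kqy : K (q^T *m y) (y^T *m q) = YP ^+ 2 - YY * PP.
  by rewrite kul_rank1 qyy qqq qyq qqy; ring.
have KcH : K (y^T *m q) H = K c H - K (q^T *m y) H by rewrite kulDl addrK.
have KGc : K G c = 4 * YP by rewrite KGT trc; ring.
have KGq : K G qq = 2 * PP by rewrite KGT trqq.
rewrite Kyq Kqy KcH.
have nE : dot q q = 2 * pr + (1 - h) * pr ^+ 2 - w by rewrite /wdet -/pr; ring.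
have YYE : YY = (1 - h * dot q q + h * pr ^+ 2) / w by exact: dot_Yup_y.
have YPE : YP = (pr + pr ^+ 2 - dot q q) / w by exact: dot_Yup_q.
have PPE : PP = pr ^+ 2 / w by exact: dot_Qup_q.
rewrite nE in YYE YPE.
have T := @gauss_table R (invmx G) G c qq H s h pr w YY YP PP w0 s0
  YYE YPE PPE KGG KGc KGq Kcc Kcq Kqq.
cbv zeta in T; rewrite -rE in T.
rewrite -/eta -/M -/N -/B in T; rewrite -{}T.
by rewrite mulrBr opprB; ring.
Qed.

End GaussAlgebra.

(** * The contracted Gauss equation for the graph *)

Section GraphCurvature.
Context {R : realType}.
Notation V3 := 'rV[R]_3.
Notation W := ('rV[R]_3 * R)%type.
Variables (m : R) (m_ge0 : 0 <= m) (U : set W) (U_open : open U)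
  (P : W -> R) (P_smooth : Cinf U P).
Implicit Types (x v w : V3) (i j k : 'I_3).
Local Notation hfun := (hfun m).
Local Notation radial := (radial P).
Local Notation lapsq := (lapsq m P).
Local Notation good := (good m U P).

Lemma Lop_comm f x i j : Cinf U f -> x != 0 -> U (sph x) ->
  Lop i (Lop j f) (sph x) = Lop j (Lop i f) (sph x).
Proof.
move=> fs x0 Ux; pose F z := f (sph z).
have nx := near_sph U_open x0 Ux.
have D1 k z : z != 0 /\ U (sph z) ->
    dder F z (ebase R k) (Lop k f (sph z)).
  by move=> [z0 Uz]; exact: (hat_dder k fs z0 Uz).
have eq1 k z : z != 0 /\ U (sph z) ->
    \near z, Lop k f (sph z) = 'D_(ebase R k) F z.
  move=> [z0 Uz]; apply: filterS (near_sph U_open z0 Uz) => t tP.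
  by have [_ ->] := D1 k t tP.
have D2 k l z : z != 0 /\ U (sph z) ->
    dder ('D_(ebase R k) F) z (ebase R l) (Lop l (Lop k f) (sph z)).
  move=> zP; apply: dder_near (eq1 k z zP) _; have [z0 Uz] := zP.
  by apply: (hat_dder l _ z0 Uz); exact: Cinf_Lop.
have eq2 k l : \near x, Lop l (Lop k f) (sph x) = 'D_(ebase R l) ('D_(ebase R k) F) x.
  by apply: filterS nx => t tP; have [_ ->] := D2 k l t tP.
have c k l : {for x, continuous ('D_(ebase R l) ('D_(ebase R k) F))}.
  apply: differentiable_continuous.
  have := dder_near (eq2 k l) (hat_dder 0 (Cinf_Lop U_open l (Cinf_Lop U_open k fs)) x0 Ux).
  by case.
have [_ <-] := D2 j i x (conj x0 Ux); have [_ <-] := D2 i j x (conj x0 Ux).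
apply: derive_comm => //.
apply: filterS nx => z zP; split; first by have [] := D1 0 z zP.
by split; [have [] := D2 j 0 z zP|have [] := D2 i 0 z zP].
Qed.

Definition rr i j (p : W) : R := p.2 * ((i == j)%:R - p.1 0 i * p.1 0 j).
Definition drr a i j (p : W) : R :=
  - (p.2 ^+ 2 * p.1 0 a) * ((i == j)%:R - p.1 0 i * p.1 0 j)
  - p.2 * (rr a i p * p.1 0 j + p.1 0 i * rr a j p).
Definition hs i j : W -> R := Lop i (Lop j P).
(** The Christoffel symbols of the first kind of the graph are
    y_l M_ij + q_l N_ij, with q the gradient of P; a prefix d marks the
    derivative in the chart in the direction of the first index. *)
Definition Mf i j (p : W) : R :=
  Lop j (Lop i P) p - rr i j p + m * p.2 ^+ 2 * (Lop i P p * Lop j P p).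
Definition Nf i j (p : W) : R :=
  rr i j p - hfun p * Lop j (Lop i P) p
  - m * p.2 ^+ 2 * (p.1 0 i * Lop j P p + Lop i P p * p.1 0 j).
Lemma MfE i j p : Mf i j p =
  Lop j (Lop i P) p - rr i j p + m * p.2 ^+ 2 * (Lop i P p * Lop j P p).
Proof. by []. Qed.

Lemma NfE i j p : Nf i j p = rr i j p - hfun p * Lop j (Lop i P) p
  - m * p.2 ^+ 2 * (p.1 0 i * Lop j P p + Lop i P p * p.1 0 j).
Proof. by []. Qed.

Definition Cf l i j (p : W) : R := p.1 0 l * Mf i j p + Lop l P p * Nf i j p.
Definition dMf a i j (p : W) : R :=
  Lop a (Lop j (Lop i P)) p - drr a i j p
  + (- (2 * m * p.2 * (p.2 ^+ 2 * p.1 0 a)) * (Lop i P p * Lop j P p)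
     + m * p.2 ^+ 2 * (hs a i p * Lop j P p + Lop i P p * hs a j p)).
Definition dNf a i j (p : W) : R :=
  drr a i j p
  - (2 * m * p.2 ^+ 2 * p.1 0 a * Lop j (Lop i P) p
     + hfun p * Lop a (Lop j (Lop i P)) p)
  - (- (2 * m * p.2 * (p.2 ^+ 2 * p.1 0 a))
       * (p.1 0 i * Lop j P p + Lop i P p * p.1 0 j)
     + m * p.2 ^+ 2 * (rr a i p * Lop j P p + p.1 0 i * hs a j p
         + hs a i p * p.1 0 j + Lop i P p * rr a j p)).
Definition dCf a l i j (p : W) : R :=
  rr a l p * Mf i j p + p.1 0 l * dMf a i j p
  + (hs a l p * Nf i j p + Lop l P p * dNf a i j p).

Section AtPoint.
Variables (x : V3) (x0 : x != 0) (Ux : U (sph x)) (a : 'I_3).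
Local Notation p := (sph x).
Local Notation D f := (dder (fun z => f (sph z)) x (ebase R a)).

Lemma Dq k : D (Lop k P) (hs a k p).
Proof. by apply: (hat_dder a _ x0 Ux); exact: Cinf_Lop. Qed.

Lemma Dy k : D (fun p : W => p.1 0 k) (rr a k p).
Proof. exact: dder_y. Qed.

Lemma DH i j : D (Lop j (Lop i P)) (Lop a (Lop j (Lop i P)) p).
Proof. by apply: (hat_dder a _ x0 Ux); do 2!apply: Cinf_Lop => //. Qed.

Lemma Drr i j : D (rr i j) (drr a i j p).
Proof.
apply: dder_eq (dderM (dder_s a x0) (dderB (dder_cst (i == j)%:R x (ebase R a))
  (dderM (Dy i) (Dy j)))) _.
rewrite /drr; move: (sph x) => q; ring.
Qed.

Lemma Dh : D hfun (2 * m * p.2 ^+ 2 * p.1 0 a).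
Proof.
apply: dder_eq (dderB (dder_cst 1 x (ebase R a))
    (dderM (dder_cst (2 * m) x (ebase R a)) (dder_s a x0))) _.
move: (sph x) => q; ring.
Qed.

Lemma Deta : D (fun p : W => m * p.2 ^+ 2) (- (2 * m * p.2 * (p.2 ^+ 2 * p.1 0 a))).
Proof.
apply: dder_eq (dderM (dder_cst m x (ebase R a)) (dderX 2 (dder_s a x0))) _.
rewrite /= expr1; move: (sph x) => q; ring.
Qed.

Lemma DM i j : D (Mf i j) (dMf a i j p).
Proof.
apply: dder_eq (dderD (dderB (DH i j) (Drr i j))
  (dderM Deta (dderM (Dq i) (Dq j)))) _.
rewrite /dMf; move: (sph x) => q; rewrite /hs.
move: (drr a i j q) (rr a i q) (rr a j q) (rr i j q) (hfun q) => r1 r2 r3 r4 h.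
move: (Lop a (Lop j (Lop i P)) q) (Lop j (Lop i P) q) => t1 t2.
move: (Lop a (Lop i P) q) (Lop a (Lop j P) q) => t3 t4.
move: (Lop i P q) (Lop j P q) (q.1 0 a) (q.1 0 i) (q.1 0 j) (q.2) => *; ring.
Qed.

Lemma DN i j : D (Nf i j) (dNf a i j p).
Proof.
apply: dder_eq (dderB (dderB (Drr i j) (dderM Dh (DH i j)))
  (dderM Deta (dderD (dderM (Dy i) (Dq j)) (dderM (Dq i) (Dy j))))) _.
rewrite /dNf; move: (sph x) => q; rewrite /hs.
move: (drr a i j q) (rr a i q) (rr a j q) (rr i j q) (hfun q) => r1 r2 r3 r4 h.
move: (Lop a (Lop j (Lop i P)) q) (Lop j (Lop i P) q) => t1 t2.
move: (Lop a (Lop i P) q) (Lop a (Lop j P) q) => t3 t4.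
move: (Lop i P q) (Lop j P q) (q.1 0 a) (q.1 0 i) (q.1 0 j) (q.2) => *; ring.
Qed.

Lemma DC l i j : D (Cf l i j) (dCf a l i j p).
Proof.
apply: dder_eq (dderD (dderM (Dy l) (DM i j)) (dderM (Dq l) (DN i j))) _.
rewrite /dCf; move: (sph x) => q.
move: (dMf a i j q) (dNf a i j q) (Mf i j q) (Nf i j q) => t1 t2 t3 t4.
move: (hs a l q) (rr a l q) (Lop l P q) (q.1 0 l) => *; ring.
Qed.

Definition gent i j (p : W) : R := (i == j)%:R - p.1 0 i * p.1 0 j
    + p.1 0 i * Lop j P p + Lop i P p * p.1 0 j
    - hfun p * Lop i P p * Lop j P p.

Definition dgent i j (p : W) : R :=
  - (rr a i p * p.1 0 j + p.1 0 i * rr a j p)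
  + (rr a i p * Lop j P p + p.1 0 i * hs a j p)
  + (hs a i p * p.1 0 j + Lop i P p * rr a j p)
  - (2 * m * p.2 ^+ 2 * p.1 0 a * Lop i P p * Lop j P p
     + hfun p * (hs a i p * Lop j P p + Lop i P p * hs a j p)).

Lemma Dgent i j : D (gent i j) (dgent i j p).
Proof.
apply: dder_eq (dderB (dderD (dderD (dderB (dder_cst (i == j)%:R x (ebase R a))
   (dderM (Dy i) (Dy j))) (dderM (Dy i) (Dq j))) (dderM (Dq i) (Dy j)))
   (dderM (dderM Dh (Dq i)) (Dq j))) _.
rewrite /dgent; move: (sph x) => q; rewrite /hs.
move: (drr a i j q) (rr a i q) (rr a j q) (rr i j q) (hfun q) => r1 r2 r3 r4 h.
move: (Lop a (Lop j (Lop i P)) q) (Lop j (Lop i P) q) => t1 t2.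
move: (Lop a (Lop i P) q) (Lop a (Lop j P) q) => t3 t4.
move: (Lop i P q) (Lop j P q) (q.1 0 a) (q.1 0 i) (q.1 0 j) (q.2) => *; ring.
Qed.

End AtPoint.

Lemma rrC i j p : rr i j p = rr j i p.
Proof. by rewrite /rr eq_sym; ring. Qed.

Lemma partial_metricG x a i j : good x ->
  partial a (fun z => metricG m P z i j) x = dgent a i j (sph x) /\
  differentiable (fun z => metricG m P z i j) x.
Proof.
move=> gx; have [x0 mx Ux wx] := gx.
have [] : dder (fun z => metricG m P z i j) x (ebase R a) (dgent a i j (sph x)).
  apply: dder_near (Dgent x0 Ux a i j).
  apply: filterS (near_good U_open P_smooth gx) => z [z0 mz Uz _].
  by rewrite (metricG_entry m_ge0 P_smooth).
by [].
Qed.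

Lemma first_kind x l i j : good x ->
  partial i (fun z => metricG m P z j l) x + partial j (fun z => metricG m P z i l) x
  - partial l (fun z => metricG m P z i j) x = 2 * Cf l i j (sph x).
Proof.
move=> gx; have [x0 mx Ux wx] := gx.
have [-> _] := partial_metricG i j l gx; have [-> _] := partial_metricG j i l gx.
have [-> _] := partial_metricG l i j gx.
have hsC k k' : hs k k' (sph x) = hs k' k (sph x) by exact: Lop_comm.
rewrite /dgent /Cf /Mf /Nf -/(hs j i) (hsC l i) (hsC l j) (hsC j i).
rewrite (rrC j i) (rrC l i) (rrC l j).
move: (sph x) => q.
move: (hs j i q) (hs i l q) (hs j l q) (hs i j q) (hfun q) => t1 t2 t3 t4 h.
move: (rr i j q) (rr i l q) (rr j l q) => r1 r2 r3.
move: (Lop i P q) (Lop j P q) (Lop l P q) => *.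
by move: (q.1 0 i) (q.1 0 j) (q.1 0 l) (q.2) => *; ring.
Qed.

Definition qv (p : W) : V3 := \row_k Lop k P p.

Lemma dot_qv p : dot p.1 (qv p) = radial p.
Proof. by apply: eq_bigr => k _; rewrite [qv p 0 k]mxE. Qed.

Lemma dot_qvqv p : dot (qv p) (qv p) = gradsq P p.
Proof. by apply: eq_bigr => k _; rewrite mxE expr2. Qed.

Lemma wdetE p : wdet p.1 (qv p) (hfun p) = lapsq p.
Proof. by rewrite /wdet dot_qv dot_qvqv lapsqE hfunE; ring. Qed.

Lemma metricG_mx x : x != 0 -> 2 * m < eucl x -> U (sph x) ->
  metricG m P x = gmx (sph x).1 (qv (sph x)) (hfun (sph x)).
Proof.
move=> x0 mx Ux; apply/matrixP => i j.
rewrite (metricG_entry m_ge0 P_smooth)//.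
move: (sph x) => p; rewrite /gmx.
have rank1 (u v : V3) : (u^T *m v) i j = u 0 i * v 0 j.
  by rewrite mxE big_ord1 mxE.
have qE k : qv p 0 k = Lop k P p by rewrite mxE.
rewrite [RHS]mxE [X in _ = X + _]mxE [X in _ = X + _ + _]mxE.
rewrite [X in _ = _ + X + _]mxE [X in _ = _ + _ + X]mxE.
rewrite [X in _ = X + _ + _ + _]mxE [X in _ = _ + X + _ + _]mxE.
by rewrite [X in _ = _ - X]mxE !rank1 !qE; ring.
Qed.

Lemma christoffel_metricG x k i j : good x ->
  christoffel (metricG m P) k i j x =
  let p := sph x in
  Yup p.1 (qv p) (hfun p) 0 k * Mf i j p + Qup p.1 (qv p) (hfun p) 0 k * Nf i j p.
Proof.
move=> gx /=; have [x0 mx Ux wx] := gx.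
rewrite /christoffel; under eq_bigr do rewrite first_kind//.
rewrite metricG_mx//; set p := sph x in Ux wx *.
have yy : dot p.1 p.1 = 1 by apply: sphere_dot; exact: sph_sphere.
have w0 : wdet p.1 (qv p) (hfun p) != 0 by rewrite wdetE gt_eqF.
have up (u : V3) : \sum_l invmx (gmx p.1 (qv p) (hfun p)) k l * u 0 l =
    (u *m invmx (gmx p.1 (qv p) (hfun p))) 0 k.
  rewrite mxE; apply: eq_bigr => l _; rewrite mulrC -{1}(invgmx_sym p.1).
  by rewrite [in LHS]mxE.
rewrite -mul_invgmx_y// -[X in _ + X * _]/(Qup _ _ _ 0 k) -mul_invgmx_q// -!up.
rewrite mulr_sumr !mulr_suml -big_split /=; apply: eq_bigr => l _.
rewrite /Cf [qv p 0 l]mxE.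
by move: (Mf i j p) (Nf i j p) (invmx _ k l) (Lop l P p) (p.1 0 l) => *; field.
Qed.

End GraphCurvature.

Section DoubleContraction.
Context {R : realType} (n : nat) (Q : 'M[R]_n).
Implicit Types (f : 'I_n -> 'I_n -> 'I_n -> 'I_n -> R).

Definition dctr f : R := \sum_i \sum_j \sum_k \sum_l Q i j * Q k l * f l i k j.

Lemma dctrD f1 f2 :
  dctr (fun l i k j => f1 l i k j + f2 l i k j) = dctr f1 + dctr f2.
Proof.
rewrite /dctr -big_split; apply: eq_bigr => i _.
rewrite -big_split; apply: eq_bigr => j _.
rewrite -big_split; apply: eq_bigr => k _.
by rewrite -big_split; apply: eq_bigr => l _; rewrite mulrDr.
Qed.

Lemma dctrZ c f : dctr (fun l i k j => c * f l i k j) = c * dctr f.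
Proof.
rewrite /dctr mulr_sumr; apply: eq_bigr => i _.
rewrite mulr_sumr; apply: eq_bigr => j _.
rewrite mulr_sumr; apply: eq_bigr => k _.
by rewrite mulr_sumr; apply: eq_bigr => l _; rewrite mulrCA.
Qed.

Lemma dctrB f1 f2 :
  dctr (fun l i k j => f1 l i k j - f2 l i k j) = dctr f1 - dctr f2.
Proof.
rewrite dctrD; congr (_ + _); rewrite -mulN1r -dctrZ.
congr (dctr _); apply/funext => l; apply/funext => i; apply/funext => k.
by apply/funext => j; rewrite mulN1r.
Qed.

Lemma dctr_comb f1 f2 f3 f4 f5 f6 f7 f8 f9 f10 f11 c3 c4 c5 c6 c7 c8 c9 c10 :
  dctr (fun l i k j => f1 l i k j + f2 l i k j - c3 * f3 l i k j
    - c4 * f4 l i k j - c5 * f5 l i k j + c6 * f6 l i k j + c7 * f7 l i k j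
    - c8 * f8 l i k j - c9 * (f9 l i k j + f10 l i k j) - c10 * f11 l i k j) =
  dctr f1 + dctr f2 - c3 * dctr f3 - c4 * dctr f4 - c5 * dctr f5
  + c6 * dctr f6 + c7 * dctr f7 - c8 * dctr f8 - c9 * (dctr f9 + dctr f10)
  - c10 * dctr f11.
Proof. by rewrite !(dctrB, dctrD, dctrZ). Qed.

(** Summed against two inverse metrics it gives [kul]. *)
Definition kn (T V : 'M[R]_n) l i k j : R := T l k * V i j - T l j * V i k.

Lemma dctr_kn T V : Q^T = Q -> dctr (kn T V) = kul Q T V.
Proof. exact: kul_sum. Qed.

End DoubleContraction.

Section GaussGraph.
Context {R : realType}.
Notation V3 := 'rV[R]_3.
Notation W := ('rV[R]_3 * R)%type.
Variables (m : R) (m_ge0 : 0 <= m) (U : set W) (U_open : open U)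
  (P : W -> R) (P_smooth : Cinf U P).
Implicit Types (x v w : V3) (i j k l : 'I_3).
Local Notation hfun := (hfun m).
Local Notation radial := (radial P).
Local Notation lapsq := (lapsq m P).
Local Notation good := (good m U P).
Local Notation qv := (qv P).
Local Notation hs := (hs P).
Local Notation Mf := (Mf m P).
Local Notation Nf := (Nf m P).

Definition rmx (p : W) : 'M[R]_3 := p.2 *: (1%:M - p.1^T *m p.1).
Definition hmx (p : W) : 'M[R]_3 := \matrix_(i, j) hs j i p.
(** m s^2, expressed through h as in [gauss_algebra]. *)
Definition eta (p : W) : R := (1 - hfun p) / (2 * p.2) * p.2 ^+ 2.
Definition cmx (p : W) : 'M[R]_3 := p.1^T *m qv p + (qv p)^T *m p.1.
Definition qmx (p : W) : 'M[R]_3 := (qv p)^T *m qv p.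

(** The matrix of [Wsecond]. *)
Definition Bmx (p : W) : 'M[R]_3 :=
  (1 + (1 - hfun p) * dot p.1 (qv p)) *: rmx p - hmx p
  - eta p *: (dot p.1 (qv p) *: cmx p + (1 - hfun p * dot p.1 (qv p)) *: qmx p).

Lemma etaE p : p.2 != 0 -> eta p = m * p.2 ^+ 2.
Proof. by move=> s0; rewrite /eta hfunE; field. Qed.

Lemma rank1E (u v : V3) i j : (u^T *m v) i j = u 0 i * v 0 j.
Proof. by rewrite mxE big_ord1 mxE. Qed.

Lemma qvE p k : qv p 0 k = Lop k P p. Proof. by rewrite mxE. Qed.

Lemma rmxE p i j : rmx p i j = rr i j p.
Proof. by rewrite 3!mxE [X in _ + X]mxE rank1E. Qed.

Lemma hmxE p i j : hmx p i j = hs j i p.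
Proof. by rewrite [LHS]mxE. Qed.

Lemma cmxE p i j : cmx p i j = p.1 0 i * Lop j P p + Lop i P p * p.1 0 j.
Proof. by rewrite mxE !rank1E !qvE. Qed.

Lemma qmxE p i j : qmx p i j = Lop i P p * Lop j P p.
Proof. by rewrite rank1E !qvE. Qed.

Lemma sph2_neq0 x : x != 0 -> (sph x).2 != 0.
Proof. by move=> x0; rewrite /sph /= invr_neq0// gt_eqF// eucl_gt0. Qed.

Lemma hs_sym x i j : x != 0 -> U (sph x) -> hs i j (sph x) = hs j i (sph x).
Proof. by move=> x0 Ux; exact: (Lop_comm U_open i j P_smooth x0 Ux). Qed.

Lemma secondA_mx x : good x ->
  secondA m P x = (Num.sqrt (lapsq (sph x)))^-1 *: Bmx (sph x).
Proof.
move=> gx; have [x0 mx Ux wx] := gx; have s0 := sph2_neq0 x0.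
apply/matrixP => i j; rewrite (secondA_entry m_ge0 U_open P_smooth)//.
have hsij := hs_sym i j x0 Ux.
rewrite [RHS]mxE; congr (_ * _); move: (sph x) s0 hsij => p s0 hsij.
have comb (A B C D : 'M[R]_3) a b c d :
    (a *: A - B - b *: (c *: C + d *: D)) i j =
    a * A i j - B i j - b * (c * C i j + d * D i j) by rewrite !mxE.
rewrite /Bmx comb hmxE.
rewrite rmxE cmxE qmxE (dot_qv P p) etaE// /Wsecond /rr -/(hs i j p) hsij.
have mE : 1 - hfun p = 2 * m * p.2 by rewrite hfunE; ring.
by rewrite mE; ring.
Qed.

Lemma drrE a i j (p : W) : drr a i j p =
  - p.2 * p.1 0 a * rr i j p - p.2 * (rr a i p * p.1 0 j + p.1 0 i * rr a j p).
Proof. by rewrite /drr /rr; ring. Qed.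

(** The third derivatives t of P occur twice, with opposite signs, and
    cancel. *)
Lemma riem_algebra (s m0 h yi yj yk yl qi qj qk ql : R)
  (ril_k rlj rij rik rjk hlk hlj hij hik hjk t Mij Mik Mlk Mlj Nij Nik Nlk Nlj
    YY YP PP drk drj : R) :
  drk = - s * yk * rij - s * (rik * yj + yi * rjk) ->
  drj = - s * yj * rik - s * (rij * yk + yi * rjk) ->
  Mij = hij - rij + m0 * s ^+ 2 * (qi * qj) ->
  Mik = hik - rik + m0 * s ^+ 2 * (qi * qk) ->
  let eta := m0 * s ^+ 2 in
  ril_k * Mij + yl * (t - drk + (- (2 * m0 * s * (s ^+ 2 * yk)) * (qi * qj)
     + eta * (hik * qj + qi * hjk)))
   + (hlk * Nij + ql * (drk - (2 * m0 * s ^+ 2 * yk * hij + h * t)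
      - (- (2 * m0 * s * (s ^+ 2 * yk)) * (yi * qj + qi * yj)
         + eta * (rik * qj + yi * hjk + hik * yj + qi * rjk))))
  - (rlj * Mik + yl * (t - drj + (- (2 * m0 * s * (s ^+ 2 * yj)) * (qi * qk)
     + eta * (hij * qk + qi * hjk)))
   + (hlj * Nik + ql * (drj - (2 * m0 * s ^+ 2 * yj * hik + h * t)
      - (- (2 * m0 * s * (s ^+ 2 * yj)) * (yi * qk + qi * yk)
         + eta * (rij * qk + yi * hjk + hij * yk + qi * rjk)))))
  - ((YY * Mlk * Mij + YP * (Mlk * Nij + Nlk * Mij) + PP * Nlk * Nij)
    - (YY * Mlj * Mik + YP * (Mlj * Nik + Nlj * Mik) + PP * Nlj * Nik))
  = (ril_k * Mij - rlj * Mik) + (hlk * Nij - hlj * Nik)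
  - 2 * eta * s * (yl * yk * (qi * qj) - yl * yj * (qi * qk))
  - eta * (yl * qk * hij - yl * qj * hik)
  - eta * (ql * yk * hij - ql * yj * hik)
  + 2 * eta * s * (ql * yk * (yi * qj) - ql * yj * (yi * qk))
  + eta * (ql * qk * rij - ql * qj * rik)
  - YY * (Mlk * Mij - Mlj * Mik)
  - YP * ((Mlk * Nij - Mlj * Nik) + (Nlk * Mij - Nlj * Mik))
  - PP * (Nlk * Nij - Nlj * Nik).
Proof.
move=> -> -> _ _ /=; ring.
Qed.

Lemma riem_graph x l i k j : good x ->
  let p := sph x in
  let M := hmx p - rmx p + eta p *: qmx p in
  let N := rmx p - hfun p *: hmx p - eta p *: cmx p in
  let YY := dot (Yup p.1 (qv p) (hfun p)) p.1 in
  let YP := dot (Yup p.1 (qv p) (hfun p)) (qv p) in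
  let PP := dot (Qup p.1 (qv p) (hfun p)) (qv p) in
  riem (metricG m P) x (fun l i j z => Cf m P l i j (sph z))
    (fun a l i j => dCf m P a l i j p) l i k j =
  kn (rmx p) M l i k j + kn (hmx p) N l i k j
  - 2 * eta p * p.2 * kn (p.1^T *m p.1) (qmx p) l i k j
  - eta p * kn (p.1^T *m qv p) (hmx p) l i k j
  - eta p * kn ((qv p)^T *m p.1) (hmx p) l i k j
  + 2 * eta p * p.2 * kn ((qv p)^T *m p.1) (p.1^T *m qv p) l i k j
  + eta p * kn (qmx p) (rmx p) l i k j
  - YY * kn M M l i k j - YP * (kn M N l i k j + kn N M l i k j)
  - PP * kn N N l i k j.
Proof.
move=> gx p; have pE : p = sph x by [].
clearbody p; move=> M N YY YP PP; have [x0 mx Ux wx] := gx.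
have s0 : p.2 != 0 by rewrite pE; exact: sph2_neq0.
have yy : dot p.1 p.1 = 1 by rewrite pE; apply: sphere_dot; exact: sph_sphere.
have w0 : wdet p.1 (qv p) (hfun p) != 0 by rewrite wdetE pE gt_eqF.
have hsC a b : hs a b p = hs b a p by rewrite pE; exact: hs_sym.
have T3 : Lop k (Lop j (Lop i P)) p = Lop j (Lop k (Lop i P)) p.
  by rewrite pE; exact: (Lop_comm U_open k j (Cinf_Lop U_open i P_smooth) x0 Ux).
have ME a b : M a b = Mf a b p.
  have comb (A B C : 'M[R]_3) c : (A - B + c *: C) a b = A a b - B a b + c * C a b.
    by rewrite !mxE.
  by rewrite /M comb rmxE qmxE etaE// hmxE.
have NE a b : N a b = Nf a b p.
  have comb (A B C : 'M[R]_3) c d :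
      (A - d *: B - c *: C) a b = A a b - d * B a b - c * C a b.
    by rewrite !mxE.
  by rewrite /N comb rmxE cmxE etaE// hmxE.
have MC a b : Mf a b p = Mf b a p.
  by rewrite !MfE -/(hs b a p) -/(hs a b p) hsC rrC [Lop a P p * _]mulrC.
have NC a b : Nf a b p = Nf b a p.
  by rewrite !NfE -/(hs b a p) -/(hs a b p) hsC rrC; congr (_ - _ * _); ring.
rewrite /riem -pE.
have qsum a b c d : \sum_q0 Cf m P q0 a b p * christoffel (metricG m P) q0 c d x =
    YY * Mf a b p * Mf c d p
    + YP * (Mf a b p * Nf c d p + Nf a b p * Mf c d p) + PP * Nf a b p * Nf c d p.
  have YP' : dot (Qup p.1 (qv p) (hfun p)) p.1 = YP.
    by rewrite /YP dot_Qup_y// dot_Yup_q.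
  transitivity (\sum_q0 (Yup p.1 (qv p) (hfun p) 0 q0 * p.1 0 q0 * (Mf a b p * Mf c d p)
     + Yup p.1 (qv p) (hfun p) 0 q0 * qv p 0 q0 * (Nf a b p * Mf c d p)
     + (Qup p.1 (qv p) (hfun p) 0 q0 * p.1 0 q0 * (Mf a b p * Nf c d p)
     + Qup p.1 (qv p) (hfun p) 0 q0 * qv p 0 q0 * (Nf a b p * Nf c d p)))).
    apply: eq_bigr => e _.
    rewrite (christoffel_metricG m_ge0 U_open P_smooth)// -pE /Cf -qvE.
    move: (Yup _ _ _ 0 e) (Qup _ _ _ 0 e) (qv p 0 e) (p.1 0 e) => t1 t2 t3 t4.
    move: (Mf a b p) (Nf a b p) (Mf c d p) (Nf c d p) => *; ring.
  rewrite !big_split /= -!mulr_suml.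
  rewrite -/(dot (Yup p.1 (qv p) (hfun p)) p.1) -/YY.
  rewrite -/(dot (Yup p.1 (qv p) (hfun p)) (qv p)) -/YP.
  rewrite -/(dot (Qup p.1 (qv p) (hfun p)) p.1) YP'.
  rewrite -/(dot (Qup p.1 (qv p) (hfun p)) (qv p)) -/PP.
  by move: (Mf a b p) (Nf a b p) (Mf c d p) (Nf c d p) => *; ring.
rewrite sumrB !qsum /kn !ME !NE !hmxE !rmxE !qmxE !rank1E !qvE etaE//.
rewrite (MC k l) (MC j l) (NC k l) (NC j l).
rewrite /dCf /dMf /dNf.
rewrite T3.
rewrite -/(hs j i p) -/(hs k i p).
rewrite (rrC k l) (rrC j l) (rrC k i) (rrC j i) (hsC j k) (rrC j k).
apply: (@riem_algebra p.2 m (hfun p)).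
- by rewrite drrE (rrC k i).
- by rewrite drrE (rrC j i) (rrC j k).
- by rewrite MfE.
- by rewrite MfE.
Qed.

Lemma Cinf_hfun : Cinf U hfun.
Proof.
apply: CinfB => //; first exact: Cinf_cst.
by apply: CinfM => //; [exact: Cinf_cst|exact: Cinf_snd].
Qed.

Lemma Cinf_rr i j : Cinf U (rr i j).
Proof.
apply: CinfM => //; first exact: Cinf_snd.
apply: CinfB => //; first exact: Cinf_cst.
by apply: CinfM => //; exact: Cinf_fst.
Qed.

Lemma Cinf_eta : Cinf U (fun p : W => m * p.2 ^+ 2).
Proof.
apply: CinfM => //; first exact: Cinf_cst.
by apply: CinfX => //; exact: Cinf_snd.
Qed.

Lemma Cinf_Mf i j : Cinf U (Mf i j).
Proof.
apply: CinfD => //.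
  by apply: CinfB => //; [do 2!apply: Cinf_Lop => //|exact: Cinf_rr].
apply: CinfM => //; first exact: Cinf_eta.
by apply: CinfM => //; exact: Cinf_Lop.
Qed.

Lemma Cinf_Nf i j : Cinf U (Nf i j).
Proof.
apply: CinfB => //.
  apply: CinfB => //; first exact: Cinf_rr.
  by apply: CinfM => //; [exact: Cinf_hfun|do 2!apply: Cinf_Lop => //].
apply: CinfM => //; first exact: Cinf_eta.
by apply: CinfD => //; apply: CinfM => //; (exact: Cinf_fst || exact: Cinf_Lop).
Qed.

Lemma inner_sym n (G : 'M[R]_n) (u v : 'rV[R]_n) : G^T = G ->
  inner G u v = inner G v u.
Proof.
move=> Gs; have -> : inner G v u = (v *m G *m u^T)^T 0 0 by rewrite mxE.
by rewrite !trmx_mul trmxK Gs mulmxA.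
Qed.

Lemma metricG_sym x : (metricG m P x)^T = metricG m P x.
Proof.
apply/matrixP => i j; rewrite [LHS]mxE [LHS]mxE [RHS]mxE.
exact: inner_sym (schwarzschild_sym _ _).
Qed.

Lemma christoffel_diff x k i j : good x ->
  differentiable (christoffel (metricG m P) k i j) x.
Proof.
move=> gx; have [x0 mx Ux wx] := gx.
pose YN (p : W) := (1 + radial p - hfun p * gradsq P p) * p.1 0 k
   - (1 - hfun p * radial p) * Lop k P p.
pose QN (p : W) := (radial p - gradsq P p) * p.1 0 k + radial p * Lop k P p.
pose F (p : W) := YN p * Mf i j p + QN p * Nf i j p.
have rs : Cinf U radial by exact: Cinf_radial.
have ns : Cinf U (gradsq P) by exact: Cinf_gradsq.
have hfs := Cinf_hfun.
have ls : Cinf U (Lop k P) by exact: Cinf_Lop.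
have ys : Cinf U (fun p : W => p.1 0 k) by exact: Cinf_fst.
have Fs : Cinf U F.
  have YNs : Cinf U YN.
    apply: CinfB => //; apply: CinfM => //.
      apply: CinfB => //; last exact: CinfM.
      by apply: CinfD => //; exact: Cinf_cst.
    by apply: CinfB => //; [exact: Cinf_cst|exact: CinfM].
  have QNs : Cinf U QN.
    apply: CinfD => //; apply: CinfM => //.
    exact: CinfB.
  apply: CinfD => //; apply: CinfM => //; [exact: Cinf_Mf|exact: Cinf_Nf].
have D := dderM (dderV (hat_dder 0 (Cinf_lapsq m U_open P_smooth) x0 Ux)
    (lt0r_neq0 wx)) (hat_dder 0 Fs x0 Ux).
have [] // := dder_near (g := christoffel (metricG m P) k i j) _ D.
apply: filterS (near_good U_open P_smooth gx) => z gz.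
rewrite (christoffel_metricG m_ge0 U_open P_smooth)//.
move: (sph z) => p.
have lin (u v : V3) a b c : (c *: (a *: u + b *: v)) 0 k = c * (a * u 0 k + b * v 0 k).
  by rewrite !mxE.
have linB (u v : V3) a b c : (c *: (a *: u - b *: v)) 0 k = c * (a * u 0 k - b * v 0 k).
  by rewrite !mxE.
rewrite /Yup /Qup lin linB wdetE dot_qv dot_qvqv qvE /F /YN /QN.
move: (lapsq p)^-1 (radial p) (gradsq P p) (hfun p) (p.1 0 k) (Lop k P p) => *.
by move: (Mf i j p) (Nf i j p) => *; ring.
Qed.

(** S = |A|^2 - (tr A)^2: the ambient Ricci tensor vanishes, and the sign is
    that of a spacelike hypersurface. *)
Lemma scalar_curvature_graph x : good x ->
  scalar_curvature (metricG m P) x =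
  - kul (invmx (metricG m P x)) (secondA m P x) (secondA m P x).
Proof.
move=> gx; have [x0 mx Ux wx] := gx; have s0 := sph2_neq0 x0.
have yy : dot (sph x).1 (sph x).1 = 1 by apply: sphere_dot; exact: sph_sphere.
have w0 : wdet (sph x).1 (qv (sph x)) (hfun (sph x)) != 0.
  by rewrite wdetE gt_eqF.
rewrite (@scalar_curvature_riem R 2 (metricG m P) x
  (fun l i j z => Cf m P l i j (sph z)) (fun a l i j => dCf m P a l i j (sph x))).
- under eq_bigr do under eq_bigr do under eq_bigr do under eq_bigr
    do rewrite riem_graph//.
  rewrite (secondA_mx gx) kulZl kulZr mulrA -mulNr.
  have ww : - ((Num.sqrt (lapsq (sph x)))^-1 * (Num.sqrt (lapsq (sph x)))^-1) =
     - (wdet (sph x).1 (qv (sph x)) (hfun (sph x)))^-1.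
    by rewrite -invfM -expr2 sqr_sqrtr ?(ltW wx)// wdetE.
  rewrite ww (metricG_mx m_ge0 P_smooth x0 mx Ux).
  set p := sph x in yy w0 s0 *.
  have Qs := invgmx_sym p.1 (qv p) (hfun p).
  have ga := gauss_algebra (hmx p) yy w0 s0.
  have mulNdiv (a b : R) : - a / b = - b^-1 * a by rewrite mulNr mulrC -mulNr.
  apply: etrans (etrans _ ga) (mulNdiv _ _); cbv zeta.
  apply: etrans (dctr_comb _ _ _ _ _ _ _ _ _ _ _ _ _ _ _ _ _ _ _ _) _.
  by rewrite !dctr_kn.
- exact: metricG_sym.
- apply: filterS (near_good U_open P_smooth gx) => z [z0 mz Uz wz].
  rewrite (metricG_mx m_ge0 P_smooth z0 mz Uz); apply: gmx_unit.
    by apply: sphere_dot; exact: sph_sphere.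
  by rewrite wdetE gt_eqF.
- by move=> i j; have [] := partial_metricG m_ge0 U_open P_smooth 0 i j gx.
- apply: filterS (near_good U_open P_smooth gx) => z gz l i j.
  exact: (first_kind m_ge0 U_open P_smooth l i j gz).
- by move=> k i j; exact: christoffel_diff.
- by move=> a l i j; exact: (DC m U_open P_smooth x0 Ux).
Qed.

End GaussGraph.

(** * Tangential jets and the rescaled basis (e, f, y / s) *)

Section Frames.
Context {R : realType}.
Notation V3 := 'rV[R]_3.
Notation W := ('rV[R]_3 * R)%type.
Implicit Types (u v w y e f : V3) (p : W).

Definition frame y e f : Prop :=
  [/\ dot y y = 1, dot e e = 1 & dot f f = 1] /\
  [/\ dot y e = 0, dot y f = 0 & dot e f = 0].

Definition mx3 (a b c : V3) : 'M[R]_3 :=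
  \matrix_(i < 3) (if i == 0 then a else if i == 1 then b else c).

Lemma ord3P (Q : 'I_3 -> Prop) : Q 0 -> Q 1 -> Q 2 -> forall i, Q i.
Proof.
move=> q0 q1 q2 i; case: i => [[|[|[|//]]] h].
- by have -> : Ordinal h = 0 by apply: val_inj.
- by have -> : Ordinal h = 1 by apply: val_inj.
- by have -> : Ordinal h = 2 by apply: val_inj.
Qed.

Lemma sum3 (F : 'I_3 -> R) : \sum_i F i = F 0 + F 1 + F 2.
Proof.
rewrite !big_ord_recl big_ord0 addr0 addrA; congr (_ + F _ + F _); exact: val_inj.
Qed.

Lemma row_mx3 a b c i : row i (mx3 a b c) =
  if i == 0 then a else if i == 1 then b else c.
Proof. by rewrite rowK. Qed.

Lemma inner_row n (G E : 'M[R]_n) i j :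
  (E *m G *m E^T) i j = inner G (row i E) (row j E).
Proof.
rewrite /inner tr_row -row_mul [RHS]mxE [LHS]mxE; apply: eq_bigr => k _.
by rewrite [X in _ = X * _]mxE [X in _ = _ * X]mxE.
Qed.

Lemma parseval y e f u v : frame y e f ->
  dot u v = dot u e * dot v e + dot u f * dot v f + dot u y * dot v y.
Proof.
move=> [[yy ee ff] [ye yf ef]].
pose O := mx3 e f y.
have OO : O *m O^T = 1%:M.
  apply/matrixP => i j; have -> : (O *m O^T) i j = dot (row i O) (row j O).
    by rewrite -dotE tr_row mxE mxE; apply: eq_bigr => k _; rewrite !mxE.
  rewrite !row_mx3 mxE; move: i j.
  by apply: ord3P; apply: ord3P; rewrite /= ?yy ?ee ?ff ?ye ?yf ?ef //
    ?[dot e y]dotC ?[dot f y]dotC ?[dot f e]dotC ?ye ?yf ?ef.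
have OO' := mulmx1C OO.
have -> : dot u v = ((u *m O^T) *m (v *m O^T)^T) 0 0.
  by rewrite trmx_mul trmxK mulmxA -(mulmxA u) OO' mulmx1 dotE.
rewrite dotE /dot sum3.
have c w i : (w *m O^T) 0 i = dot w (row i O).
  by rewrite -dotE tr_row mxE [RHS]mxE; apply: eq_bigr => k _; rewrite !mxE.
by rewrite !c !row_mx3.
Qed.

(** For v and w tangent to the sphere, tt v w F is the covariant Hessian of the
    restriction of F, the second index of T_j T_i F being the outer one. *)
Definition tv v (F : W -> R) p : R := \sum_k v 0 k * tang k F p.
Definition tt v w (F : W -> R) p : R :=
  \sum_i \sum_j v 0 i * w 0 j * tang j (tang i F) p.

Lemma rowBZ u v c k : (u - c *: v) 0 k = u 0 k - c * v 0 k.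
Proof. by rewrite !mxE. Qed.

Definition tdir i p : W := (ebase R i - p.1 0 i *: p.1, 0).

Lemma tang_derive i (F : W -> R) p : differentiable F p ->
  tang i F p = 'D_(tdir i p) F p.
Proof.
move=> Fd; rewrite /tdir derive_prod// mul0r addr0 /tang mulr_sumr.
have -> : 'D_(ez i) F p = \sum_k (i == k)%:R * 'D_(ez k) F p.
  rewrite (bigD1 i)//= eqxx mul1r big1 ?addr0// => k ki.
  by rewrite eq_sym (negbTE ki) mul0r.
rewrite -sumrB; apply: eq_bigr => k _; rewrite mulrA -mulrBl; congr (_ * _).
by rewrite rowBZ ebaseE.
Qed.

Lemma tang_radial y s (F : W -> R) : dot y y = 1 ->
  \sum_k y 0 k * tang k F (y, s) = 0.
Proof.
move=> yy; pose S := \sum_k y 0 k * 'D_(ez k) F (y, s).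
transitivity (S - dot y y * S); last by rewrite yy mul1r subrr.
rewrite {1}/S /dot mulr_suml -sumrB; apply: eq_bigr => k _.
by rewrite /tang -[(y, s).1]/y -/S mulrBr mulrA.
Qed.

Variables (U : set W) (U_open : open U) (P : W -> R) (P_smooth : Cinf U P).

Lemma ds_tang i p : U p -> ds (tang i P) p = tang i (ds P) p.
Proof.
move=> Up.
have D k : dder ('D_(ez k) P) p es (ds ('D_(ez k) P) p).
  by apply: dderE; apply: Cinf_diff Up; exact: Cinf_derive.
have D1 k : dder (fun p : W => p.1 0 k) p es 0.
  by apply: dder_eq (dder_fst p es k) _; rewrite mxE.
have Dt : dder (tang i P) p es
    (ds ('D_(ez i) P) p - p.1 0 i * \sum_k p.1 0 k * ds ('D_(ez k) P) p).
  apply: dder_eq (dderB (D i) (dderM (D1 i)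
    (dder_sum (fun k => dderM (D1 k) (D k))))) _.
  rewrite mulr0 addr0; congr (_ - _ * _).
  by apply: eq_bigr => k _; rewrite mulr0 addr0.
have DC k : ds ('D_(ez k) P) p = 'D_(ez k) (ds P) p.
  exact: (derive_comm_Cinf U_open es (ez k) P_smooth Up).
transitivity (ds ('D_(ez i) P) p - p.1 0 i * \sum_k p.1 0 k * ds ('D_(ez k) P) p).
  by case: Dt.
have E : \sum_k p.1 0 k * ds ('D_(ez k) P) p = \sum_k p.1 0 k * 'D_(ez k) (ds P) p.
  by apply: eq_bigr => k _; exact: (congr1 (GRing.mul (p.1 0 k)) (DC k)).
exact: (f_equal2 (fun a b => a - p.1 0 i * b) (DC i) E).
Qed.

Lemma Lop_Lop i j y s : dot y y = 1 -> U (y, s) ->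
  let p := (y, s) in
  Lop j (Lop i P) p =
  s ^+ 2 * tang j (tang i P) p - s ^+ 3 * ((i == j)%:R - y 0 i * y 0 j) * ds P p
  - s ^+ 3 * y 0 i * tang j (ds P) p - s ^+ 2 * y 0 j * tang i P p
  - s ^+ 3 * y 0 j * tang i (ds P) p + 2 * s ^+ 3 * y 0 i * y 0 j * ds P p
  + s ^+ 4 * y 0 i * y 0 j * ds (ds P) p.
Proof.
move=> yy Up p.
have ts k : Cinf U (tang k P) by exact: Cinf_tang.
have dsP : Cinf U (ds P) by exact: Cinf_derive.
have ls : Cinf U (Lop i P) by exact: Cinf_Lop.
have Lder (v : W) (a b c d : R) : dder (fun p : W => p.2) p v a ->
    dder (fun p : W => p.1 0 i) p v b -> dder (tang i P) p v c ->
    dder (ds P) p v d -> dder (Lop i P) p v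
    (s * c + tang i P p * a - ((s ^+ 2 * y 0 i) * d +
      ds P p * (s ^+ 2 * b + y 0 i * (2 * s * a)))).
  move=> Da Db Dc Dd.
  apply: dder_eq (dderB (dderM Da Dc) (dderM (dderM (dderX 2 Da) Db) Dd)) _.
  by rewrite /= expr1.
have E1 : tang j (Lop i P) p = s * tang j (tang i P) p
    - s ^+ 2 * (y 0 i * tang j (ds P) p + ds P p * ((i == j)%:R - y 0 i * y 0 j)).
  rewrite (tang_derive j (Cinf_diff ls Up)).
  have [||||_ ->] := Lder (tdir j p) 0 ((i == j)%:R - y 0 i * y 0 j)
    (tang j (tang i P) p) (tang j (ds P) p).
  - exact: dder_snd.
  - apply: dder_eq (dder_fst p (tdir j p) i) _.
    by rewrite /= rowBZ ebaseE eq_sym; ring.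
  - rewrite (tang_derive j (Cinf_diff (ts i) Up)).
    exact: (dderE (tdir j p) (Cinf_diff (ts i) Up)).
  - rewrite (tang_derive j (Cinf_diff dsP Up)).
    exact: (dderE (tdir j p) (Cinf_diff dsP Up)).
  by move: (tang j (tang i P) _) (tang j (ds P) _) (tang i P _) (ds P _) => *; ring.
have E2 : ds (Lop i P) p = tang i P p + s * tang i (ds P) p
    - (2 * s * y 0 i * ds P p + s ^+ 2 * y 0 i * ds (ds P) p).
  have [||||_ e] := Lder es 1 0 (tang i (ds P) p) (ds (ds P) p).
  - exact: dder_snd.
  - by apply: dder_eq (dder_fst p es i) _; rewrite mxE.
  - by rewrite -ds_tang//; exact: (dderE es (Cinf_diff (ts i) Up)).
  - exact: (dderE es (Cinf_diff dsP Up)).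
  apply: etrans e _.
  by move: (tang i (ds P) _) (ds (ds P) _) (tang i P _) (ds P _) => *; ring.
have -> : Lop j (Lop i P) p =
  s * tang j (Lop i P) p - s ^+ 2 * y 0 j * ds (Lop i P) p by [].
rewrite E1 E2.
move: (tang j (tang i P) _) (tang j (ds P) _) (tang i (ds P) _) => t1 t2 t3.
move: (tang i P _) (ds (ds P) _) (ds P _) => t4 t5 t6; ring.
Qed.

Lemma dot_qv_frame v y s : dot v (qv P (y, s)) =
  s * tv v P (y, s) - s ^+ 2 * dot v y * ds P (y, s).
Proof.
rewrite /dot /tv mulr_sumr mulr_sumr mulr_suml -sumrB; apply: eq_bigr => k _.
by rewrite qvE /Lop /=; ring.
Qed.

Lemma inner_hmx v w y s : dot y y = 1 -> U (y, s) ->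
  inner (hmx P (y, s)) v w =
  s ^+ 2 * tt v w P (y, s)
  - s ^+ 3 * (dot v w - dot v y * dot w y) * ds P (y, s)
  - s ^+ 3 * dot v y * tv w (ds P) (y, s) - s ^+ 2 * dot w y * tv v P (y, s)
  - s ^+ 3 * dot w y * tv v (ds P) (y, s)
  + 2 * s ^+ 3 * dot v y * dot w y * ds P (y, s)
  + s ^+ 4 * dot v y * dot w y * ds (ds P) (y, s).
Proof.
move=> yy Up.
have -> : inner (hmx P (y, s)) v w =
    \sum_i \sum_j v 0 i * w 0 j * Lop j (Lop i P) (y, s).
  rewrite /inner mxE exchange_big; apply: eq_bigr => j _ /=.
  rewrite [(v *m _) _ _]mxE mulr_suml; apply: eq_bigr => i _.
  by rewrite hmxE [w^T _ _]mxE; rewrite /hs; ring.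
have sep (A B : 'I_3 -> R) : \sum_i \sum_j A i * B j = (\sum_i A i) * (\sum_j B j).
  by rewrite mulr_suml; apply: eq_bigr => i _; rewrite mulr_sumr.
have comb (f1 f2 f3 f4 f5 f6 : 'I_3 -> 'I_3 -> R) c1 c2 c3 c4 c5 c6 :
    \sum_i \sum_j (c1 * f1 i j - c2 * f2 i j + c3 * f3 i j - c4 * f4 i j
      - c5 * f5 i j - c6 * f6 i j) =
    c1 * (\sum_i \sum_j f1 i j) - c2 * (\sum_i \sum_j f2 i j)
    + c3 * (\sum_i \sum_j f3 i j) - c4 * (\sum_i \sum_j f4 i j)
    - c5 * (\sum_i \sum_j f5 i j) - c6 * (\sum_i \sum_j f6 i j).
  rewrite !mulr_sumr -!(sumrB, big_split) /=; apply: eq_bigr => i _.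
  by rewrite !mulr_sumr -!(sumrB, big_split).
transitivity (\sum_i \sum_j (
   s ^+ 2 * (v 0 i * w 0 j * tang j (tang i P) (y, s))
   - s ^+ 3 * ds P (y, s) * (v 0 i * w 0 j * (i == j)%:R)
   + (3 * s ^+ 3 * ds P (y, s) + s ^+ 4 * ds (ds P) (y, s))
     * (v 0 i * y 0 i * (w 0 j * y 0 j))
   - s ^+ 3 * (v 0 i * y 0 i * (w 0 j * tang j (ds P) (y, s)))
   - s ^+ 2 * (v 0 i * tang i P (y, s) * (w 0 j * y 0 j))
   - s ^+ 3 * (v 0 i * tang i (ds P) (y, s) * (w 0 j * y 0 j)))).
  apply: eq_bigr => i _; apply: eq_bigr => j _; rewrite Lop_Lop//.
  move: (tang j (tang i P) _) (tang j (ds P) _) (tang i (ds P) _) => t1 t2 t3.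
  move: (tang i P _) (ds (ds P) _) (ds P _) => t4 t5 t6; ring.
rewrite comb !sep.
have -> : \sum_i \sum_j v 0 i * w 0 j * (i == j)%:R = dot v w.
  apply: eq_bigr => i _.
  rewrite (bigD1 i)//= eqxx mulr1 big1 ?addr0// => k ki.
  by rewrite eq_sym (negbTE ki) mulr0.
rewrite -/(tt v w P (y, s)) -/(dot v y) -/(dot w y).
rewrite -/(tv w (ds P) (y, s)) -/(tv v P (y, s)) -/(tv v (ds P) (y, s)).
move: (tt _ _ _ _) (tv w _ _) (tv v (ds P) _) (tv v P _) => t1 t2 t3 t4.
move: (ds (ds P) _) (ds P _) (dot v y) (dot w y) (dot v w) => *; ring.
Qed.

End Frames.

(** * Mean curvature and traceless part in the rescaled basis *)

Section Sym3.
Context {R : realType}.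
Notation M3 := 'M[R]_3.

Definition sym3 (a b c d e f : R) : M3 := \matrix_(i, j)
  (if i == 0 then (if j == 0 then a else if j == 1 then b else c)
   else if i == 1 then (if j == 0 then b else if j == 1 then d else e)
   else (if j == 0 then c else if j == 1 then e else f)).

Definition gen3 (a b c d e f g h k : R) : M3 := \matrix_(i, j)
  (if i == 0 then (if j == 0 then a else if j == 1 then b else c)
   else if i == 1 then (if j == 0 then d else if j == 1 then e else f)
   else (if j == 0 then g else if j == 1 then h else k)).

Lemma mx3P (A B : M3) :
  A 0 0 = B 0 0 -> A 0 1 = B 0 1 -> A 0 2 = B 0 2 ->
  A 1 0 = B 1 0 -> A 1 1 = B 1 1 -> A 1 2 = B 1 2 ->
  A 2 0 = B 2 0 -> A 2 1 = B 2 1 -> A 2 2 = B 2 2 -> A = B.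
Proof. by move=> *; apply/matrixP; apply: ord3P; apply: ord3P. Qed.

Lemma sym_mx3P (A B : M3) : A^T = A -> B^T = B ->
  A 0 0 = B 0 0 -> A 0 1 = B 0 1 -> A 0 2 = B 0 2 ->
  A 1 1 = B 1 1 -> A 1 2 = B 1 2 -> A 2 2 = B 2 2 -> A = B.
Proof.
move=> As Bs e1 e2 e3 e4 e5 e6.
by apply: mx3P => //; rewrite -As -Bs mxE [RHS]mxE.
Qed.

Lemma sym3_tr a b c d e f : (sym3 a b c d e f)^T = sym3 a b c d e f.
Proof. by apply: mx3P; rewrite !mxE. Qed.

Lemma mulmx3E (A B : M3) i j :
  (A *m B) i j = A i 0 * B 0 j + A i 1 * B 1 j + A i 2 * B 2 j.
Proof. by rewrite mxE sum3. Qed.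

Definition adj3 (a b c d e f : R) : M3 :=
  sym3 (d * f - e ^+ 2) (c * e - b * f) (b * e - c * d)
       (a * f - c ^+ 2) (b * c - a * e) (a * d - b ^+ 2).

Definition det3 (a b c d e f : R) : R :=
  a * (d * f - e ^+ 2) + b * (c * e - b * f) + c * (b * e - c * d).

Lemma mul_adj3 a b c d e f :
  sym3 a b c d e f *m adj3 a b c d e f = (det3 a b c d e f)%:M.
Proof.
by apply: mx3P; rewrite mulmx3E !mxE /= /det3 ?mulr1n ?mulr0n; ring.
Qed.

Lemma trace_conj (E Q B : M3) :
  \tr (E^T *m Q *m E *m B *m (E^T *m Q *m E) *m B) =
  \tr (Q *m (E *m B *m E^T) *m Q *m (E *m B *m E^T)).
Proof. by rewrite -!mulmxA mxtrace_mulC !mulmxA. Qed.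

Lemma trace_shift (X : M3) :
  \tr ((X - 1%:M) *m (X - 1%:M)) = \tr (X *m X) - 2 * \tr X + 3.
Proof. by rewrite mulmxBl mulmxBr mulmx1 mul1mx !linearB /= mxtrace1; ring. Qed.

Lemma trace3 (A : M3) : \tr A = A 0 0 + A 1 1 + A 2 2.
Proof. exact: sum3. Qed.

End Sym3.

Section HatBasis.
Context {R : realType}.
Notation V3 := 'rV[R]_3.
Notation W := ('rV[R]_3 * R)%type.
Implicit Types (u v w y e f : V3).

Lemma inner_gmx (y q u v : V3) h : inner (gmx y q h) u v =
  dot u v - dot u y * dot v y + (dot u y * dot v q + dot u q * dot v y)
  - h * dot u q * dot v q.
Proof.
rewrite /inner mul_gmx dotE.
have lin (a b c d : V3) x1 x2 x3 x4 z :
    dot (a - x1 *: b + (x2 *: c + x3 *: d) - x4 *: c) z =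
    dot a z - x1 * dot b z + (x2 * dot c z + x3 * dot d z) - x4 * dot c z.
  by rewrite !(dotDl, dotNl, dotZl).
by rewrite lin !(dotC v); ring.
Qed.

Section Jets.
(* h = 1 - 2ms; t, t2 are the first and second s-derivatives of P, a_i its
   tangential gradient, b_i that of its s-derivative, k_ij its Hessian. *)
Variables (m s t t2 a1 a2 b1 b2 k11 k12 k22 : R).
Local Notation h := (1 - 2 * m * s).
Local Notation N := (1 + s ^+ 2 * h * t).

Definition Fj : R := - 2 * t - a1 ^+ 2 - a2 ^+ 2 - s ^+ 2 * h * t ^+ 2.
Definition g11 := 1 - h * s ^+ 2 * a1 ^+ 2.
Definition g12 := - h * s ^+ 2 * a1 * a2.
Definition g13 := a1 + h * s ^+ 2 * a1 * t.
Definition g22 := 1 - h * s ^+ 2 * a2 ^+ 2.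
Definition g23 := a2 + h * s ^+ 2 * a2 * t.
Definition g33 := - 2 * t - h * s ^+ 2 * t ^+ 2.
Definition A11 := N - s * k11 - m * s ^+ 3 * N * a1 ^+ 2.
Definition A12 := - s * k12 - m * s ^+ 3 * N * a1 * a2.
Definition A13 := a1 + s * b1 + m * s ^+ 3 * t * a1 * (2 + h * s ^+ 2 * t).
Definition A22 := N - s * k22 - m * s ^+ 3 * N * a2 ^+ 2.
Definition A23 := a2 + s * b2 + m * s ^+ 3 * t * a2 * (2 + h * s ^+ 2 * t).
Definition A33 := - 2 * t - s * t2 - m * s ^+ 3 * t ^+ 2 * (3 + h * s ^+ 2 * t).

Definition Gj := sym3 g11 g12 g13 g22 g23 g33.
Definition Aj := sym3 A11 A12 A13 A22 A23 A33.
Definition Gadj := adj3 g11 g12 g13 g22 g23 g33.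
(** 3 F^(3/2) H, see [mean_curvature_frame]. *)
Definition Thj : R := \tr (Gadj *m Aj).

(** 3 F^(3/2) times the traceless part of the second fundamental form, in the
    basis (e, f, y / s). *)
Definition Tj : 'M[R]_3 := 3 * Fj *: Aj - Thj *: Gj.

(** The rows of Sj are orthogonal for Gj, of squared lengths 1, 1 and Fj:
    e_a - (P_a / P_s) d_s is tangent to the surface, and d_s is null. *)
Definition Sj : 'M[R]_3 := gen3 1 0 (a1 / t) 0 1 (a2 / t)
  a1 a2 (1 + a1 * (a1 / t) + a2 * (a2 / t)).
Definition Rj : 'M[R]_3 := gen3
  (1 + a1 / t * a1) (a1 / t * a2) (- (a1 / t))
  (a2 / t * a1) (1 + a2 / t * a2) (- (a2 / t)) (- a1) (- a2) 1.
Definition Dj : 'M[R]_3 := sym3 1 0 0 1 0 Fj.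
Definition dj (i : 'I_3) : R := if i == 2 then Fj^-1 else 1.

Lemma RjSj : Rj *m Sj = 1%:M.
Proof. by apply: mx3P; rewrite mulmx3E !mxE /= ?mulr1n ?mulr0n; ring. Qed.

Lemma Sj_orthogonal : t != 0 -> Sj *m Gj *m Sj^T = Dj.
Proof.
move=> t0; apply: sym_mx3P; first by rewrite !trmx_mul trmxK sym3_tr mulmxA.
- exact: sym3_tr.
all: rewrite !mulmx3E !mxE /= /g11 /g12 /g13 /g22 /g23 /g33 /Fj.
all: by field.
Qed.

Lemma Gj_adj : Gj *m Gadj = Fj%:M.
Proof.
rewrite /Gj /Gadj mul_adj3; congr (_%:M).
rewrite /det3 /Fj /g11 /g12 /g13 /g22 /g23 /g33; ring.
Qed.

Lemma ThjE : Thj =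
  (g22 * g33 - g23 ^+ 2) * A11 + (g11 * g33 - g13 ^+ 2) * A22
  + (g11 * g22 - g12 ^+ 2) * A33 + 2 * (g13 * g23 - g12 * g33) * A12
  + 2 * (g12 * g23 - g13 * g22) * A13 + 2 * (g12 * g13 - g11 * g23) * A23.
Proof. rewrite /Thj trace3 !mulmx3E !mxE /=; ring. Qed.

(** Here Fs, F1, F2 are the derivatives of F by s and along e and f, by
    [ds_lapF] and [tv_lapF]: P enters otherwise only through its Laplacian. *)
Lemma Thj_conformal :
  let beta := s ^+ 2 * h in let dbeta := 2 * s - 6 * m * s ^+ 2 in
  let Ns := dbeta * t + beta * t2 in
  let Fs := - 2 * t2 - 2 * (a1 * b1 + a2 * b2) - dbeta * t ^+ 2 - 2 * beta * t * t2 in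
  let F1 := - 2 * b1 - 2 * (a1 * k11 + a2 * k12) - 2 * beta * t * b1 in
  let F2 := - 2 * b2 - 2 * (a1 * k12 + a2 * k22) - 2 * beta * t * b2 in
  Thj = 3 * Fj * N - s * (Fj * Ns - N * Fs / 2 + Fj * (k11 + k22)
                          - (a1 * F1 + a2 * F2) / 2).
Proof.
rewrite /= ThjE /Fj /g11 /g12 /g13 /g22 /g23 /g33 /A11 /A12 /A13 /A22 /A23 /A33.
by field.
Qed.

End Jets.

Variables (m : R) (m_ge0 : 0 <= m) (U : set W) (U_open : open U)
  (P : W -> R) (P_smooth : Cinf U P).

Section AtFrame.
Variables (y e f : V3) (s : R).
Hypothesis (fr : frame y e f) (s_gt0 : 0 < s).
Let p : W := (y, s).
Hypothesis (Up : U p).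

Local Notation t := (ds P p).
Local Notation t2 := (ds (ds P) p).
Local Notation a1 := (tv e P p).
Local Notation a2 := (tv f P p).
Local Notation b1 := (tv e (ds P) p).
Local Notation b2 := (tv f (ds P) p).
Local Notation k11 := (tt e e P p).
Local Notation k12 := (tt e f P p).
Local Notation k22 := (tt f f P p).

Definition ebasis : 'M[R]_3 := mx3 e f (s^-1 *: y).

Let s0 : s != 0. Proof. by rewrite gt_eqF. Qed.
Let yy : dot y y = 1. Proof. by case: fr => [[]]. Qed.
Let ee : dot e e = 1. Proof. by case: fr => [[]]. Qed.
Let ff : dot f f = 1. Proof. by case: fr => [[]]. Qed.
Let ye : dot y e = 0. Proof. by case: fr => [_ []]. Qed.
Let yf : dot y f = 0. Proof. by case: fr => [_ []]. Qed.
Let ef : dot e f = 0. Proof. by case: fr => [_ []]. Qed.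
Let ey : dot e y = 0. Proof. by rewrite dotC. Qed.
Let fy : dot f y = 0. Proof. by rewrite dotC. Qed.
Let fe : dot f e = 0. Proof. by rewrite dotC. Qed.

Let tvy (F : W -> R) : tv y F p = 0.
Proof. exact: tang_radial. Qed.

Let eq_ : dot e (qv P p) = s * a1.
Proof. by rewrite dot_qv_frame ey; ring. Qed.
Let fq_ : dot f (qv P p) = s * a2.
Proof. by rewrite dot_qv_frame fy; ring. Qed.
Let yq_ : dot y (qv P p) = - s ^+ 2 * t.
Proof. by rewrite dot_qv_frame tvy yy; ring. Qed.

Lemma lapsq_frame : lapsq m P p = s ^+ 2 * Fj m s t a1 a2.
Proof.
rewrite -wdetE /wdet -[p.1]/y yq_ (parseval _ _ fr) !(dotC (qv P p)).
by rewrite eq_ fq_ yq_ /Fj /hfun -[p.2]/s; ring.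
Qed.

Lemma metric_frame : ebasis *m gmx y (qv P p) (hfun m p) *m ebasis^T =
  Gj m s t a1 a2.
Proof.
apply: sym_mx3P; first by rewrite !trmx_mul trmxK gmx_sym mulmxA.
- exact: sym3_tr.
all: rewrite inner_row !row_mx3 [RHS]mxE /= inner_gmx ?dotZl ?dotZr ?dotZl.
all: rewrite ?ee ?ff ?ef ?yy ?ey ?fy ?ye ?yf ?eq_ ?fq_ ?yq_ /hfun -[p.2]/s.
all: by rewrite /g11 /g12 /g13 /g22 /g23 /g33; field.
Qed.

Let ysph : eucl y = 1.
Proof.
apply/eqP; rewrite -(@eqrXn2 _ 2)// ?sqrtr_ge0//.
by rewrite eucl_sq yy expr1n.
Qed.

Lemma sph_pt : sph (pt y s) = p.
Proof.
have r : eucl (pt y s) = s^-1 by rewrite /pt euclZ ?invr_ge0 ?ltW// ysph mulr1.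
by rewrite /sph r /pt invrK scalerA mulfV// scale1r.
Qed.

Lemma pt_neq0 : pt y s != 0.
Proof.
rewrite /pt scaler_eq0 invr_eq0 (negbTE s0) /=.
by apply: sphere_neq0; rewrite /sphere2 /= ysph.
Qed.

Lemma eucl_pt : eucl (pt y s) = s^-1.
Proof. by rewrite /pt euclZ ?invr_ge0 ?ltW// ysph mulr1. Qed.

Lemma hmx_sym : (hmx P p)^T = hmx P p.
Proof.
apply/matrixP => i j; rewrite [LHS]mxE !hmxE.
have := hs_sym U_open P_smooth i j pt_neq0; rewrite sph_pt; exact.
Qed.

Lemma Bmx_sym : (Bmx m P p)^T = Bmx m P p.
Proof.
have hE i j : hmx P p i j = hmx P p j i by rewrite -{1}hmx_sym mxE.
apply/matrixP => i j; rewrite [LHS]mxE.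
have comb (A B C D : 'M[R]_3) a b c d k l :
    (a *: A - B - b *: (c *: C + d *: D)) k l =
    a * A k l - B k l - b * (c * C k l + d * D k l) by rewrite !mxE.
rewrite /Bmx !comb !rmxE !cmxE !qmxE (hE j i) (rrC j i).
by move: (hmx P p i j) (rr i j p) => *; ring.
Qed.

Let tvZ c v (F : W -> R) : tv (c *: v) F p = c * tv v F p.
Proof. by rewrite /tv mulr_sumr; apply: eq_bigr => k _; rewrite mxE mulrA. Qed.

Let ttZr c v w (F : W -> R) : tt v (c *: w) F p = c * tt v w F p.
Proof.
rewrite /tt mulr_sumr; apply: eq_bigr => i _; rewrite mulr_sumr.
by apply: eq_bigr => j _; rewrite mxE; ring.
Qed.

Let tty v (F : W -> R) : tt v y F p = 0.
Proof.
rewrite /tt big1// => i _; under eq_bigr do rewrite -mulrA.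
by rewrite -mulr_sumr tang_radial// mulr0.
Qed.

Lemma second_frame : ebasis *m Bmx m P p *m ebasis^T =
  s *: Aj m s t t2 a1 a2 b1 b2 k11 k12 k22.
Proof.
have innerB u v : inner (Bmx m P p) u v =
  (1 - 2 * m * s ^+ 3 * t) * (s * (dot u v - dot u y * dot v y))
  - inner (hmx P p) u v - m * s ^+ 2 * (- s ^+ 2 * t *
    (dot u y * dot v (qv P p) + dot u (qv P p) * dot v y)
    + (1 + hfun m p * s ^+ 2 * t) * (dot u (qv P p) * dot v (qv P p))).
  have lin (A B C D : 'M[R]_3) x1 x2 x3 x4 :
      inner (x1 *: A - B - x2 *: (x3 *: C + x4 *: D)) u v =
      x1 * inner A u v - inner B u v - x2 * (x3 * inner C u v + x4 * inner D u v).
    rewrite /inner !(mulmxDr, mulmxDl, mulmxN, mulNmx, =^~ scalemxAl, =^~ scalemxAr).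
    by rewrite !mxE.
  have rk (a b : V3) : inner (a^T *m b) u v = dot u a * dot v b.
    by rewrite /inner mul_rank1 -scalemxAl mxE dotE (dotC b).
  have linD (A B : 'M[R]_3) : inner (A + B) u v = inner A u v + inner B u v.
    by rewrite /inner mulmxDr mulmxDl mxE.
  have i1 : inner (1%:M : 'M[R]_3) u v = dot u v by rewrite /inner mulmx1 dotE.
  have lin2 (A B : 'M[R]_3) x : inner (x *: (A - B)) u v = x * (inner A u v - inner B u v).
    rewrite /inner !(mulmxDr, mulmxDl, mulmxN, mulNmx, =^~ scalemxAl, =^~ scalemxAr).
    by rewrite !mxE.
  rewrite /Bmx lin /rmx lin2 i1 /cmx linD /qmx !rk etaE// -[p.1]/y -[p.2]/s yq_ /hfun.
  by rewrite -[p.2]/s; ring.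
apply: sym_mx3P; first by rewrite !trmx_mul trmxK Bmx_sym mulmxA.
- by rewrite [LHS]linearZ /= sym3_tr.
all: rewrite inner_row !row_mx3 [RHS]mxE [X in _ * X]mxE /= innerB.
all: rewrite (inner_hmx U_open P_smooth _ _ yy Up) -/p.
all: rewrite ?ttZr ?tty ?tvZ ?tvy ?dotZl ?dotZr ?dotZl.
all: rewrite ?ee ?ff ?ef ?yy ?ey ?fy ?ye ?yf ?eq_ ?fq_ ?yq_ /hfun -[p.2]/s.
all: move: (tt e e P p) (tt e f P p) (tt f f P p) (tv e (ds P) p) (tv f (ds P) p).
all: move: (tv e P p) (tv f P p) (ds (ds P) p) (ds P p) => *.
all: by rewrite /A11 /A12 /A13 /A22 /A23 /A33; field.
Qed.

Local Notation F := (Fj m s t a1 a2).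
Local Notation Th := (Thj m s t t2 a1 a2 b1 b2 k11 k12 k22).
Local Notation T := (Tj m s t t2 a1 a2 b1 b2 k11 k12 k22).
Local Notation S := (Sj t a1 a2).
Local Notation G := (metricG m P (pt y s)).
Local Notation A := (secondA m P (pt y s)).
Hypothesis (ms1 : 2 * m * s < 1) (F_gt0 : 0 < F).

Lemma good_pt : good m U P (pt y s).
Proof.
split; rewrite ?sph_pt ?eucl_pt //; first exact: pt_neq0.
- by rewrite -[s^-1]mul1r ltr_pdivlMr.
- by rewrite lapsq_frame mulr_gt0// exprn_gt0.
Qed.

Let GE : G = gmx y (qv P p) (hfun m p).
Proof.
have [x0 mx Ux _] := good_pt.
by rewrite (metricG_mx m_ge0 P_smooth x0 mx Ux) sph_pt.
Qed.

Let Gframe : ebasis *m G *m ebasis^T = Gj m s t a1 a2.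
Proof. by rewrite GE metric_frame. Qed.

Let F0 : F != 0. Proof. by rewrite gt_eqF. Qed.

Let Gj_unit : Gj m s t a1 a2 \in unitmx.
Proof.
have e0 : Gj m s t a1 a2 *m (F^-1 *: Gadj m s t a1 a2) = 1%:M.
  by rewrite -scalemxAr Gj_adj scale_scalar_mx mulVf.
by case: (mulmx1_unit e0).
Qed.

Let ebasis_unit : ebasis \in unitmx.
Proof.
have := Gj_unit; rewrite -Gframe -mulmxA unitmx_mul; by case/andP.
Qed.

Let G_inv : invmx G = ebasis^T *m invmx (Gj m s t a1 a2) *m ebasis.
Proof.
have e0 : G *m (ebasis^T *m invmx (Gj m s t a1 a2) *m ebasis) = 1%:M.
  have -> : G = invmx ebasis *m (ebasis *m G) by rewrite mulKmx// ebasis_unit.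
  rewrite !mulmxA -(mulmxA (invmx ebasis)) -(mulmxA (invmx ebasis)) Gframe.
  by rewrite -(mulmxA (invmx ebasis)) mulmxV// mulmx1 mulVmx// ebasis_unit.
have Gu : G \in unitmx by case: (mulmx1_unit e0).
by rewrite -[LHS]mulmx1 -e0 mulKmx.
Qed.

Let trace_frame (B : 'M[R]_3) :
  \tr (invmx G *m B) = \tr (invmx (Gj m s t a1 a2) *m (ebasis *m B *m ebasis^T)).
Proof.
by rewrite G_inv -!mulmxA mxtrace_mulC !mulmxA.
Qed.

Let sqrtw : (Num.sqrt (lapsq m P (sph (pt y s))))^-1 * s = (Num.sqrt F)^-1.
Proof.
rewrite sph_pt lapsq_frame sqrtrM ?sqr_ge0// sqrtr_sqr gtr0_norm// invfM.
by rewrite mulrAC mulVf// mul1r.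
Qed.

Let A_frame : ebasis *m A *m ebasis^T =
  (Num.sqrt F)^-1 *: Aj m s t t2 a1 a2 b1 b2 k11 k12 k22.
Proof.
rewrite (secondA_mx m_ge0 U_open P_smooth good_pt) -scalemxAr -scalemxAl.
by rewrite sph_pt second_frame scalerA -sqrtw sph_pt.
Qed.

Lemma mean_curvature_frame : Hys m P y s = Th / (3 * F * Num.sqrt F).
Proof.
rewrite /Hys /mean_curvature trace_frame A_frame -scalemxAr mxtraceZ.
have -> : invmx (Gj m s t a1 a2) = F^-1 *: Gadj m s t a1 a2.
  have e0 : Gj m s t a1 a2 *m (F^-1 *: Gadj m s t a1 a2) = 1%:M.
    by rewrite -scalemxAr Gj_adj scale_scalar_mx mulVf.
  by rewrite -[LHS]mulmx1 -e0 mulKmx.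
rewrite -scalemxAl mxtraceZ -/(Thj _ _ _ _ _ _ _ _ _ _ _).
have q0 : Num.sqrt F != 0 by rewrite gt_eqF// sqrtr_gt0.
by move: (Num.sqrt F) q0 => q q0; field; rewrite F0 q0.
Qed.

Let Ao_frame : ebasis *m tracelessA m P (pt y s) *m ebasis^T =
  (3 * F * Num.sqrt F)^-1 *: T.
Proof.
rewrite /tracelessA mulmxBr mulmxBl A_frame -scalemxAr -scalemxAl Gframe.
rewrite -/(Hys m P y s) mean_curvature_frame /Tj scalerBr !scalerA.
have q0 : Num.sqrt F != 0 by rewrite gt_eqF// sqrtr_gt0.
move: (Num.sqrt F) q0 => q q0; congr (_ *: _ - _ *: _); last exact: mulrC.
by field; rewrite F0 q0.
Qed.

Let A_sym : A^T = A.
Proof.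
rewrite (secondA_mx m_ge0 U_open P_smooth good_pt) linearZ /=.
by rewrite sph_pt Bmx_sym.
Qed.

Let Ao_sym : (tracelessA m P (pt y s))^T = tracelessA m P (pt y s).
Proof. by rewrite /tracelessA linearB linearZ /= A_sym metricG_sym. Qed.

Let Q_sym : (invmx G)^T = invmx G.
Proof. by rewrite trmx_inv metricG_sym. Qed.

Lemma tensor_sum (Q B : 'M[R]_3) : Q^T = Q -> B^T = B ->
  \sum_i \sum_j \sum_k \sum_l Q i k * Q j l * B i j * B k l =
  \tr (Q *m B *m Q *m B).
Proof.
move=> Qs Bs.
have QE i j : Q i j = Q j i by rewrite -{1}Qs mxE.
have BE i j : B i j = B j i by rewrite -{1}Bs mxE.
have -> : \tr (Q *m B *m Q *m B) = \tr (B *m (Q *m B *m Q)).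
  by rewrite mxtrace_mulC.
apply: eq_bigr => i _; rewrite mxE; apply: eq_bigr => j _.
rewrite mxE mulr_sumr; apply: eq_bigr => k _.
rewrite mxE mulr_suml mulr_sumr; apply: eq_bigr => l _.
by rewrite (QE i k) (BE k l); ring.
Qed.

Hypothesis t0 : t != 0.

Let Gj_inv : invmx (Gj m s t a1 a2) =
  S^T *m (\matrix_(i, j) (dj m s t a1 a2 i *+ (i == j))) *m S.
Proof.
pose D' : 'M[R]_3 := \matrix_(i, j) (dj m s t a1 a2 i *+ (i == j)).
have SR : S *m Rj t a1 a2 = 1%:M by apply: mulmx1C; exact: RjSj.
have DD : Dj m s t a1 a2 *m D' = 1%:M.
  by apply: mx3P; rewrite mulmx3E !mxE /= /dj /= ?mulr1n ?mulr0n ?mulr0 ?mul0r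
    ?addr0 ?add0r ?mulr1// mulfV.
have GSD : Gj m s t a1 a2 *m S^T = Rj t a1 a2 *m Dj m s t a1 a2.
  by rewrite -(Sj_orthogonal _ _ _ _ t0) -mulmxA mulmxA RjSj mul1mx.
have e0 : Gj m s t a1 a2 *m (S^T *m D' *m S) = 1%:M.
  by rewrite !mulmxA GSD -(mulmxA (Rj _ _ _)) DD mulmx1 RjSj.
by rewrite -[LHS]mulmx1 -e0 mulKmx.
Qed.

(** A sum of squares: this gives both directions of the comparison of the norm
    with the components. *)
Definition Nsum : R := (9 * F ^+ 3)^-1 *
  \sum_i \sum_j dj m s t a1 a2 i * dj m s t a1 a2 j * (S *m T *m S^T) i j ^+ 2.

Let Ao_trace : \tr (invmx G *m tracelessA m P (pt y s) *m invmx G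
    *m tracelessA m P (pt y s)) = Nsum.
Proof.
pose D' : 'M[R]_3 := \matrix_(i, j) (dj m s t a1 a2 i *+ (i == j)).
set B := tracelessA m P (pt y s).
pose B' := ebasis *m B *m ebasis^T.
have -> : \tr (invmx G *m B *m invmx G *m B) =
    \tr (invmx (Gj m s t a1 a2) *m B' *m invmx (Gj m s t a1 a2) *m B').
  by rewrite G_inv; exact: trace_conj.
rewrite Gj_inv -/D'.
have -> : \tr (S^T *m D' *m S *m B' *m (S^T *m D' *m S) *m B') =
    \tr (D' *m (S *m B' *m S^T) *m D' *m (S *m B' *m S^T)).
  exact: trace_conj.
pose c := (3 * F * Num.sqrt F)^-1.
have -> : S *m B' *m S^T = c *: (S *m T *m S^T).
  by rewrite /B' Ao_frame -scalemxAr -scalemxAl.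
set N := S *m T *m S^T.
have Ns : N^T = N.
  rewrite /N !trmx_mul trmxK mulmxA; congr (_ *m _ *m _).
  by rewrite /Tj linearB /= !linearZ /= !sym3_tr.
have NE i j : N i j = N j i by rewrite -{1}Ns mxE.
rewrite -!scalemxAr -!scalemxAl scalerA mxtraceZ.
rewrite /Nsum -/N; have -> : c * c = (9 * F ^+ 3)^-1.
  rewrite /c -invfM; congr (_^-1).
  rewrite -[in RHS](sqr_sqrtr (ltW F_gt0)); move: (sqr_sqrtr (ltW F_gt0)).
  move: (Num.sqrt F) => q qF; rewrite -qF; ring.
congr (_ * _); apply: eq_bigr => i _.
have DN (M : 'M[R]_3) k l : (D' *m M) k l = dj m s t a1 a2 k * M k l.
  rewrite mxE (bigD1 k)//= mxE eqxx mulr1n big1 ?addr0// => r rk.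
  by rewrite mxE eq_sym (negbTE rk) mulr0n mul0r.
rewrite -mulmxA mxE; apply: eq_bigr => j _; rewrite !DN (NE j i); ring.
Qed.

Lemma normAo_sq : normAo m P y s = Num.sqrt Nsum.
Proof. by rewrite /normAo /tensor_norm (tensor_sum Q_sym Ao_sym) Ao_trace. Qed.

Lemma Nsum_ge0 : 0 <= Nsum.
Proof.
have d0 i : 0 <= dj m s t a1 a2 i.
  by rewrite /dj; case: ifP => // _; rewrite invr_ge0 ltW.
rewrite /Nsum mulr_ge0 ?invr_ge0 ?mulr_ge0 ?exprn_ge0 ?(ltW F_gt0)//.
apply: sumr_ge0 => i _; apply: sumr_ge0 => j _.
by rewrite mulr_ge0 ?sqr_ge0// mulr_ge0.
Qed.

Lemma Sys_frame : Hys m P y s = 1 -> Sys m P y s + 6 = normAo m P y s ^+ 2.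
Proof.
move=> H1; rewrite normAo_sq sqr_sqrtr ?Nsum_ge0// -Ao_trace.
rewrite /Sys (scalar_curvature_graph m_ge0 U_open P_smooth good_pt).
have H3 : \tr (invmx G *m A) = 3.
  have : mean_curvature m P (pt y s) = 1 by [].
  rewrite /mean_curvature => /(congr1 (fun z => 3 * z)).
  by rewrite mulrA mulfV ?mul1r ?mulr1// pnatr_eq0.
have Gu : G \in unitmx by rewrite GE gmx_unit// -[y]/(p.1) wdetE lapsq_frame mulf_neq0 ?expf_neq0.
have QG : invmx G *m G = 1%:M by rewrite mulVmx.
rewrite /tracelessA -/(Hys m P y s) H1 scale1r /kul H3.
have -> : invmx G *m (A - G) *m invmx G *m (A - G) =
    (invmx G *m A - 1%:M) *m (invmx G *m A - 1%:M).
  by rewrite -(mulmxA _ (invmx G)) mulmxBr QG.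
rewrite trace_shift H3 !mulmxA.
by move: (\tr _) => X; ring.
Qed.

End AtFrame.

End HatBasis.

(** * Compactness and orthonormal frames *)

Section Compactness.
Context {R : realType}.
Notation V3 := 'rV[R]_3.
Notation W := ('rV[R]_3 * R)%type.
Implicit Types (y e f : V3) (s : R).

Lemma unit_coord y i : dot y y = 1 -> `|y 0 i| <= 1.
Proof.
move=> yy; rewrite -(@ler_pXn2r _ 2) ?nnegrE// expr1n real_normK ?num_real//.
rewrite -yy /dot (bigD1 i)//= -expr2 lerDl.
by apply: sumr_ge0 => j _; rewrite -expr2 sqr_ge0.
Qed.

Lemma dot_sphere y : dot y y = 1 -> sphere2 y.
Proof. by move=> yy; rewrite /sphere2 /= -[RHS]sqrtr1 -yy -eucl_sq sqrtr_sqr ger0_norm ?sqrtr_ge0. Qed.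

Lemma sphere_compact : compact (@sphere2 R).
Proof.
apply: bounded_closed_compact.
  exists 1; split; first exact: num_real.
  move=> M M1 y ys; apply: le_trans (ltW M1).
  rewrite [leLHS]/Num.Def.normr /= mx_normrE; apply: bigmax_le => //= -[i k] _ /=.
  by rewrite (ord1 i); apply: unit_coord; exact: sphere_dot.
have -> : @sphere2 R = [set y | \sum_i y 0 i ^+ 2 \in [set 1]].
  apply/seteqP; split => y /=.
    by move/sphere_dot => yy; rewrite inE -yy; apply: eq_bigr => i _; rewrite expr2.
  by rewrite inE => yy; apply: dot_sphere; rewrite -yy; apply: eq_bigr => i _; rewrite expr2.
have c : continuous (fun y : V3 => \sum_i y 0 i ^+ 2).
  move=> y; apply: differentiable_continuous.
  by have [] := dder_sum (fun i => dderX 2 (dder_coord y 0 i)).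
have := @closed_comp _ _ _ [set (1 : R)] (fun x _ => c x) (@closed_eq _ _).
by congr closed; apply/seteqP; split => y /=; rewrite inE.
Qed.

Lemma collar_sub_compact (a b : R) :
  compact [set p : W | sphere2 p.1 /\ a <= p.2 <= b].
Proof.
have -> : [set p : W | sphere2 p.1 /\ a <= p.2 <= b] = @sphere2 R `*` `[a, b].
  by apply/seteqP; split => p /=; rewrite in_itv.
by apply: compact_setX; [exact: sphere_compact|exact: segment_compact].
Qed.

Lemma collar_min (F : W -> R) (a b : R) (y0 : V3) (s1 : R) :
  sphere2 y0 -> a <= s1 <= b ->
  (forall y s, sphere2 y -> a <= s <= b -> {for (y, s), continuous F}) ->
  exists y s, [/\ sphere2 y, a <= s <= b &
    forall y' s', sphere2 y' -> a <= s' <= b -> F (y, s) <= F (y', s')].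
Proof.
move=> ys sab Fc.
have [|||[y s] + h] := @compact_EVT_min _ _ F
    [set p : W | sphere2 p.1 /\ a <= p.2 <= b].
- by exists (y0, s1).
- exact: collar_sub_compact.
- apply: continuous_in_subspaceT => -[y s]; rewrite inE => -[ys' ab]; exact: Fc.
rewrite inE => -[ys' ab].
by exists y, s; split => // y' s' ys1 ab1; apply: h; rewrite inE.
Qed.

Lemma collar_bounded (F : W -> R) (a b : R) :
  (forall y s, sphere2 y -> a <= s <= b -> {for (y, s), continuous F}) ->
  exists2 C, 0 <= C & forall y s, sphere2 y -> a <= s <= b -> `|F (y, s)| <= C.
Proof.
move=> Fc.
have K : compact (F @` [set p : W | sphere2 p.1 /\ a <= p.2 <= b]).
  apply: continuous_compact; last exact: collar_sub_compact.
  apply: continuous_in_subspaceT => -[y s]; rewrite inE => -[ys' ab]; exact: Fc.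
have [M [_ h]] := compact_bounded K.
exists (`|M| + 1); first by rewrite addr_ge0.
move=> y s ys sab; apply: (h (`|M| + 1)).
  by rewrite (le_lt_trans (ler_norm M)) ?ltrDl.
by exists (y, s).
Qed.

Definition row3 (a b c : R) : V3 :=
  \row_i (if i == 0 then a else if i == 1 then b else c).

Lemma dot_row3 u a b c : dot u (row3 a b c) = u 0 0 * a + u 0 1 * b + u 0 2 * c.
Proof. by rewrite /dot sum3 !mxE. Qed.

Lemma frame_exists y : sphere2 y -> exists e f, frame y e f.
Proof.
move/sphere_dot => yy.
have yE : y = row3 (y 0 0) (y 0 1) (y 0 2).
  by apply/rowP; apply: ord3P; rewrite mxE.
move: yE yy; move: (y 0 0) (y 0 1) (y 0 2) => a b c ->.
rewrite dot_row3 !mxE /= => yy.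
have [r0|r0] := eqVneq (a ^+ 2 + b ^+ 2) 0.
  have [a0 b0] : a = 0 /\ b = 0 by split; nra.
  exists (row3 1 0 0), (row3 0 1 0).
  by rewrite /frame !dot_row3 !mxE /= yy a0 b0; split; split; ring.
pose r := Num.sqrt (a ^+ 2 + b ^+ 2).
have rr : r ^+ 2 = a ^+ 2 + b ^+ 2 by rewrite sqr_sqrtr// addr_ge0 ?sqr_ge0.
have r1 : r != 0 by rewrite -sqrf_eq0 rr.
clearbody r.
exists (row3 (- b / r) (a / r) 0), (row3 (- c * a / r) (- c * b / r) r).
have cE : c ^+ 2 = 1 - r ^+ 2 by rewrite rr -yy; ring.
rewrite /frame !dot_row3 !mxE /= yy; split; split => //.
- apply: (@mulIf _ (r ^+ 2)); first by rewrite expf_neq0.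
  transitivity (a ^+ 2 + b ^+ 2); first by field.
  by rewrite -rr mul1r.
- apply: (@mulIf _ (r ^+ 2)); first by rewrite expf_neq0.
  transitivity (c ^+ 2 * (a ^+ 2 + b ^+ 2) + r ^+ 4); first by field.
  by rewrite -rr cE; ring.
- by field.
- apply: (@mulIf _ r) => //.
  transitivity (c * (r ^+ 2 - (a ^+ 2 + b ^+ 2))); first by field.
  by rewrite rr subrr mulr0 mul0r.
- by field.
Qed.

Lemma frame_sphere y e f : frame y e f -> sphere2 y.
Proof. by case=> [[yy _ _] _]; exact: dot_sphere. Qed.

End Compactness.

(** * Expansions modulo s^4, uniform over orthonormal frames *)

Section Expansions.
Context {R : realType}.
Notation V3 := 'rV[R]_3.
Notation W := ('rV[R]_3 * R)%type.

(** The components of a tensor on the sphere depend on the frame; bounds and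
    expansions in s are meant uniformly over all frames. *)
Record fr := Fr { fy : V3; fe : V3; ff : V3; frP : frame fy fe ff }.

Implicit Types (phi psi : fr -> R -> R) (c d : fr -> nat -> R) (k : nat).

Definition unifO k phi : Prop := exists C d : R, [/\ 0 <= C, 0 < d &
  forall w s, 0 < s <= d -> `|phi w s| <= C * s ^+ k].

Lemma unifO_ext k phi psi : (forall w s, 0 < s -> phi w s = psi w s) ->
  unifO k phi -> unifO k psi.
Proof.
move=> e [C [d [C0 d0 h]]]; exists C, d; split => // w s sd.
by rewrite -e; [exact: h|case/andP: sd].
Qed.

Lemma unifOD k phi psi : unifO k phi -> unifO k psi ->
  unifO k (fun w s => phi w s + psi w s).
Proof.
move=> [C [d [C0 d0 h]]] [C' [d' [C0' d0' h']]].
exists (C + C'), (Num.min d d'); split; rewrite ?addr_ge0 ?lt_min ?d0//.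
move=> w s /andP[s0]; rewrite le_min => /andP[sd sd'].
rewrite mulrDl (le_trans (ler_normD _ _))// lerD// ?h ?h'// ?s0//.
Qed.

Lemma unifOM k l phi psi : unifO k phi -> unifO l psi ->
  unifO (k + l) (fun w s => phi w s * psi w s).
Proof.
move=> [C [d [C0 d0 h]]] [C' [d' [C0' d0' h']]].
exists (C * C'), (Num.min d d'); split; rewrite ?mulr_ge0 ?lt_min ?d0//.
move=> w s /andP[s0]; rewrite le_min => /andP[sd sd'].
by rewrite normrM exprD mulrACA ler_pM// ?h ?h'// ?s0.
Qed.

Lemma unifOM0 (phi psi : fr -> R -> R) :
  unifO 0 phi -> unifO 0 psi -> unifO 0 (fun w s => phi w s * psi w s).
Proof. by move=> b1 b2; exact: (unifOM b1 b2). Qed.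

Lemma unifO_le k l phi : (k <= l)%N -> unifO l phi -> unifO k phi.
Proof.
move=> kl [C [d [C0 d0 h]]].
exists C, (Num.min d 1); split; rewrite ?lt_min ?d0 ?ltr01//.
move=> w s /andP[s0]; rewrite le_min => /andP[sd s1].
apply: le_trans (h w s _) _; first by rewrite s0.
by rewrite ler_wpM2l// -(subnK kl) exprD ler_piMl ?exprn_ge0 ?exprn_ile1// ltW.
Qed.

Lemma unifO_cst (a : fr -> R) C : (forall w, `|a w| <= C) -> unifO 0 (fun w _ => a w).
Proof.
move=> h; exists `|C|, 1; split=> // w s _.
by rewrite expr0 mulr1 (le_trans (h w))// ler_norm.
Qed.

Lemma unifO_real (a : R) : unifO 0 (fun _ _ => a).
Proof. by apply: (@unifO_cst _ `|a|). Qed.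

Lemma unifO_s k : unifO k (fun _ s => s ^+ k).
Proof.
exists 1, 1; split=> // w s /andP[s0 _].
by rewrite mul1r ger0_norm// exprn_ge0// ltW.
Qed.

Lemma unifO0 k : unifO k (fun _ _ => 0).
Proof.
by exists 0, 1; split=> // w s _; rewrite normr0 mul0r.
Qed.

Lemma unifON k phi : unifO k phi -> unifO k (fun w s => - phi w s).
Proof.
move=> [C [d [C0 d0 h]]]; exists C, d; split => // w s sd.
by rewrite normrN h.
Qed.

Lemma unifOB k phi psi : unifO k phi -> unifO k psi ->
  unifO k (fun w s => phi w s - psi w s).
Proof. by move=> p q; apply: unifOD => //; exact: unifON. Qed.

Lemma unifO_sum k n (phi : 'I_n -> fr -> R -> R) : (forall i, unifO k (phi i)) ->
  unifO k (fun w s => \sum_i phi i w s).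
Proof.
elim: n phi => [|n IH] phi h.
  by apply: unifO_ext (unifO0 k) => w s _; rewrite big_ord0.
have := unifOD (h ord0) (IH (fun i => phi (lift ord0 i)) (fun i => h _)).
by apply: unifO_ext => w s _; rewrite big_ord_recl.
Qed.

Lemma unifO_lead k (a : fr -> R) : unifO k.+1 (fun w s => a w * s ^+ k) ->
  forall w, a w = 0.
Proof.
move=> [C [d [C0 d0 h]]] w; apply/eqP; rewrite -normr_le0; apply/ler_addgt0Pr => e e0.
rewrite add0r; pose s := Num.min d (e / (C + 1)).
have C1 : 0 < C + 1 by rewrite ltr_wpDl.
have s0 : 0 < s by rewrite lt_min d0 divr_gt0.
have := h w s; rewrite s0 ge_min lexx /= => /(_ isT).
rewrite normrM (gtr0_norm (exprn_gt0 _ s0)) exprSr mulrA (mulrAC _ _ s).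
rewrite ler_pM2r ?exprn_gt0// => /le_trans; apply.
have : (C + 1) * s <= e.
  by rewrite mulrC -ler_pdivlMr// ge_min lexx orbT.
by apply: le_trans; rewrite ler_pM2r// lerDl.
Qed.

Lemma unifO_small (phi : fr -> R -> R) (eps : R) : unifO 1 phi -> 0 < eps ->
  exists2 d, 0 < d & forall w s, 0 < s <= d -> `|phi w s| <= eps.
Proof.
move=> [C [d [C0 d0 h]]] e0.
have C1 : 0 < C + 1 by rewrite ltr_wpDl.
exists (Num.min d (eps / (C + 1))) => [|w s /andP[sp]].
  by rewrite lt_min d0 divr_gt0.
rewrite le_min ler_pdivlMr// => /andP[sd se].
apply: le_trans (h w s _) _; first by rewrite sp.
by rewrite expr1; apply: le_trans se; rewrite mulrC ler_pM2l// lerDl.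
Qed.

Definition poly4 (c : nat -> R) (s : R) : R := \sum_(j < 4) c j * s ^+ j.

Lemma poly4E (c : nat -> R) s : poly4 c s = c 0%N + c 1%N * s + c 2%N * s ^+ 2 + c 3%N * s ^+ 3.
Proof. by rewrite /poly4 !big_ord_recr big_ord0 /= add0r expr0 mulr1 expr1. Qed.

(** phi = c_0 + c_1 s + c_2 s^2 + c_3 s^3 + O(s^4), with bounded c_j. *)
Definition expands phi c : Prop := (forall j, (j < 4)%N -> unifO 0 (fun w _ => c w j)) /\
  unifO 4 (fun w s => phi w s - poly4 (c w) s).

Lemma unifO_poly4 c : (forall j, (j < 4)%N -> unifO 0 (fun w _ => c w j)) ->
  unifO 0 (fun w s => poly4 (c w) s).
Proof.
move=> cb; apply: unifO_sum => j; apply: (@unifOM 0 0); first exact: cb.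
exact: unifO_le (unifO_s _).
Qed.

Lemma expands_bounded phi c : expands phi c -> unifO 0 phi.
Proof.
move=> [cb h]; have := unifOD (unifO_le (leq0n _) h) (unifO_poly4 cb).
by apply: unifO_ext => w s _; rewrite subrK.
Qed.

Lemma expands_coef phi c d : expands phi c ->
  (forall w j, (j < 4)%N -> c w j = d w j) -> expands phi d.
Proof.
move=> [cb h] e; split=> [j j4|].
  by apply: unifO_ext (cb j j4) => w s _; exact: e.
apply: unifO_ext h => w s _; congr (_ - _).
by apply: eq_bigr => j _; rewrite e.
Qed.

Lemma expands_ext phi psi c : (forall w s, 0 < s -> phi w s = psi w s) ->
  expands phi c -> expands psi c.
Proof. by move=> e [cb h]; split=> //; apply: unifO_ext h => w s s0; rewrite e. Qed.

Lemma expandsD phi psi c d : expands phi c -> expands psi d ->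
  expands (fun w s => phi w s + psi w s) (fun w j => c w j + d w j).
Proof.
move=> [cb hc] [db hd]; split=> [j j4|]; first by apply: unifOD; [exact: cb|exact: db].
apply: unifO_ext (unifOD hc hd) => w s _; rewrite !poly4E; ring.
Qed.

Lemma expandsN phi c : expands phi c ->
  expands (fun w s => - phi w s) (fun w j => - c w j).
Proof.
move=> [cb hc]; split=> [j j4|]; first by apply: unifON; exact: cb.
apply: unifO_ext (unifON hc) => w s _; rewrite !poly4E; ring.
Qed.

(** The product of power series modulo s^4. *)
Definition mulc (c d : nat -> R) (j : nat) : R :=
  match j with
  | 0 => c 0%N * d 0%N
  | 1 => c 0%N * d 1%N + c 1%N * d 0%N
  | 2 => c 0%N * d 2%N + c 1%N * d 1%N + c 2%N * d 0%N
  | 3 => c 0%N * d 3%N + c 1%N * d 2%N + c 2%N * d 1%N + c 3%N * d 0%N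
  | _ => 0
  end.

Lemma expandsM phi psi c d : expands phi c -> expands psi d ->
  expands (fun w s => phi w s * psi w s) (fun w => mulc (c w) (d w)).
Proof.
move=> ec ed; have [cb hc] := ec; have [db hd] := ed.
have cd i j : (i < 4)%N -> (j < 4)%N -> unifO 0 (fun w _ => c w i * d w j).
  by move=> i4 j4; apply: (@unifOM 0 0); [exact: cb|exact: db].
split=> [[|[|[|[|//]]]] _ /=|].
- exact: cd.
- by do ?apply: unifOD; exact: cd.
- by do ?apply: unifOD; exact: cd.
- by do ?apply: unifOD; exact: cd.
pose rest w s := (c w 1%N * d w 3%N + c w 2%N * d w 2%N + c w 3%N * d w 1%N)
  + s * (c w 2%N * d w 3%N + c w 3%N * d w 2%N) + s ^+ 2 * (c w 3%N * d w 3%N).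
have sb : unifO 0 (fun _ s => s) by exact: unifO_le (unifO_s 1).
have hr : unifO 0 rest.
  apply: unifOD; first apply: unifOD.
  - by do ?apply: unifOD; exact: cd.
  - by apply: (@unifOM 0 0) => //; apply: unifOD; exact: cd.
  - by apply: (@unifOM 0 0) => //; [exact: unifO_le (unifO_s 2)|exact: cd].
have := unifOD (unifOM hc (expands_bounded ed)) (unifOD (unifOM (unifO_poly4 cb) hd)
  (unifOM (unifO_s 4) hr)).
by apply: unifO_ext => w s _; rewrite /rest /= !poly4E /mulc; ring.
Qed.

Lemma expands_cst (a : fr -> R) : unifO 0 (fun w _ => a w) ->
  expands (fun w _ => a w) (fun w j => if j is 0 then a w else 0).
Proof.
move=> ab; split=> [[|j] _|]; [exact: ab|exact: unifO0|].
by apply: unifO_ext (unifO0 4) => w s _; rewrite poly4E; ring.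
Qed.

Lemma expands_s : expands (fun _ s => s) (fun _ j => if j == 1 then 1 else 0).
Proof.
split=> [j _|].
  by have [_|_] := ifP; [exact: unifO_real|exact: unifO0].
by apply: unifO_ext (unifO0 4) => w s _; rewrite poly4E /=; ring.
Qed.

Lemma expands_sum n (phi : 'I_n -> fr -> R -> R) (c : 'I_n -> fr -> nat -> R) :
  (forall i, expands (phi i) (c i)) ->
  expands (fun w s => \sum_i phi i w s) (fun w j => \sum_i c i w j).
Proof.
elim: n phi c => [|n IH] phi c h.
  by apply: expands_ext (expands_coef (expands_cst (unifO0 0)) _) =>
    [w s _|w [|j] _]; rewrite big_ord0.
have := expandsD (h ord0) (IH (fun i => phi (lift ord0 i)) _ (fun i => h _)).
move=> e; apply: expands_ext (expands_coef e _) => [w s _|w j _].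
all: by rewrite big_ord_recl.
Qed.

Lemma expands_unifO phi c k : (k <= 4)%N -> expands phi c ->
  unifO k phi <-> (forall w j, (j < k)%N -> c w j = 0).
Proof.
move=> k4 [cb h]; have hp : unifO k (fun w s => phi w s - poly4 (c w) s).
  exact: unifO_le h.
have term j : (j < 4)%N -> unifO j (fun w s => c w j * s ^+ j).
  by move=> j4; apply: (@unifOM 0 j); [exact: cb|exact: unifO_s].
split=> [hk|c0]; last first.
  have : unifO k (fun w s => poly4 (c w) s).
    apply: unifO_sum => j; have [jk|kj] := ltnP j k; last exact: unifO_le (term j _).
    by apply: unifO_ext (unifO0 k) => w s _; rewrite c0// mul0r.
  by move/(unifOD hp); apply: unifO_ext => w s _; rewrite subrK.
have pk : unifO k (fun w s => poly4 (c w) s).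
  by apply: unifO_ext (unifOB hk hp) => w s _; ring.
suff : forall n w j, (n <= k)%N -> (j < n)%N -> c w j = 0 by move=> H w j; exact: H.
elim=> [//|n IH] w j nk; rewrite ltnS leq_eqVlt => /orP[/eqP->|]; last first.
  by apply: IH; exact: ltnW.
apply: (@unifO_lead n (fun w => c w n)).
have n4 : (n < 4)%N by exact: leq_trans k4.
have : unifO n.+1 (fun w s => \sum_(j < 4) (if j == n :> nat then 0 else c w j * s ^+ j)).
  apply: unifO_sum => i; case: ltngtP => [i_n|n_i|_]; last exact: unifO0.
  - by apply: unifO_ext (unifO0 _) => w' s _; rewrite (IH w' i (ltnW nk))// mul0r.
  - exact: unifO_le (term i _).
move/(unifOB (unifO_le nk pk)); apply: unifO_ext => w' s _.
rewrite /poly4 (bigD1 (Ordinal n4))//= [X in _ - X](bigD1 (Ordinal n4))//= eqxx add0r.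
rewrite [X in _ - X](eq_bigr (fun i : 'I_4 => c w' i * s ^+ i)) ?addrK// => i ni.
by rewrite ifN.
Qed.

End Expansions.

(** Boundedness of polynomial expressions in functions known to be bounded. *)
Ltac bounded_expr := repeat first
  [ assumption | apply: unifO_real | apply: unifOB | apply: unifON
  | apply: unifOD | apply: unifOM0 ].


Section Taylor.
Context {R : realType}.
Notation V3 := 'rV[R]_3.
Notation W := ('rV[R]_3 * R)%type.
Variables (U : set W) (U_open : open U) (s0 : R) (s0_gt0 : 0 < s0).
Hypothesis (collarU : collar s0 `<=` U).

Definition sder (F : W -> R) (n : nat) : W -> R := iter n (@ds R) F.

Lemma sderS F n : sder (ds F) n = sder F n.+1.
Proof. by rewrite /sder iterSr. Qed.

Lemma Cinf_ds F : Cinf U F -> Cinf U (ds F).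
Proof. exact: Cinf_derive. Qed.

Lemma Cinf_sder F n : Cinf U F -> Cinf U (sder F n).
Proof. by elim: n => [//|n IH] /IH; exact: Cinf_ds. Qed.

Lemma collar_pt (w : fr) s : 0 <= s <= s0 -> U (fy w, s).
Proof. by move=> s01; apply: collarU; split => //; exact: frame_sphere (frP w). Qed.

Lemma bounded_collar F : Cinf U F -> exists2 C, 0 <= C &
  forall (w : fr) s, 0 <= s <= s0 -> `|F (fy w, s)| <= C.
Proof.
move=> Fs; have [|C C0 h] := @collar_bounded _ F 0 s0.
  by move=> y s ys s01; apply: (Cinf_cont Fs); apply: collarU.
by exists C => // w s s01; apply: h => //; exact: frame_sphere (frP w).
Qed.

(** The s-derivative of the remainder is the remainder of one order less for
    ds F, and the mean value theorem integrates the bound. *)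
Lemma taylor n F : Cinf U F -> exists2 C, 0 <= C &
  forall (w : fr) s, 0 <= s <= s0 ->
  `|F (fy w, s) - \sum_(j < n) sder F j (fy w, 0) / j`!%:R * s ^+ j| <= C * s ^+ n.
Proof.
elim: n F => [|n IH] F Fs.
  have [C C0 h] := bounded_collar Fs; exists C => // w s s01.
  by rewrite big_ord0 subr0 expr0 mulr1 h.
have [C C0 h] := IH _ (Cinf_ds Fs); exists C => // w s /andP[].
rewrite le_eqVlt => /orP[/eqP<- _|sp ss0].
  rewrite big_ord_recl /= fact0 divr1 expr0 mulr1 big1 => [|i _]; last first.
    by rewrite expr0n /= mulr0.
  by rewrite addr0 subrr normr0 expr0n mulr0.
pose c j := sder F j (fy w, 0) / j`!%:R.
pose f (q : W) := F q - \sum_(j < n.+1) c j * q.2 ^+ j.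
have fD t : 0 <= t <= s -> dder f (fy w, t) es
    (ds F (fy w, t) - \sum_(j < n) sder (ds F) j (fy w, 0) / j`!%:R * t ^+ j).
  move=> /andP[t0 ts].
  have Ut : U (fy w, t) by apply: collar_pt; rewrite t0 (le_trans ts).
  apply: dder_eq.
    apply: dderB; first by apply: dderE; exact: Cinf_diff Fs Ut.
    apply: dder_sum => j; apply: dderM; first exact: dder_cst.
    by apply: dderX; exact: dder_snd.
  congr (_ - _); rewrite big_ord_recl /= !mul0r !mulr0 addr0 add0r.
  apply: eq_bigr => j _; rewrite /c /bump add0n add1n sderS mulr0 addr0 mulr1 factS natrM.
  have cancel (x z a b : R) : a != 0 -> b != 0 -> x / (a * b) * (a * z) = x / b * z.
    by move=> a0 b0; field; rewrite a0 b0.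
  by apply: cancel; rewrite pnatr_eq0 // -lt0n fact_gt0.
have line t : (fy w, 0) + t *: es = (fy w, t) :> W.
  by apply: injective_projections => /=; rewrite ?scaler0 ?addr0// add0r [LHS]mulr1.
have [|t t0s] := @MVT_line _ _ f (fy w, 0) es s sp.
  by move=> t ts; rewrite line; have [] := fD t ts.
rewrite !line; have -> : f (fy w, 0) = 0.
  rewrite /f big_ord_recl /= /c /= fact0 divr1 expr0 mulr1 big1 ?addr0 ?subrr// => i _.
  by rewrite expr0n /= mulr0.
have /andP[tp ts] := t0s.
have t0s' : 0 <= t <= s by rewrite !ltW.
have [_ ->] := fD t t0s'.
rewrite subr0 {1}/f /= {1}/c => ->; rewrite normrM gtr0_norm// exprS mulrCA ler_pM2l//.
apply: le_trans (h w t _) _; first by rewrite ltW//= (le_trans (ltW ts)).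
by rewrite ler_wpM2l// lerXn2r// ?nnegrE ltW.
Qed.

Lemma expands_Cinf F : Cinf U F -> expands (fun w s => F (fy w, s))
  (fun w j => sder F j (fy w, 0) / j`!%:R).
Proof.
move=> Fs; split=> [j _|].
  have [C C0 h] := bounded_collar (Cinf_sder j Fs).
  apply: (@unifO_cst _ _ (C / j`!%:R)) => w; rewrite normrM.
  by rewrite [`|_^-1|]ger0_norm ?invr_ge0// ler_wpM2r ?invr_ge0// h// lexx ltW.
have [C C0 h] := taylor 4 Fs.
by exists C, s0; split => // w s /andP[sp ss]; apply: h; rewrite ltW.
Qed.

Lemma mulc_cst (a : R) d j : (j < 4)%N ->
  mulc (fun j => if j is 0 then a else 0) d j = a * d j.
Proof. by case: j => [|[|[|[|//]]]] _ /=; ring. Qed.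

Lemma unifO_unit (u : fr -> V3) k : (forall w, dot (u w) (u w) = 1) ->
  unifO 0 (fun w _ => u w 0 k).
Proof. by move=> uu; apply: (@unifO_cst _ _ 1) => w; exact: unit_coord. Qed.

Lemma tang_near i (F G : W -> R) p : (\near p, F p = G p) -> tang i F p = tang i G p.
Proof.
move=> FG; rewrite /tang (near_eq_derive _ FG); congr (_ - _ * _).
by apply: eq_bigr => k _; rewrite (near_eq_derive _ FG).
Qed.

Lemma sder_tang i P n p : Cinf U P -> U p ->
  sder (tang i P) n p = tang i (sder P n) p.
Proof.
elim: n P p => [//|n IH] P p Ps Up.
have Cd : Cinf U (sder P n) by exact: Cinf_sder.
rewrite /sder /= -/(sder _ n) -/(sder P n) -(ds_tang U_open Cd)//.
apply: near_eq_derive; apply: filterS (near_open U_open Up) => q Uq; exact: IH.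
Qed.

Lemma expands_tv (u : fr -> V3) P : (forall w, dot (u w) (u w) = 1) -> Cinf U P ->
  expands (fun w s => tv (u w) P (fy w, s))
    (fun w j => tv (u w) (sder P j) (fy w, 0) / j`!%:R).
Proof.
move=> uu Ps; have := @expands_sum _ 3
  (fun k w s => u w 0 k * tang k P (fy w, s)) _
  (fun k => expandsM (expands_cst (unifO_unit k uu))
    (expands_Cinf (Cinf_tang U_open k Ps))).
move=> e; apply: (expands_coef e) => w j j4; rewrite /tv mulr_suml; apply: eq_bigr => k _.
have U0 : U (fy w, 0) by apply: collar_pt; rewrite lexx ltW.
by rewrite -(sder_tang _ _ Ps U0) mulc_cst// mulrA.
Qed.

Lemma expands_tt (u v : fr -> V3) P : (forall w, dot (u w) (u w) = 1) ->
  (forall w, dot (v w) (v w) = 1) -> Cinf U P ->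
  expands (fun w s => tt (u w) (v w) P (fy w, s))
    (fun w j => tt (u w) (v w) (sder P j) (fy w, 0) / j`!%:R).
Proof.
move=> uu vv Ps; have := @expands_sum _ 3
  (fun k w s => u w 0 k * tv (v w) (tang k P) (fy w, s)) _
  (fun k => expandsM (expands_cst (unifO_unit k uu))
    (expands_tv vv (Cinf_tang U_open k Ps))).
move=> e; apply: expands_ext (expands_coef e _) => [w s _|w j j4].
  by apply: eq_bigr => k _; rewrite /tv mulr_sumr; apply: eq_bigr => l _; rewrite mulrA.
have U0 : U (fy w, 0) by apply: collar_pt; rewrite lexx ltW.
rewrite /tt mulr_suml; apply: eq_bigr => k _.
rewrite [in RHS](eq_bigr (fun l => u w 0 k * (v w 0 l * tang l (sder (tang k P) j) (fy w, 0)))).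
  by rewrite -mulr_sumr -mulrA mulc_cst.
move=> l _; rewrite mulrA; congr (_ * _); apply: tang_near.
by apply: filterS (near_open U_open U0) => q Uq; rewrite sder_tang.
Qed.

End Taylor.

(** * Tangential calculus *)

Section TangentialCalculus.
Context {R : realType}.
Notation V3 := 'rV[R]_3.
Notation W := ('rV[R]_3 * R)%type.
Variables (U : set W) (U_open : open U).
Implicit Types (F G P : W -> R) (p : W).

Lemma tang_dder i F p d : dder F p (tdir i p) d -> tang i F p = d.
Proof. by move=> [Fd <-]; exact: tang_derive. Qed.

Lemma dder_tang i F p : differentiable F p -> dder F p (tdir i p) (tang i F p).
Proof. by move=> Fd; rewrite tang_derive//; exact: dderE. Qed.

Lemma tangM i F G p : differentiable F p -> differentiable G p ->
  tang i (fun q => F q * G q) p = F p * tang i G p + G p * tang i F p.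
Proof. by move=> Fd Gd; apply: tang_dder; apply: dderM; exact: dder_tang. Qed.

Lemma tangD i F G p : differentiable F p -> differentiable G p ->
  tang i (fun q => F q + G q) p = tang i F p + tang i G p.
Proof. by move=> Fd Gd; apply: tang_dder; apply: dderD; exact: dder_tang. Qed.

Lemma tang_cst i (c : R) p : tang i (fun=> c) p = 0.
Proof. by apply: tang_dder; exact: dder_cst. Qed.

Lemma tang_fst i k p : tang i (fun q => q.1 0 k) p = (i == k)%:R - p.1 0 i * p.1 0 k.
Proof.
apply: tang_dder; apply: dder_eq (dder_fst _ _ _) _.
rewrite /tdir /= rowBZ; congr (_ - _).
by rewrite /ebase mxE eqxx /= eq_sym.
Qed.

(** The part of T_k T_j F that is symmetric in k and j cancels; what remains
    comes from the derivative of the normal y_j in T_j = D_j - y_j D_y. *)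
Lemma tang_comm F k j p : Cinf U F -> U p ->
  tang k (tang j F) p - tang j (tang k F) p =
  p.1 0 k * tang j F p - p.1 0 j * tang k F p.
Proof.
move=> Fs Up.
pose H k l := 'D_(ez k) ('D_(ez l) F) p.
have Hs k' l : H k' l = H l k' by exact: (derive_comm_Cinf U_open).
pose S := \sum_l p.1 0 l * 'D_(ez l) F p.
have D l : differentiable ('D_(ez l) F) p.
  by apply: Cinf_diff Up; exact: Cinf_derive.
pose yH b := \sum_l p.1 0 l * H l b.
have tD a b : tang a ('D_(ez b) F) p = H a b - p.1 0 a * yH b by [].
have T1 a : tang a F p = 'D_(ez a) F p - p.1 0 a * S by [].
have TT a b : tang a (tang b F) p = tang a ('D_(ez b) F) p
    - (p.1 0 b * \sum_l (p.1 0 l * tang a ('D_(ez l) F) p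
         + 'D_(ez l) F p * ((a == l)%:R - p.1 0 a * p.1 0 l))
       + S * ((a == b)%:R - p.1 0 a * p.1 0 b)).
  apply: tang_dder; apply: dderB; first exact: dder_tang.
  have df l : dder (fun q : W => q.1 0 l) p (tdir a p) ((a == l)%:R - p.1 0 a * p.1 0 l).
    by rewrite -tang_fst; apply: dder_tang; have [] := dder_fst p 0 l.
  apply: dderM; first exact: df.
  by apply: dder_sum => l; apply: dderM; [exact: df|exact: dder_tang].
have sumE (y h d : 'I_3 -> R) (a : 'I_3) (yHy : R) : yHy = \sum_l y l * h l ->
    \sum_l (y l * (H a l - y a * h l) + d l * ((a == l)%:R - y a * y l)) =
    \sum_l y l * H a l - y a * yHy + (d a - y a * \sum_l y l * d l).
  move=> ->; rewrite big_split /=; congr (_ + _).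
    by rewrite mulr_sumr -sumrB; apply: eq_bigr => l _; ring.
  have da : \sum_l d l * (a == l)%:R = d a.
    rewrite (bigD1 a)//= eqxx mulr1 big1 ?addr0// => l la.
    by rewrite eq_sym (negbTE la) mulr0.
  by rewrite mulr_sumr -da -sumrB; apply: eq_bigr => l _; ring.
pose yHy := \sum_l p.1 0 l * yH l.
have TTE a b : tang a (tang b F) p = H a b - p.1 0 a * yH b
    - (p.1 0 b * (yH a - p.1 0 a * yHy + tang a F p)
       + S * ((a == b)%:R - p.1 0 a * p.1 0 b)).
  have HE : \sum_l p.1 0 l * H a l = yH a by apply: eq_bigr => l _; rewrite Hs.
  apply: etrans (TT a b) _; congr (_ - (_ * _ + _)).
  by rewrite -HE; exact: (sumE (fun l => p.1 0 l) yH (fun l => 'D_(ez l) F p)).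
have alg (h a b u v x z n c d : R) :
    h - a * v - (b * (u - a * n + x) + c * (d - a * b))
    - (h - b * u - (a * (v - b * n + z) + c * (d - b * a))) = a * z - b * x.
  by ring.
rewrite (TTE k j) (TTE j k) (Hs k j) (eq_sym k j); exact: alg.
Qed.

Lemma tt_sym y e f s F : frame y e f -> Cinf U F -> U (y, s) ->
  tt f e F (y, s) = tt e f F (y, s).
Proof.
move=> [_ [ye yf _]] Fs Up; apply/eqP; rewrite -subr_eq0; apply/eqP.
rewrite /tt exchange_big /= -sumrB.
under eq_bigr => i _.
  rewrite -sumrB; under eq_bigr => j _.
    rewrite (_ : _ - _ = e 0 i * f 0 j * (y 0 i * tang j F (y, s) - y 0 j * tang i F (y, s))).
      over.
    rewrite -(tang_comm i j Fs Up)/=; ring.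
  over.
have -> : \sum_i \sum_j e 0 i * f 0 j * (y 0 i * tang j F (y, s) - y 0 j * tang i F (y, s))
  = dot y e * tv f F (y, s) - dot y f * tv e F (y, s).
  by rewrite /dot /tv !sum3; ring.
by rewrite ye yf !mul0r subrr.
Qed.

(** Only the restriction of F to the sphere matters, through its extension of
    degree 0. *)
Lemma tang_ext i F G y s : (forall z, sphere2 z -> U (z, s)) ->
  Cinf U F -> Cinf U G -> (forall z, sphere2 z -> F (z, s) = G (z, s)) ->
  sphere2 y -> tang i F (y, s) = tang i G (y, s).
Proof.
move=> sU Fs Gs FG ys; have y0 := sphere_neq0 ys.
have yE : (eucl y)^-1 *: y = y by rewrite ys invr1 scale1r.
have Uy : U (y, s) by exact: sU.
have T H : Cinf U H ->
    tang i H (y, s) = 'D_(ebase R i) (fun z => H ((eucl z)^-1 *: z, s)) y.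
  move=> Hs; have [|_ ->] := @dder_hat0 _ H s y i y0.
    by rewrite yE; exact: Cinf_diff Hs Uy.
  by rewrite yE ys invr1 mul1r.
rewrite !T//; apply: near_eq_derive.
have n0 : \near y, (y : V3) != 0.
  by apply: filterS (near_sph openT y0 (I : setT (sph y))) => z [].
by apply: filterS n0 => z z0; apply: FG; exact: normalize_sphere.
Qed.

(** The extension of degree 0 is constant along the segment from y to y', which
    avoids the origin. *)
Lemma tang0_segment F y y' s : (forall z, sphere2 z -> U (z, s)) -> Cinf U F ->
  (forall i z, sphere2 z -> tang i F (z, s) = 0) ->
  sphere2 y -> sphere2 y' -> 0 <= dot y y' -> F (y, s) = F (y', s).
Proof.
move=> sU Fs F0 ys ys' yy'.
pose v := y' - y.
have seg t : 0 <= t <= 1 -> y + t *: v != 0.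
  move=> /andP[t0 t1]; apply/eqP => z.
  have : dot (y + t *: v) (y + t *: v) = 0.
    by rewrite z /dot big1// => i _; rewrite mxE mul0r.
  have -> : y + t *: v = (1 - t) *: y + t *: y'.
    by rewrite /v scalerBr scalerBl scale1r addrA addrAC.
  rewrite !(dotDl, dotDr, dotZl, dotZr) (dotC y' y) !sphere_dot//.
  have tc : 0 <= t * (1 - t) * dot y y' by rewrite !mulr_ge0 ?subr_ge0.
  have tt : 0 <= (t - 2^-1) ^+ 2 by exact: sqr_ge0.
  by move: (dot y y') tc => c; nra.
pose hF (z : V3) := F ((eucl z)^-1 *: z, s).
have hd z : z != 0 -> differentiable hF z /\ forall u, 'D_u hF z = 0.
  move=> z0; have zs := normalize_sphere z0.
  have D i : dder hF z (ebase R i) 0.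
    apply: dder_eq (dder_hat0 _ z0 (Cinf_diff Fs (sU _ zs))) _.
    by rewrite F0// mulr0.
  have [hz _] := D 0; split=> // u.
  have -> : u = \sum_i u 0 i *: ebase R i by exact: row_sum_delta.
  rewrite deriveE// linear_sum big1// => i _; rewrite linearZ /= -deriveE//.
  by have [_ ->] := D i; rewrite scaler0.
have [||t t01] := @MVT_line _ _ hF y v 1 => //.
  by move=> t t01; have [] := hd _ (seg t t01).
have t01' : 0 <= t <= 1 by case/andP: t01 => /ltW-> /ltW->.
have [_ ->] := hd _ (seg t t01').
rewrite mulr0 scale1r /v subrKC /hF ys ys' invr1 !scale1r => /eqP.
by rewrite subr_eq0 => /eqP.
Qed.

(** An intermediate point orthogonal to y takes care of antipodal points. *)
Lemma tang0_cst F y y' s : (forall z, sphere2 z -> U (z, s)) -> Cinf U F ->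
  (forall i z, sphere2 z -> tang i F (z, s) = 0) ->
  sphere2 y -> sphere2 y' -> F (y, s) = F (y', s).
Proof.
move=> sU Fs F0 ys ys'.
have [e [f [[_ ee _] [ye _ _]]]] := frame_exists ys.
have opp : dot (- e) (- e) = 1 by rewrite dotNl dotNr opprK.
have [c|c] := leP 0 (dot e y').
  transitivity (F (e, s)); apply: tang0_segment => //; rewrite ?ye//; exact: dot_sphere.
transitivity (F (- e, s)); apply: tang0_segment => //; try exact: dot_sphere.
- by rewrite dotNr ye oppr0.
- by rewrite dotNl oppr_ge0 ltW.
Qed.

End TangentialCalculus.

(** * Nondegeneracy at infinity *)

Section OneSided.
Context {R : realType} {V : normedModType R}.

Lemma derive_ge0 (f : V -> R) x v (d : R) : differentiable f x -> 0 < d ->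
  (forall h, 0 < h < d -> f x <= f (h *: v + x)) -> 0 <= 'D_v f x.
Proof.
move=> fx d0 h.
have := diff_derivable (v := v) fx; rewrite /derivable => c.
have c' := cvg_dnbhs_at_right c.
have -> : 'D_v f x = lim (h^-1 *: (f (h *: v + x) - f x) @[h --> 0^'+]).
  by apply/esym/cvg_lim.
apply: limr_ge; first by apply/cvg_ex; eexists; exact: c'.
near=> e; have e0 : 0 < e by near: e; exact: nbhs_right_gt.
apply: mulr_ge0; first by rewrite invr_ge0 ltW.
rewrite subr_ge0 h// e0 /=.
by near: e; exact: nbhs_right_lt.
Unshelve. all: by end_near. Qed.

End OneSided.

Section Nondegeneracy.
Context {R : realType}.
Notation V3 := 'rV[R]_3.
Notation W := ('rV[R]_3 * R)%type.
Variables (m : R) (m_ge0 : 0 <= m) (U : set W) (U_open : open U)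
  (P : W -> R) (P_smooth : Cinf U P).
Implicit Types (y e f : V3) (p : W).

(** F as a function of (y, s); s^2 F is minus the squared length of the
    conormal ([lapsq_frame]). *)
Definition lapF p : R := - 2 * ds P p - \sum_k tang k P p ^+ 2
  - p.2 ^+ 2 * (1 - 2 * m * p.2) * ds P p ^+ 2.

Lemma sum_tang_frame y e f s (F G : W -> R) : frame y e f ->
  \sum_k tang k F (y, s) * tang k G (y, s) =
  tv e F (y, s) * tv e G (y, s) + tv f F (y, s) * tv f G (y, s).
Proof.
move=> fr; have yy : dot y y = 1 by case: fr => [[]].
pose g H : V3 := \row_k tang k H (y, s).
have gE H v : dot (g H) v = tv v H (y, s).
  by apply: eq_bigr => k _; rewrite mxE mulrC.
have := parseval (g F) (g G) fr; rewrite !(gE _ e) !(gE _ f) !(gE _ y) [tv y F _]tang_radial// mul0r addr0.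
by move=> <-; apply: eq_bigr => k _; rewrite !mxE.
Qed.

Lemma lapF_frame y e f s : frame y e f ->
  lapF (y, s) = Fj m s (ds P (y, s)) (tv e P (y, s)) (tv f P (y, s)).
Proof.
move=> fr; rewrite /lapF /Fj /=.
have -> : \sum_k tang k P (y, s) ^+ 2 = \sum_k tang k P (y, s) * tang k P (y, s).
  by apply: eq_bigr => k _; rewrite expr2.
by rewrite (sum_tang_frame _ _ _ fr); ring.
Qed.

Lemma Cinf_lapF : Cinf U lapF.
Proof.
have Ps : Cinf U (ds P) by exact: Cinf_derive.
have Cs := Cinf_snd U_open.
apply: CinfB => //; first apply: CinfB => //.
- by apply: CinfM => //; exact: Cinf_cst.
- by apply: Cinf_sum => // k; apply: CinfX => //; exact: Cinf_tang.
- apply: CinfM => //; last exact: CinfX.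
  apply: CinfM => //; first exact: CinfX.
  by apply: CinfB => //; [exact: Cinf_cst|apply: CinfM => //; exact: Cinf_cst].
Qed.

(** For V = (y.q - q.q) y + (y.q) q, with q the gradient of P in the chart,
    G(V, V) is (y.q)^2 times the determinant of G. *)
Lemma spacelike_lapF y s : sphere2 y -> 0 < s -> 2 * m * s < 1 -> U (y, s) ->
  posdef (metricG m P (pt y s)) -> 0 < lapF (y, s).
Proof.
move=> ys s0 ms Uy pd; have [e [f fr]] := frame_exists ys.
have yy := sphere_dot ys.
have lw : s ^+ 2 * lapF (y, s) = lapsq m P (y, s).
  by rewrite (lapF_frame _ fr) -lapsq_frame.
suff w0 : 0 < lapsq m P (y, s) by move: w0; rewrite -lw pmulr_rgt0// exprn_gt0.
have GE : metricG m P (pt y s) = gmx y (qv P (y, s)) (hfun m (y, s)).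
  rewrite (metricG_mx m_ge0 P_smooth) ?(sph_pt fr s0)//.
  - exact: (pt_neq0 fr s0).
  - by rewrite (eucl_pt fr s0) -[s^-1]mul1r ltr_pdivlMr.
rewrite -wdetE /wdet -[(y, s).1]/y; move: pd; rewrite GE.
move: (qv P (y, s)) (hfun m (y, s)) => q h pd.
pose pr := dot y q; pose V := (pr - dot q q) *: y + pr *: q.
have Vy : dot V y = pr - dot q q + pr ^+ 2.
  by rewrite dotDl !dotZl yy (dotC q y) -/pr; ring.
have Vq : dot V q = pr ^+ 2.
  by rewrite dotDl !dotZl -/pr; ring.
have VV : inner (gmx y q h) V V = (2 * pr - dot q q + (1 - h) * pr ^+ 2) * pr ^+ 2.
  rewrite inner_gmx Vy Vq.
  have -> : dot V V = (pr - dot q q) * dot V y + pr * dot V q.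
    by rewrite {2}/V dotDr !dotZr.
  by rewrite Vy Vq; ring.
have [pr0|pr0] := eqVneq pr 0.
  have [qq0|qq0] := eqVneq (dot q q) 0.
    have := pd y (sphere_neq0 ys); rewrite inner_gmx yy -/pr pr0.
    by rewrite (_ : _ - _ = 0) ?ltxx//; ring.
  have V0 : V != 0.
    by rewrite /V pr0 scale0r addr0 sub0r scaler_eq0 oppr_eq0 negb_or qq0 sphere_neq0.
  by have := pd V V0; rewrite VV pr0 expr0n /= mulr0 ltxx.
have V0 : V != 0.
  apply: contraNneq pr0 => V0; move: Vq; rewrite V0.
  have -> : dot 0 q = 0 by rewrite /dot big1// => i _; rewrite mxE mul0r.
  by move/esym/eqP; rewrite sqrf_eq0.
by have := pd V V0; rewrite VV pmulr_lgt0// exprn_even_gt0.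
Qed.

(** This and the next lemma recover the terms Fs, F1, F2 of
    [Thj_conformal]. *)
Lemma ds_lapF y e f s : frame y e f -> U (y, s) ->
  let p := (y, s) in let t := ds P p in let t2 := ds (ds P) p in
  ds lapF p = - 2 * t2 - 2 * (tv e P p * tv e (ds P) p + tv f P p * tv f (ds P) p)
   - (2 * s - 6 * m * s ^+ 2) * t ^+ 2 - 2 * (s ^+ 2 * (1 - 2 * m * s)) * t * t2.
Proof.
move=> fr Up /=; rewrite -(sum_tang_frame _ _ _ fr).
have Ds : dder (ds P) (y, s) es (ds (ds P) (y, s)).
  by apply: dderE; apply: Cinf_diff Up; exact: Cinf_derive.
have Dt k : dder (tang k P) (y, s) es (tang k (ds P) (y, s)).
  rewrite -(ds_tang U_open)//; apply: dderE; apply: Cinf_diff Up; exact: Cinf_tang.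
have Dsnd := dder_snd (y, s) es.
apply: (proj2 (_ : dder lapF (y, s) es _)).
apply: dder_eq.
  apply: dderB; first apply: dderB.
  - by apply: dderM; [exact: dder_cst|exact: Ds].
  - by apply: dder_sum => k; apply: dderX; exact: Dt.
  - apply: dderM; last by apply: dderX; exact: Ds.
    apply: dderM; first by apply: dderX; exact: Dsnd.
    apply: dderB; first exact: dder_cst.
    by apply: dderM; [exact: dder_cst|exact: Dsnd].
rewrite (_ : \sum_i 2%:R * _ * _ = 2 * \sum_k tang k P (y, s) * tang k (ds P) (y, s)).
  by rewrite /=; move: (\sum_k _) (ds P _) (ds (ds P) _) => *; ring.
by rewrite mulr_sumr; apply: eq_bigr => k _; rewrite expr1 mulrA.
Qed.

Lemma tv_lapF y e f s v : frame y e f -> U (y, s) ->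
  let p := (y, s) in
  tv v lapF p = - 2 * tv v (ds P) p
   - 2 * (tv e P p * tt e v P p + tv f P p * tt f v P p)
   - 2 * (s ^+ 2 * (1 - 2 * m * s)) * ds P p * tv v (ds P) p.
Proof.
move=> fr Up /=.
have yy : dot y y = 1 by case: fr => [[]].
have tE j : tang j lapF (y, s) = - 2 * tang j (ds P) (y, s)
    - 2 * (\sum_k tang k P (y, s) * tang j (tang k P) (y, s))
    - 2 * (s ^+ 2 * (1 - 2 * m * s)) * ds P (y, s) * tang j (ds P) (y, s).
  have Ds : dder (ds P) (y, s) (tdir j (y, s)) (tang j (ds P) (y, s)).
    by apply: dder_tang; apply: Cinf_diff Up; exact: Cinf_derive.
  have Dt k : dder (tang k P) (y, s) (tdir j (y, s)) (tang j (tang k P) (y, s)).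
    by apply: dder_tang; apply: Cinf_diff Up; exact: Cinf_tang.
  have Dsnd := dder_snd (y, s) (tdir j (y, s)).
  apply: tang_dder; apply: dder_eq.
    apply: dderB; first apply: dderB.
    - by apply: dderM; [exact: dder_cst|exact: Ds].
    - by apply: dder_sum => k; apply: dderX; exact: Dt.
    - apply: dderM; last by apply: dderX; exact: Ds.
      apply: dderM; first by apply: dderX; exact: Dsnd.
      apply: dderB; first exact: dder_cst.
      by apply: dderM; [exact: dder_cst|exact: Dsnd].
  rewrite (_ : \sum_i 2%:R * _ * _ = 2 * \sum_k tang k P (y, s) * tang j (tang k P) (y, s)).
    by rewrite /=; move: (\sum_k _) (ds P _) (tang _ (ds P) _) => *; ring.
  by rewrite mulr_sumr; apply: eq_bigr => k _; rewrite expr1 mulrA.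
pose gr : V3 := \row_k tang k P (y, s).
pose hv : V3 := \row_k tv v (tang k P) (y, s).
have gE u : dot gr u = tv u P (y, s).
  by apply: eq_bigr => k _; rewrite mxE mulrC.
have hE u : dot hv u = tt u v P (y, s).
  apply: eq_bigr => k _; rewrite mxE mulrC /tv mulr_sumr; apply: eq_bigr => j _.
  by rewrite mulrA.
have S : \sum_j v 0 j * (\sum_k tang k P (y, s) * tang j (tang k P) (y, s)) =
    tv e P (y, s) * tt e v P (y, s) + tv f P (y, s) * tt f v P (y, s).
  have := parseval gr hv fr; rewrite (gE e) (gE f) (gE y) (hE e) (hE f).
  rewrite [tv y P _]tang_radial// mul0r addr0 => <-.
  under eq_bigr do rewrite mulr_sumr.
  rewrite exchange_big; apply: eq_bigr => k _ /=; rewrite !mxE /tv mulr_sumr.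
  by apply: eq_bigr => j _; rewrite mulrCA.
rewrite -S {1}/tv; under eq_bigr => j _ do rewrite tE.
have alg (x z w : 'I_3 -> R) a b c : \sum_j v 0 j * (a * x j - b * z j - c * x j) =
    a * \sum_j v 0 j * x j - b * \sum_j v 0 j * z j - c * \sum_j v 0 j * x j.
  by rewrite !mulr_sumr -!sumrB; apply: eq_bigr => j _; ring.
exact: alg.
Qed.

End Nondegeneracy.

Section Surface.
Context {R : realType}.
Notation V3 := 'rV[R]_3.
Notation W := ('rV[R]_3 * R)%type.
Variables (m : R) (m_ge0 : 0 <= m) (U : set W) (U_open : open U)
  (P : W -> R) (P_smooth : Cinf U P) (s0 : R) (s0_gt0 : 0 < s0)
  (ms0 : 2 * m * s0 < 1) (collarU : collar s0 `<=` U)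
  (P_spacelike : spacelike m s0 P)
  (H_asymp : unifO 3 (fun (w : fr) s => Hys m P (fy w) s - 1)).
Implicit Types (y e f : V3) (w : fr (R := R)) (s : R).
Local Notation F := (lapF m P).

Let Ps_smooth : Cinf U (ds P). Proof. exact: Cinf_derive. Qed.
Let Pss_smooth : Cinf U (ds (ds P)). Proof. exact: Cinf_derive. Qed.

Lemma yy1 w : dot (fy w) (fy w) = 1. Proof. by case: (frP w) => [[]]. Qed.
Lemma ee1 w : dot (fe w) (fe w) = 1. Proof. by case: (frP w) => [[]]. Qed.
Lemma ff1 w : dot (ff w) (ff w) = 1. Proof. by case: (frP w) => [[]]. Qed.

(** The jets of P in a frame, in the notation of [Fj] and [Tj]. *)
Definition jt w s := ds P (fy w, s).
Definition jt2 w s := ds (ds P) (fy w, s).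
Definition ja1 w s := tv (fe w) P (fy w, s).
Definition ja2 w s := tv (ff w) P (fy w, s).
Definition jb1 w s := tv (fe w) (ds P) (fy w, s).
Definition jb2 w s := tv (ff w) (ds P) (fy w, s).
Definition jk11 w s := tt (fe w) (fe w) P (fy w, s).
Definition jk12 w s := tt (fe w) (ff w) P (fy w, s).
Definition jk22 w s := tt (ff w) (ff w) P (fy w, s).
Definition jF w s := Fj m s (jt w s) (ja1 w s) (ja2 w s).
Definition jTh w s := Thj m s (jt w s) (jt2 w s) (ja1 w s) (ja2 w s)
  (jb1 w s) (jb2 w s) (jk11 w s) (jk12 w s) (jk22 w s).
Definition jT w s := Tj m s (jt w s) (jt2 w s) (ja1 w s) (ja2 w s)
  (jb1 w s) (jb2 w s) (jk11 w s) (jk12 w s) (jk22 w s).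

Lemma expands_t : expands jt (fun w j => sder (ds P) j (fy w, 0) / j`!%:R).
Proof. exact: (expands_Cinf s0_gt0 collarU Ps_smooth). Qed.
Lemma expands_t2 : expands jt2 (fun w j => sder (ds (ds P)) j (fy w, 0) / j`!%:R).
Proof. exact: (expands_Cinf s0_gt0 collarU Pss_smooth). Qed.
Lemma expands_a1 : expands ja1 (fun w j => tv (fe w) (sder P j) (fy w, 0) / j`!%:R).
Proof. exact: (expands_tv U_open s0_gt0 collarU ee1 P_smooth). Qed.
Lemma expands_a2 : expands ja2 (fun w j => tv (ff w) (sder P j) (fy w, 0) / j`!%:R).
Proof. exact: (expands_tv U_open s0_gt0 collarU ff1 P_smooth). Qed.
Lemma expands_b1 : expands jb1 (fun w j => tv (fe w) (sder (ds P) j) (fy w, 0) / j`!%:R).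
Proof. exact: (expands_tv U_open s0_gt0 collarU ee1 Ps_smooth). Qed.
Lemma expands_b2 : expands jb2 (fun w j => tv (ff w) (sder (ds P) j) (fy w, 0) / j`!%:R).
Proof. exact: (expands_tv U_open s0_gt0 collarU ff1 Ps_smooth). Qed.
Lemma expands_k11 : expands jk11 (fun w j => tt (fe w) (fe w) (sder P j) (fy w, 0) / j`!%:R).
Proof. exact: (expands_tt U_open s0_gt0 collarU ee1 ee1 P_smooth). Qed.
Lemma expands_k12 : expands jk12 (fun w j => tt (fe w) (ff w) (sder P j) (fy w, 0) / j`!%:R).
Proof. exact: (expands_tt U_open s0_gt0 collarU ee1 ff1 P_smooth). Qed.
Lemma expands_k22 : expands jk22 (fun w j => tt (ff w) (ff w) (sder P j) (fy w, 0) / j`!%:R).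
Proof. exact: (expands_tt U_open s0_gt0 collarU ff1 ff1 P_smooth). Qed.

Lemma ms_lt1 s : s <= s0 -> 2 * m * s < 1.
Proof. by move=> ss; apply: le_lt_trans ms0; rewrite ler_wpM2l ?mulr_ge0. Qed.

Lemma F_gt0 y s : sphere2 y -> 0 < s <= s0 -> 0 < F (y, s).
Proof.
move=> ys s01; have /andP[sp ss] := s01.
have Uy : U (y, s) by apply: collarU; split => //=; rewrite ltW.
exact: (spacelike_lapF m_ge0 P_smooth ys sp (ms_lt1 ss) Uy (P_spacelike ys s01)).
Qed.

Lemma jF_lapF w s : jF w s = F (fy w, s).
Proof. by rewrite (lapF_frame _ _ _ (frP w)). Qed.

Lemma jF_gt0 w s : 0 < s <= s0 -> 0 < jF w s.
Proof. by move=> s01; rewrite jF_lapF; apply: F_gt0 => //; exact: frame_sphere (frP w). Qed.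

Lemma jH w s : 0 < s <= s0 ->
  Hys m P (fy w) s = jTh w s / (3 * jF w s * Num.sqrt (jF w s)).
Proof.
move=> s01; have /andP[sp ss] := s01.
apply: (mean_curvature_frame m_ge0 U_open P_smooth (frP w) sp _ (ms_lt1 ss) (jF_gt0 w s01)).
by apply: (collar_pt collarU); rewrite ltW.
Qed.

Lemma critical_bound (q F N X dd s Th : R) : 0 < q -> q ^+ 2 = F -> 0 <= N ->
  0 <= dd -> 0 < s -> 2 <= 3 * N - s * X ->
  Th = 3 * F * N - s * (F * X - N * dd / 2) ->
  Th / (3 * F * q) - 1 <= 1 -> 16^-1 <= F.
Proof.
move=> q0 <- N0 d0 sp h ThE.
have h2 : 0 <= s * (N * dd) by rewrite !mulr_ge0// ltW.
have h1 : 0 <= q ^+ 2 * (3 * N - s * X - 2) by rewrite mulr_ge0 ?sqr_ge0// subr_ge0.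
rewrite lerBlDr ler_pdivrMr ?mulr_gt0 ?exprn_gt0// => h3.
have : q ^+ 2 * 2 <= q ^+ 2 * (6 * q) by lra.
by rewrite ler_pM2l ?exprn_gt0// => h4; nra.
Qed.

(** In [Thj_conformal] the terms in F1, F2 vanish and the one in Fs has a sign,
    so that 3 F^(3/2) H >= 2 F for s small, whereas H <= 2. *)
Lemma lapF_critical : exists2 b, 0 < b <= s0 & forall w s, 0 < s <= b ->
  0 <= ds F (fy w, s) -> (forall i, tang i F (fy w, s) = 0) -> 16^-1 <= F (fy w, s).
Proof.
have bt := expands_bounded expands_t; have bt2 := expands_bounded expands_t2.
have bk1 := expands_bounded expands_k11; have bk2 := expands_bounded expands_k22.
have bs : unifO 0 (fun _ s => s) by exact: unifO_le (unifO_s 1).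
have s1 : unifO 1 (fun _ s => s) by exact: unifO_s 1.
pose h s := 1 - 2 * m * s.
have N1 : unifO 1 (fun w s => s * (s * h s * jt w s)).
  by apply: (unifOM s1); bounded_expr.
pose g w s := 3 * s * h s * jt w s - ((2 * s - 6 * m * s * s) * jt w s
  + s * s * h s * jt2 w s) - (jk11 w s + jk22 w s).
have G1 : unifO 1 (fun w s => s * g w s).
  by apply: (unifOM s1); bounded_expr.
have H1 : unifO 1 (fun w s => Hys m P (fy w) s - 1) by exact: unifO_le H_asymp.
have [d1 d10 hN] := unifO_small N1 (ltr01 : 0 < 1).
have [d2 d20 hG] := unifO_small G1 (ltr01 : 0 < 1).
have [d3 d30 hH] := unifO_small H1 (ltr01 : 0 < 1).
exists (Num.min s0 (Num.min d1 (Num.min d2 d3))) => [|w s /andP[sp]].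
  by rewrite !lt_min s0_gt0 d10 d20 d30 ge_min lexx.
rewrite !le_min => /and4P[ss sd1 sd2 sd3] dF tF.
have s01 : 0 < s <= s0 by rewrite sp.
have := hN w s; rewrite sp sd1 => /(_ isT).
have := hG w s; rewrite sp sd2 => /(_ isT).
have := hH w s; rewrite sp sd3 => /(_ isT).
rewrite jH// -jF_lapF; have Fp := jF_gt0 w s01.
have Up : U (fy w, s) by apply: (collar_pt collarU); rewrite ltW.
have tv0 v : tv v F (fy w, s) = 0 by rewrite /tv big1// => i _; rewrite tF mulr0.
have := Thj_conformal m s (jt w s) (jt2 w s) (ja1 w s) (ja2 w s)
  (jb1 w s) (jb2 w s) (jk11 w s) (jk12 w s) (jk22 w s).
have F1 := tv_lapF m U_open P_smooth (fe w) (frP w) Up.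
have F2 := tv_lapF m U_open P_smooth (ff w) (frP w) Up.
have Fs := ds_lapF m U_open P_smooth (frP w) Up.
rewrite /= tv0 (tt_sym U_open (frP w) P_smooth Up) in F1.
rewrite /= tv0 in F2; rewrite /= in Fs.
rewrite /= -/(jTh w s) -/(jF w s).
rewrite -[- 2 * jt2 w s - _ - _ - _]Fs -[- 2 * jb1 w s - _ - _]F1 -[- 2 * jb2 w s - _ - _]F2.
rewrite !mulr0 addr0 mul0r subr0.
move=> ThE H2 gG nN; clear F1 F2 Fs.
have qq : Num.sqrt (jF w s) ^+ 2 = jF w s by rewrite sqr_sqrtr// ltW.
have q0 : 0 < Num.sqrt (jF w s) by rewrite sqrtr_gt0.
move: H2; rewrite ler_norml => /andP[_ H2].
have [gG1 _] := ler_normlP _ _ gG; have [nN1 _] := ler_normlP _ _ nN.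
move: q0 qq ThE H2 gG1 nN1 dF; rewrite /g /h.
move: (jF w s) (Num.sqrt (jF w s)) (jTh w s) (jt w s) (jt2 w s) (ds F _) (jk11 w s + jk22 w s).
clear -sp; move=> f q Th t t2 dd k q0 qq ThE H2 gG1 nN1 dF.
have N0 : 0 <= 1 + s ^+ 2 * (1 - 2 * m * s) * t.
  by move: nN1; rewrite (_ : s * _ = s ^+ 2 * (1 - 2 * m * s) * t); [lra|ring].
apply: (critical_bound (X := (2 * s - 6 * m * s ^+ 2) * t
  + s ^+ 2 * (1 - 2 * m * s) * t2 + k) q0 qq N0 dF sp _ _ H2).
  move: gG1; set X := s * _ => X1.
  rewrite (_ : _ - _ = 3 + X); first lra.
  by rewrite /X; ring.
by rewrite ThE; ring.
Qed.

(** Otherwise, for some small a > 0, F takes at s = a a value less than 1/16 and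
    less than its minimum at s = b. The minimum of F over a <= s <= b then lies
    at some s < b, and F_s >= 0 there even if s = a. *)
Lemma F0_gt0 y : sphere2 y -> 0 < F (y, 0).
Proof.
move=> ys; have Fs := Cinf_lapF m U_open P_smooth.
have [//|F0] := ltP 0 (F (y, 0)).
have [b /andP[b0 bs] crit] := lapF_critical.
have Fcont a c : 0 <= a -> c <= s0 ->
    forall z s, sphere2 z -> a <= s <= c -> {for (z, s), continuous F}.
  move=> a0 cs z s zs /andP[az sc]; apply: (Cinf_cont Fs); apply: collarU.
  by split=> //=; rewrite (le_trans a0)//= (le_trans sc).
have bb : b <= b <= b by rewrite lexx.
have [yb [sb [ybs sbb minb]]] := collar_min ys bb (Fcont b b (ltW b0) bs).
have {sbb} sbb : sb = b by apply/eqP; rewrite eq_le andbC.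
rewrite {}sbb in minb.
pose mu := Num.min (F (yb, b)) 16^-1.
have mu0 : 0 < mu by rewrite lt_min F_gt0 ?b0//= invr_gt0.
have [e [f fry]] := frame_exists ys; pose w0 := Fr fry.
have small : unifO 1 (fun w s => F (fy w, s) - F (fy w, 0)).
  have [C C0 h] := taylor collarU 1 Fs; exists C, s0; split=> // w s /andP[sp ss].
  have := h w s; rewrite (ltW sp) ss => /(_ isT).
  by rewrite big_ord1 /= fact0 divr1 expr0 mulr1.
have [d d0 hd] := unifO_small small (divr_gt0 mu0 (ltr0n _ 2)).
pose a := Num.min b d.
have a0 : 0 < a by rewrite lt_min b0.
have ab : a <= b by rewrite ge_min lexx.
have Fa : F (y, a) < mu.
  have := hd w0 a; rewrite a0 ge_min lexx orbT => /(_ isT).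
  rewrite ler_norml => /andP[_]; rewrite lerBlDr [fy w0]/= => h.
  apply: le_lt_trans h _; lra.
have aab : a <= a <= b by rewrite lexx.
have [y1 [s1 [y1s /andP[as1 s1b] min1]]] := collar_min ys aab (Fcont a b (ltW a0) bs).
have F1 : F (y1, s1) < mu by apply: le_lt_trans Fa; apply: min1; rewrite ?lexx.
have s1b' : s1 < b.
  rewrite lt_neqAle s1b andbT; apply: contraTneq F1 => ->.
  by rewrite -leNgt ge_min minb// lexx.
have s10 : 0 < s1 by exact: lt_le_trans as1.
have [e1 [f1 fr1]] := frame_exists y1s.
have Uy1 : U (y1, s1).
  by apply: collarU; split=> //=; rewrite (ltW s10)/= (le_trans s1b).
have : 16^-1 <= F (y1, s1).
  apply: (crit (Fr fr1)); rewrite /= ?s10//.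
    apply: (@derive_ge0 _ _ F (y1, s1) es (b - s1)); rewrite ?subr_gt0//.
      exact: Cinf_diff Fs Uy1.
    move=> h /andP[h0 hb].
    have -> : h *: es + (y1, s1) = (y1, h + s1) :> W.
      by apply: injective_projections => /=; rewrite ?scaler0 ?add0r// [h *: 1]mulr1.
    apply: min1 => //; apply/andP; split; first by rewrite (le_trans as1)// lerDr ltW.
    by rewrite -lerBrDr ltW.
  move=> i; have y10 := sphere_neq0 y1s.
  have yE : (eucl y1)^-1 *: y1 = y1 by rewrite y1s invr1 scale1r.
  pose hF (z : V3) := F ((eucl z)^-1 *: z, s1).
  have [|hd1 hd2] := @dder_hat0 _ F s1 y1 i y10.
    by rewrite yE; exact: Cinf_diff Fs Uy1.
  rewrite y1s invr1 mul1r scale1r in hd2.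
  have hmin (v : V3) h : dot v v = 1 -> 0 < h < 1 -> hF y1 <= hF (h *: v + y1).
    move=> vv /andP[h0 h1]; rewrite {1}/hF yE; apply: min1; last by rewrite as1.
    apply: normalize_sphere; apply/eqP => z.
    have : dot y1 y1 = h ^+ 2.
      have -> : y1 = - (h *: v) by apply/eqP; rewrite -addr_eq0 addrC z.
      by rewrite dotNl dotNr opprK dotZl dotZr vv mulr1 expr2.
    by rewrite sphere_dot// => h2; nra.
  have ebb : dot (ebase R i) (ebase R i) = 1.
    rewrite /dot (bigD1 i)//= /ebase mxE !eqxx mulr1 big1 ?addr0// => k ki.
    by rewrite mxE eqxx (negbTE ki) mul0r.
  apply/eqP; rewrite eq_le -hd2; apply/andP; split.
    rewrite -oppr_ge0.
    have -> : - 'D_(ebase R i) hF y1 = 'D_(- ebase R i) hF y1.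
      by rewrite !deriveE// linearN.
    apply: (@derive_ge0 _ _ hF y1 _ 1) => // h h01; apply: hmin => //.
    by rewrite dotNl dotNr opprK.
  by apply: (@derive_ge0 _ _ hF y1 _ 1) => // h h01; exact: hmin.
have mu1 : mu <= 16^-1 by rewrite ge_min lexx orbT.
by move=> h; have := lt_le_trans F1 (le_trans mu1 h); rewrite ltxx.
Qed.

End Surface.

(** * Comparison of the norm with the components *)

Section UniformBounds.
Context {R : realType}.
Implicit Types (s : R).

Lemma near_right (Q : R -> Prop) :
  (\forall s \near 0^'+, Q s) <-> exists2 d, 0 < d & forall s, 0 < s <= d -> Q s.
Proof.
split=> [|[d d0 h]]; last first.
  near=> s; apply: h; apply/andP; split; near: s; first exact: nbhs_right_gt.
  exact: nbhs_right_le.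
rewrite /at_right /within /= => /nbhs_ballP[e /= e0 h].
exists (e / 2); first by rewrite divr_gt0.
move=> s /andP[sp se]; apply: (h s) => //=.
rewrite /ball /= sub0r normrN gtr0_norm//; apply: le_lt_trans se _.
by rewrite ltr_pdivrMr// ltr_pMr// ltr1n.
Unshelve. all: by end_near. Qed.

Lemma boundO_unifO k (phi : 'rV[R]_3 -> R -> R) :
  boundO k phi <-> unifO k (fun w s => phi (fy w) s).
Proof.
split=> [[C /near_right[d d0 h]]|[C [d [C0 d0 h]]]].
  exists `|C|, d; split=> // w s sd; have /andP[sp _] := sd.
  apply: le_trans (h s sd _ (frame_sphere (frP w))) _.
  by rewrite ler_wpM2r ?exprn_ge0 ?ler_norm// ltW.
exists C; apply/near_right; exists d => // s sd y ys.
by have [e [f fr]] := frame_exists ys; exact: (h (Fr fr) s sd).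
Qed.

Lemma unifO_mulmx k l (A B : fr -> R -> 'M[R]_3) :
  (forall i j, unifO k (fun w s => A w s i j)) ->
  (forall i j, unifO l (fun w s => B w s i j)) ->
  forall i j, unifO (k + l) (fun w s => (A w s *m B w s) i j).
Proof.
move=> hA hB i j.
have h r : unifO (k + l) (fun w s => A w s i r * B w s r j) by exact: unifOM.
by apply: unifO_ext (unifO_sum h) => w s _; rewrite mxE.
Qed.

Lemma unifO_norm k (phi psi : fr -> R -> R) (d : R) : 0 < d ->
  (forall w s, 0 < s <= d -> `|phi w s| <= `|psi w s|) -> unifO k psi -> unifO k phi.
Proof.
move=> d0 le [C [d' [C0 d0' h]]]; exists C, (Num.min d d'); split=> //.
  by rewrite lt_min d0.
move=> w s /andP[sp]; rewrite le_min => /andP[sd sd'].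
apply: le_trans (le w s _) (h w s _); by rewrite sp.
Qed.

Lemma unifO_abs k (phi : fr -> R -> R) : unifO k phi -> unifO k (fun w s => `|phi w s|).
Proof.
move=> h; apply: (@unifO_norm k _ _ 1 ltr01 _ h) => w s _.
by rewrite normr_id.
Qed.

Lemma expands_tail phi c : expands phi c ->
  unifO 1 (fun w s => phi w s - c w 0%N).
Proof.
move=> [cb h].
have s1 : unifO 1 (fun (_ : fr) s => s) by exact: unifO_s 1.
have bs : unifO 0 (fun (_ : fr) s => s) by exact: unifO_le s1.
have : unifO 1 (fun w s => s * (c w 1%N + c w 2%N * s + c w 3%N * (s * s))).
  by apply: (unifOM s1); do ?[apply: unifOD|apply: unifOM0|exact: cb|exact: bs].
move/(unifOD (unifO_le (isT : (1 <= 4)%N) h)).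
by apply: unifO_ext => w s _; rewrite poly4E; ring.
Qed.

End UniformBounds.

Section NormComparison.
Context {R : realType}.
Notation V3 := 'rV[R]_3.
Notation W := ('rV[R]_3 * R)%type.
Variables (m : R) (m_ge0 : 0 <= m) (U : set W) (U_open : open U)
  (P : W -> R) (P_smooth : Cinf U P) (s0 : R) (s0_gt0 : 0 < s0)
  (ms0 : 2 * m * s0 < 1) (collarU : collar s0 `<=` U)
  (P_spacelike : spacelike m s0 P)
  (H_asymp : unifO 3 (fun (w : fr) s => Hys m P (fy w) s - 1)).
Implicit Types (w : fr (R := R)) (s : R).
Local Notation F := (jF m P).
Local Notation Th := (jTh m P).
Local Notation T := (jT m P).
Local Notation jt := (jt P).
Local Notation a1 := (ja1 P).
Local Notation a2 := (ja2 P).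

Let Up w : U (fy w, 0).
Proof. by apply: (collar_pt collarU); rewrite lexx ltW. Qed.

Lemma bounded_F : unifO 0 F.
Proof.
have Fs := Cinf_lapF m U_open P_smooth.
apply: unifO_ext (expands_bounded (expands_Cinf s0_gt0 collarU Fs)) => w s _.
by rewrite jF_lapF.
Qed.

Lemma Th_sq : unifO 3 (fun w s => Th w s ^+ 2 - 9 * F w s ^+ 3).
Proof.
pose h w s := Hys m P (fy w) s - 1.
have hb : unifO 0 h by exact: unifO_le H_asymp.
have : unifO (3 + 0) (fun w s => h w s * ((h w s + 2) * (9 * (F w s * (F w s * F w s))))).
  apply: unifOM => //; have := bounded_F => bF; bounded_expr.
rewrite addn0 => /unifO_norm; apply; first exact: s0_gt0.
move=> w s s01; have Fp := jF_gt0 m_ge0 P_smooth ms0 collarU P_spacelike w s01.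
have HE := jH m_ge0 U_open P_smooth ms0 collarU P_spacelike w s01.
rewrite le_eqVlt; apply/orP; left; apply/eqP; congr (`|_|).
have q0 : 0 < Num.sqrt (F w s) by rewrite sqrtr_gt0.
have qq : Num.sqrt (F w s) ^+ 2 = F w s by rewrite sqr_sqrtr// ltW.
have -> : Th w s = 3 * F w s * Num.sqrt (F w s) * (h w s + 1).
  rewrite /h subrK HE mulrCA mulfV ?mulr1//.
  by rewrite !mulf_neq0 ?gt_eqF.
transitivity (9 * F w s ^+ 2 * Num.sqrt (F w s) ^+ 2 * (h w s + 1) ^+ 2 - 9 * F w s ^+ 3).
  by move: (F w s) (Num.sqrt (F w s)) (h w s) => *; ring.
by rewrite qq; move: (F w s) (h w s) => *; ring.
Qed.

Let bt := expands_bounded (expands_t P_smooth s0_gt0 collarU).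
Let bt2 := expands_bounded (expands_t2 P_smooth s0_gt0 collarU).
Let ba1 := expands_bounded (expands_a1 U_open P_smooth s0_gt0 collarU).
Let ba2 := expands_bounded (expands_a2 U_open P_smooth s0_gt0 collarU).
Let bb1 := expands_bounded (expands_b1 U_open P_smooth s0_gt0 collarU).
Let bb2 := expands_bounded (expands_b2 U_open P_smooth s0_gt0 collarU).
Let bk11 := expands_bounded (expands_k11 U_open P_smooth s0_gt0 collarU).
Let bk12 := expands_bounded (expands_k12 U_open P_smooth s0_gt0 collarU).
Let bk22 := expands_bounded (expands_k22 U_open P_smooth s0_gt0 collarU).
Let s1 : unifO 1 (fun (_ : fr (R := R)) s => s). Proof. exact: unifO_s 1. Qed.
Let bs : unifO 0 (fun (_ : fr (R := R)) s => s). Proof. exact: unifO_le s1. Qed.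

Lemma Th_3F : unifO 1 (fun w s => Th w s - 3 * F w s).
Proof.
have bF := bounded_F.
pose h s := 1 - 2 * m * s.
have bh : unifO 0 (fun (_ : fr (R := R)) s => h s) by bounded_expr.
pose beta s := s * s * h s.
have bb : unifO 0 (fun (_ : fr (R := R)) s => beta s) by bounded_expr.
pose db s := 2 * s - 6 * m * (s * s).
have bdb : unifO 0 (fun (_ : fr (R := R)) s => db s) by bounded_expr.
pose N w s := 1 + beta s * jt w s.
have bN : unifO 0 N by bounded_expr.
pose t2 := jt2 P; pose b1 := jb1 P; pose b2 := jb2 P.
pose k11 := jk11 P; pose k12 := jk12 P; pose k22 := jk22 P.
pose Fs w s := - 2 * t2 w s - 2 * (a1 w s * b1 w s + a2 w s * b2 w s)
  - db s * (jt w s * jt w s) - 2 * beta s * jt w s * t2 w s.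
have bFs : unifO 0 Fs by bounded_expr.
pose F1 w s := - 2 * b1 w s - 2 * (a1 w s * k11 w s + a2 w s * k12 w s)
  - 2 * beta s * jt w s * b1 w s.
have bF1 : unifO 0 F1 by bounded_expr.
pose F2 w s := - 2 * b2 w s - 2 * (a1 w s * k12 w s + a2 w s * k22 w s)
  - 2 * beta s * jt w s * b2 w s.
have bF2 : unifO 0 F2 by bounded_expr.
have : unifO 1 (fun w s => s * (3 * F w s * (s * h s * jt w s)
  - (F w s * (db s * jt w s + beta s * t2 w s) - N w s * Fs w s * 2^-1
     + F w s * (k11 w s + k22 w s) - (a1 w s * F1 w s + a2 w s * F2 w s) * 2^-1))).
  by apply: (unifOM s1); bounded_expr.
apply: unifO_ext => w s _; rewrite {1}/jTh Thj_conformal /=.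
rewrite /N /Fs /F1 /F2 /db /beta /h /t2 /b1 /b2 /k11 /k12 /k22 -/(F w s).
by move: (F w s) (jt w s) (jt2 P w s) (a1 w s) (a2 w s) (jb1 P w s) (jb2 P w s)
  (jk11 P w s) (jk12 P w s) (jk22 P w s) => *; field.
Qed.

Let F0 w : R := lapF m P (fy w, 0).

Lemma F_F0 : unifO 1 (fun w s => F w s - F0 w).
Proof.
have Fs := Cinf_lapF m U_open P_smooth.
apply: unifO_ext (expands_tail (expands_Cinf s0_gt0 collarU Fs)) => w s _.
by rewrite /= fact0 divr1 jF_lapF.
Qed.

(** H = 1 to leading order reads 3 F = Th = 3 F^(3/2) at s = 0, and F > 0. *)
Lemma F0_eq1 w : F0 w = 1.
Proof.
have F0p : 0 < F0 w.
  apply: (F0_gt0 m_ge0 U_open P_smooth s0_gt0 ms0 collarU) => //.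
  exact: frame_sphere (frP w).
have bF := bounded_F; have bT := Th_3F.
have bT0 : unifO 0 Th.
  have : unifO 0 (fun w s => Th w s - 3 * F w s + 3 * F w s).
    by apply: unifOD; [exact: unifO_le bT|bounded_expr].
  by apply: unifO_ext => w' s _; ring.
have bF0 : unifO 0 (fun w _ => F0 w).
  have : unifO 0 (fun w s => F w s - (F w s - F0 w)).
    by apply: unifOB => //; exact: unifO_le F_F0.
  by apply: unifO_ext => w' s _; ring.
have h1 : unifO 1 (fun w s => (Th w s - 3 * F w s) * (Th w s + 3 * F w s)).
  by apply: (unifOM bT); bounded_expr.
have h2 : unifO 1 (fun w s => (F w s - F0 w) * (9 * (F w s + F0 w)
  - 9 * (F w s * F w s + F w s * F0 w + F0 w * F0 w))).
  by apply: (unifOM F_F0); bounded_expr.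
have : unifO 1 (fun w s => (F0 w ^+ 2 - F0 w ^+ 3) * s ^+ 0).
  have := unifOM (unifO_real 9^-1) (unifOB (unifOB (unifO_le (isT : (1 <= 3)%N) Th_sq) h1) h2).
  rewrite add0n; apply: unifO_ext => w' s _.
  by move: (Th w' s) (F w' s) (F0 w') => *; field.
move/unifO_lead/(_ w) => e; have : F0 w ^+ 2 * (F0 w - 1) = 0 by rewrite -[RHS]oppr0 -e; ring.
by move/eqP; rewrite mulf_eq0 expf_eq0/= gt_eqF//= subr_eq0 => /eqP.
Qed.

(** F tends to 1, and - 2 P_s = F + |T P|^2 + O(s^2). *)
Lemma near_infinity : exists2 d, 0 < d <= s0 & forall w s, 0 < s <= d ->
  [/\ 2^-1 <= F w s, F w s <= 2 & jt w s <= - 4^-1].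
Proof.
have h1 : unifO 1 (fun w s => F w s - 1).
  by apply: unifO_ext F_F0 => w s _; rewrite F0_eq1.
have h2 : unifO 1 (fun w s => - 2 * jt w s - (F w s + (a1 w s * a1 w s
    + a2 w s * a2 w s))).
  have : unifO 1 (fun w s => s * (s * (1 - 2 * m * s) * (jt w s * jt w s))).
    by apply: (unifOM s1); bounded_expr.
  by apply: unifO_ext => w s _; rewrite /jF /Fj; ring.
have [|d1 d10 k1] := unifO_small (eps := 4^-1) h1; first by rewrite invr_gt0.
have [|d2 d20 k2] := unifO_small (eps := 4^-1) h2; first by rewrite invr_gt0.
exists (Num.min s0 (Num.min d1 d2)).
  by rewrite !lt_min s0_gt0 d10 d20 ge_min lexx.
move=> w s /andP[sp]; rewrite !le_min => /and3P[_ sd1 sd2].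
have := k1 w s; rewrite sp sd1 => /(_ isT).
have := k2 w s; rewrite sp sd2 => /(_ isT).
move: (F w s) (jt w s) (a1 w s) (a2 w s) => f t x z.
rewrite !ler_norml => /andP[g1 g2] /andP[g3 g4].
have := sqr_ge0 x; have := sqr_ge0 z.
by split; lra.
Qed.

Local Notation Sm w s := (Sj (jt w s) (a1 w s) (a2 w s)).
Local Notation Rm w s := (Rj (jt w s) (a1 w s) (a2 w s)).

Let bdt : unifO 0 (fun w s => (jt w s)^-1).
Proof.
have [d /andP[d0 ds] h] := near_infinity.
exists 4, d; split=> // w s sd; have [_ _ t4] := h w s sd.
rewrite expr0 mulr1 normfV; have tn : 4^-1 <= `|jt w s|.
  by rewrite -normrN (le_trans _ (ler_norm _))//; lra.
have t0 : 0 < `|jt w s| by apply: lt_le_trans tn; rewrite invr_gt0.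
by rewrite -[leLHS]mul1r ler_pdivrMr//; lra.
Qed.

Ltac entries := apply: ord3P; apply: ord3P;
  (eapply unifO_ext; [by move=> w s _; rewrite !mxE /=; reflexivity|]; bounded_expr).

Let bS : forall i j, unifO 0 (fun w s => Sm w s i j).
Proof. have bd := bdt; entries. Qed.

Let bST : forall i j, unifO 0 (fun w s => (Sm w s)^T i j).
Proof. by move=> i j; apply: unifO_ext (bS j i) => w s _; rewrite [RHS]mxE. Qed.

Let bR : forall i j, unifO 0 (fun w s => Rm w s i j).
Proof. have bd := bdt; entries. Qed.

Let bRT : forall i j, unifO 0 (fun w s => (Rm w s)^T i j).
Proof. by move=> i j; apply: unifO_ext (bR j i) => w s _; rewrite [RHS]mxE. Qed.

Let X w s := Sm w s *m T w s *m (Sm w s)^T.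

Let XT w s : Rm w s *m X w s *m (Rm w s)^T = T w s.
Proof.
rewrite /X !mulmxA RjSj mul1mx -mulmxA -trmx_mul RjSj trmx1 mulmx1//.
Qed.

Let normX : exists2 d, 0 < d & forall w s, 0 < s <= d ->
  normAo m P (fy w) s <= `|6 * \sum_i \sum_j `|X w s i j| | /\
  forall i j, `|X w s i j| <= `|17 * normAo m P (fy w) s|.
Proof.
have [d /andP[d0 ds] h] := near_infinity; exists d => // w s sd.
have /andP[sp sd'] := sd; have [F1 F2 t4] := h w s sd.
have ss : s <= s0 by exact: le_trans ds.
have Us : U (fy w, s) by apply: (collar_pt collarU); rewrite ltW.
have Fp : 0 < F w s by apply: lt_le_trans F1; rewrite invr_gt0.
have t0 : jt w s != 0 by rewrite lt_eqF// (le_lt_trans t4)// oppr_lt0 invr_gt0.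
rewrite (normAo_sq m_ge0 U_open P_smooth (frP w) sp Us (ms_lt1 m_ge0 ms0 ss) Fp t0).
have N0 := Nsum_ge0 Fp.
move: N0; rewrite /Nsum -/(jt w s) -/(a1 w s) -/(a2 w s) -/(F w s) -/(X w s).
pose dd := dj m s (jt w s) (a1 w s) (a2 w s); rewrite -/dd.
have dE i : 2^-1 <= dd i <= 2.
  rewrite /dd /dj -/(F w s); case: ifP => _; last by apply/andP; split; lra.
  by rewrite lef_pV2 ?posrE// F2 -[leRHS]invrK lef_pV2 ?posrE ?invr_gt0.
have f0 : 0 < 9 * F w s ^+ 3 by rewrite mulr_gt0// exprn_gt0.
have f1 : (9 * F w s ^+ 3)^-1 <= 1.
  rewrite invf_le1//; have : 2^-1 ^+ 3 <= F w s ^+ 3 by rewrite lerXn2r// nnegrE ?invr_ge0// ltW.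
  by lra.
have f2 : 72^-1 <= (9 * F w s ^+ 3)^-1.
  rewrite lef_pV2 ?posrE//; have : F w s ^+ 3 <= 2 ^+ 3 by rewrite lerXn2r// nnegrE ltW.
  by lra.
move: f0 f1 f2; move: (9 * F w s ^+ 3) => g g0 g1 g2 N0.
have d_ge0 i : 0 <= dd i.
  by have /andP[+ _] := dE i; apply: le_trans; rewrite invr_ge0.
pose term i j := dd i * dd j * X w s i j ^+ 2.
have term0 i j : 0 <= term i j.
  exact: mulr_ge0 (mulr_ge0 (d_ge0 i) (d_ge0 j)) (sqr_ge0 _).
split=> [|i j].
  pose M := \sum_i \sum_j `|X w s i j|.
  have XM i j : `|X w s i j| <= M.
    rewrite /M (bigD1 i)//= (bigD1 j)//= -addrA lerDl addr_ge0//; apply: sumr_ge0 => // k _.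
    by apply: sumr_ge0.
  have M0 : 0 <= M by apply: le_trans (XM 0 0).
  rewrite -/M -sqrtr_sqr ler_sqrt ?sqr_ge0//.
  have tM k l : term k l <= 4 * M ^+ 2.
    have /andP[p1 q1] := dE k; have /andP[p2 q2] := dE l.
    have X2 : X w s k l ^+ 2 <= M ^+ 2.
      by rewrite -(real_normK (num_real (X w s k l))) lerXn2r// nnegrE.
    apply: ler_pM (mulr_ge0 (d_ge0 k) (d_ge0 l)) (sqr_ge0 _) _ X2.
    by rewrite (_ : 4 = 2 * 2) ?ler_pM//; ring.
  have S36 : \sum_k \sum_l term k l <= 36 * M ^+ 2.
    have := tM; rewrite !sum3 => t9.
    have := (t9 0 0, t9 0 1, t9 0 2, t9 1 0, t9 1 1, t9 1 2, t9 2 0, t9 2 1, t9 2 2).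
    by case=> [[[[[[[[]]]]]]]] *; lra.
  have S0 : 0 <= \sum_k \sum_l term k l by apply: sumr_ge0 => k _; apply: sumr_ge0.
  rewrite exprMn (_ : 6 ^+ 2 = 36); last by ring.
  by apply: le_trans S36; rewrite ler_piMl.
have Xt : 4^-1 * X w s i j ^+ 2 <= term i j.
  have /andP[p1 _] := dE i; have /andP[p2 _] := dE j.
  rewrite /term ler_wpM2r ?sqr_ge0//.
  by rewrite (_ : 4^-1 = 2^-1 * 2^-1) ?ler_pM// ?invr_ge0//; field.
have tS : term i j <= \sum_k \sum_l term k l.
  rewrite (bigD1 i)//= (bigD1 j)//= -addrA lerDl addr_ge0//; apply: sumr_ge0 => // k _.
  by apply: sumr_ge0.
have S0 : 0 <= \sum_k \sum_l term k l by apply: le_trans tS.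
have gS : 72^-1 * \sum_k \sum_l term k l <= g^-1 * \sum_k \sum_l term k l.
  by rewrite ler_wpM2r.
rewrite [leRHS]ger0_norm ?mulr_ge0 ?sqrtr_ge0//.
rewrite -(@ler_pXn2r _ 2) ?nnegrE ?mulr_ge0 ?sqrtr_ge0// real_normK ?num_real//.
by rewrite exprMn sqr_sqrtr//; lra.
Qed.

(** The matrix S that orthogonalizes the metric is bounded together with its
    inverse R, and so are the weights [dj]. *)
Lemma normAo_unifO n : unifO n (fun w s => normAo m P (fy w) s) <->
  forall i j, unifO n (fun w s => T w s i j).
Proof.
have [d d0 h] := normX; split=> [bn i j|bT].
  have bX k l : unifO n (fun w s => X w s k l).
    apply: (unifO_norm d0 (fun w s sd => (h w s sd).2 k l)).
    exact: (unifOM (unifO_real 17) bn).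
  have := unifO_mulmx (unifO_mulmx bR bX) bRT i j; rewrite addn0 add0n.
  by apply: unifO_ext => w s _; rewrite XT.
have bX k l : unifO n (fun w s => X w s k l).
  by have := unifO_mulmx (unifO_mulmx bS bT) bST k l; rewrite addn0 add0n.
have b1 : unifO n (fun w s => 6 * \sum_i \sum_j `|X w s i j|).
  apply: (unifOM (unifO_real 6)); apply: unifO_sum => k; apply: unifO_sum => l.
  exact: unifO_abs.
apply: (unifO_norm d0 _ b1) => w s sd; rewrite ger0_norm; last exact: sqrtr_ge0.
exact: (h w s sd).1.
Qed.

End NormComparison.

(** * The first coefficients of the trace-free part *)

Section SeriesRules.
Context {R : realType}.

Lemma expands_real (a : R) : expands (fun _ _ => a) (fun _ j => if j is 0 then a else 0).
Proof. by apply: expands_cst; exact: unifO_real. Qed.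

Lemma expandsX2 phi (c : fr -> nat -> R) : expands phi c ->
  expands (fun w s => phi w s ^+ 2) (fun w => mulc (c w) (c w)).
Proof. by move=> e; apply: expands_ext (expandsM e e) => w s _; rewrite expr2. Qed.

Lemma expandsX3 phi (c : fr -> nat -> R) : expands phi c ->
  expands (fun w s => phi w s ^+ 3) (fun w => mulc (c w) (mulc (c w) (c w))).
Proof.
by move=> e; apply: expands_ext (expandsM e (expandsM e e)) => w s _; ring.
Qed.

End SeriesRules.

(** Expansion of a polynomial expression, the coefficients being found along
    the way. Numerals and m are constants; other atoms are hypotheses. *)
Ltac expand := lazymatch goal with
  | |- expands (fun w s => s) _ => exact expands_s
  | |- expands (fun w s => _%:R) _ => exact (expands_real _)
  | |- expands (fun w s => _^-1) _ => exact (expands_real _)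
  | |- expands (fun w s => @?A w s + @?B w s) _ =>
      refine (@expandsD _ A B _ _ _ _); expand
  | |- expands (fun w s => - @?A w s) _ => refine (@expandsN _ A _ _); expand
  | |- expands (fun w s => @?A w s ^+ 2) _ => refine (@expandsX2 _ A _ _); expand
  | |- expands (fun w s => @?A w s ^+ 3) _ => refine (@expandsX3 _ A _ _); expand
  | |- expands (fun w s => @?A w s * @?B w s) _ =>
      refine (@expandsM _ A B _ _ _ _); expand
  | |- expands (fun w s => 1) _ => exact (expands_real 1)
  | _ => first
    [ match goal with H : expands ?f _ |- expands ?f _ => exact H end
    | match goal with H : expands ?f _ |- expands (fun w s => ?f w s) _ => exact H end
    | exact (expands_real _) ]
  end.

Section Coefficients.
Context {R : realType}.
Variables (m : R) (t t2 a1 a2 b1 b2 k11 k12 k22 : fr (R := R) -> R -> R).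
Local Notation F w s := (Fj m s (t w s) (a1 w s) (a2 w s)).
Local Notation Th w s := (Thj m s (t w s) (t2 w s) (a1 w s) (a2 w s)
  (b1 w s) (b2 w s) (k11 w s) (k12 w s) (k22 w s)).
Local Notation T w s := (Tj m s (t w s) (t2 w s) (a1 w s) (a2 w s)
  (b1 w s) (b2 w s) (k11 w s) (k12 w s) (k22 w s)).
Variables (ct ct2 ca1 ca2 cb1 cb2 c11 c12 c22 : fr (R := R) -> nat -> R).
Hypothesis (et : expands t ct) (et2 : expands t2 ct2) (ea1 : expands a1 ca1)
  (ea2 : expands a2 ca2) (eb1 : expands b1 cb1) (eb2 : expands b2 cb2)
  (ek11 : expands k11 c11) (ek12 : expands k12 c12) (ek22 : expands k22 c22).

Lemma Tj_entry w s i j : T w s i j =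
  3 * F w s * Aj m s (t w s) (t2 w s) (a1 w s) (a2 w s)
  (b1 w s) (b2 w s) (k11 w s) (k12 w s) (k22 w s) i j
  - Th w s * Gj m s (t w s) (a1 w s) (a2 w s) i j.
Proof.
have comb (A G : 'M[R]_3) x y : (x *: A - y *: G) i j = x * A i j - y * G i j.
  by rewrite !mxE.
exact: comb.
Qed.

Ltac entry := eapply expands_ext;
  [by move=> w s _; rewrite !Tj_entry !mxE /=; reflexivity
  |rewrite /A11 /A12 /A13 /A22 /A23 /A33 /g11 /g12 /g13 /g22 /g23 /g33; expand].

Lemma Th_expands (cF : fr -> nat -> R) : expands (fun w s => F w s) cF ->
  exists2 c, expands (fun w s => Th w s) c & forall w,
  let f1 := - 2 * cb1 w 0%N - 2 * (ca1 w 0%N * c11 w 0%N + ca2 w 0%N * c12 w 0%N) in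
  let f2 := - 2 * cb2 w 0%N - 2 * (ca1 w 0%N * c12 w 0%N + ca2 w 0%N * c22 w 0%N) in
  let fs := - 2 * ct2 w 0%N - 2 * (ca1 w 0%N * cb1 w 0%N + ca2 w 0%N * cb2 w 0%N) in
  [/\ c w 0%N = 3 * cF w 0%N,
      c w 1%N = 3 * cF w 1%N + fs / 2 - cF w 0%N * (c11 w 0%N + c22 w 0%N)
        + (ca1 w 0%N * f1 + ca2 w 0%N * f2) / 2 &
      c w 2%N = 3 * cF w 2%N + 3 * cF w 0%N * ct w 0%N
        - 2 * cF w 0%N * ct w 0%N
        + (- 2 * ct2 w 1%N - 2 * (ca1 w 0%N * cb1 w 1%N + ca1 w 1%N * cb1 w 0%N
           + ca2 w 0%N * cb2 w 1%N + ca2 w 1%N * cb2 w 0%N) - 2 * ct w 0%N ^+ 2) / 2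
        - cF w 0%N * (c11 w 1%N + c22 w 1%N) - cF w 1%N * (c11 w 0%N + c22 w 0%N)
        + (ca1 w 1%N * f1 + ca2 w 1%N * f2 +
           ca1 w 0%N * (- 2 * cb1 w 1%N - 2 * (ca1 w 0%N * c11 w 1%N
             + ca1 w 1%N * c11 w 0%N + ca2 w 0%N * c12 w 1%N + ca2 w 1%N * c12 w 0%N))
           + ca2 w 0%N * (- 2 * cb2 w 1%N - 2 * (ca1 w 0%N * c12 w 1%N
             + ca1 w 1%N * c12 w 0%N + ca2 w 0%N * c22 w 1%N + ca2 w 1%N * c22 w 0%N))) / 2].
Proof.
move=> eF; eexists.
  eapply expands_ext; first by move=> w s _; rewrite Thj_conformal /=; reflexivity.
  expand.
by move=> w /=; split; field.
Qed.

Lemma F_expands : exists2 c, expands (fun w s => F w s) c & forall w,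
  [/\ c w 0%N = - 2 * ct w 0%N - ca1 w 0%N ^+ 2 - ca2 w 0%N ^+ 2,
      c w 1%N = - 2 * ct w 1%N - 2 * ca1 w 0%N * ca1 w 1%N - 2 * ca2 w 0%N * ca2 w 1%N &
      c w 2%N = - 2 * ct w 2%N - 2 * ca1 w 0%N * ca1 w 2%N - ca1 w 1%N ^+ 2
        - 2 * ca2 w 0%N * ca2 w 2%N - ca2 w 1%N ^+ 2 - ct w 0%N ^+ 2].
Proof.
eexists; first by rewrite /Fj; expand.
by move=> w /=; split; ring.
Qed.

Hypothesis f0 : forall w, - 2 * ct w 0%N - ca1 w 0%N ^+ 2 - ca2 w 0%N ^+ 2 = 1.

Let ct0 w : ct w 0%N = - (1 + ca1 w 0%N ^+ 2 + ca2 w 0%N ^+ 2) / 2.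
Proof. by have := f0 w; lra. Qed.

(** At s = 0 the matrices [Aj] and [Gj] coincide. *)
Lemma T_order0 i j :
  exists2 c, expands (fun w s => T w s i j) c & forall w, c w 0%N = 0.
Proof.
have [cF eF cFE] := F_expands; have [cTh eTh cThE] := Th_expands eF.
have F0 w : cF w 0%N = 1 by have [-> _ _] := cFE w.
have Th0 w : cTh w 0%N = 3 by have [-> _ _] := cThE w; rewrite F0 mulr1.
move: i j; apply: ord3P; apply: ord3P.
all: eexists; first by entry.
all: by move=> w /=; rewrite F0 Th0; ring.
Qed.

(** The Hessian of P is the only term of order s in [Aj], the metric having none
    in the tangential directions. *)
Lemma T_order1 :
  (exists2 c, expands (fun w s => T w s 0 1) c & forall w, c w 1%N = - 3 * c12 w 0%N) /\
  exists2 c, expands (fun w s => T w s 0 0 - T w s 1 1) c &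
    forall w, c w 1%N = - 3 * (c11 w 0%N - c22 w 0%N).
Proof.
have [cF eF cFE] := F_expands; have [cTh eTh cThE] := Th_expands eF.
have F0 w : cF w 0%N = 1 by have [-> _ _] := cFE w.
have Th0 w : cTh w 0%N = 3 by have [-> _ _] := cThE w; rewrite F0 mulr1.
by split; (eexists; first by entry); move=> w /=; rewrite F0 Th0; ring.
Qed.

Hypothesis H1 : unifO 3 (fun w s => Th w s ^+ 2 - 9 * F w s ^+ 3).

(** The orders 1 and 2 of Th^2 = 9 F^3. *)
Lemma H_coefs (cF cTh : fr -> nat -> R) w : expands (fun w s => F w s) cF ->
  expands (fun w s => Th w s) cTh -> cF w 0%N = 1 -> cTh w 0%N = 3 ->
  6 * cTh w 1%N = 27 * cF w 1%N /\
  6 * cTh w 2%N + cTh w 1%N ^+ 2 = 27 * (cF w 2%N + cF w 1%N ^+ 2).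
Proof.
move=> eF eTh F0 Th0.
have : exists2 c, expands (fun w s => Th w s ^+ 2 - 9 * F w s ^+ 3) c &
    c w 1%N = 6 * cTh w 1%N - 27 * cF w 1%N /\
    c w 2%N = 6 * cTh w 2%N + cTh w 1%N ^+ 2 - 27 * (cF w 2%N + cF w 1%N ^+ 2).
  eexists; first by expand.
  by split; rewrite /= F0 Th0; ring.
move=> [c ec [c1 c2]].
have c0 := proj1 (expands_unifO (isT : (3 <= 4)%N) ec) H1 w.
split; apply/eqP; rewrite -subr_eq0.
  by rewrite -c1 c0.
by rewrite -c2 c0.
Qed.

(** The case P = a + b.y at s = 0: be, bf and beta stand for b.e, b.f and b.y,
    and the hypotheses list the jets at s = 0 in the order in which the lemmas
    below determine P_s, P_ss and P_sss. *)
Section Affine.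
Variables (be bf beta : fr (R := R) -> R).
Hypothesis (a10 : forall w, ca1 w 0%N = be w) (a20 : forall w, ca2 w 0%N = bf w)
  (k110 : forall w, c11 w 0%N = - beta w) (k120 : forall w, c12 w 0%N = 0)
  (k220 : forall w, c22 w 0%N = - beta w)
  (a11 : forall w, ca1 w 1%N = beta w * be w) (a21 : forall w, ca2 w 1%N = beta w * bf w)
  (b10 : forall w, cb1 w 0%N = beta w * be w) (b20 : forall w, cb2 w 0%N = beta w * bf w)
  (t20 : forall w, ct2 w 0%N = ct w 1%N).
Let q w := - (1 + be w ^+ 2 + bf w ^+ 2) / 2.

Let q0 w : ct w 0%N = q w.
Proof. by rewrite ct0 a10 a20. Qed.

(** The order 1 of the equation is affine in P_ss. *)
Lemma affine_t1 w : ct w 1%N = 2 * beta w * q w.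
Proof.
have [cF eF cFE] := F_expands; have [cTh eTh cThE] := Th_expands eF.
have [F0 F1 _] := cFE w; have [Th0 Th1 _] := cThE w.
rewrite f0 in F0; rewrite F0 mulr1 in Th0.
have [h _] := H_coefs eF eTh F0 Th0; move: h; rewrite Th1 F1 F0.
rewrite a10 a20 k110 k120 k220 a11 a21 b10 b20 t20 /q.
by move: (ct w 1%N) => X; lra.
Qed.

Hypothesis (a12 : forall w, ca1 w 2%N = (q w + beta w ^+ 2) * be w)
  (a22 : forall w, ca2 w 2%N = (q w + beta w ^+ 2) * bf w)
  (b11 : forall w, cb1 w 1%N = 2 * (q w + beta w ^+ 2) * be w)
  (b21 : forall w, cb2 w 1%N = 2 * (q w + beta w ^+ 2) * bf w)
  (k111 : forall w, c11 w 1%N = be w ^+ 2 - beta w ^+ 2)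
  (k121 : forall w, c12 w 1%N = be w * bf w)
  (k221 : forall w, c22 w 1%N = bf w ^+ 2 - beta w ^+ 2)
  (t21 : forall w, ct2 w 1%N = 2 * ct w 2%N).

(** The order 2 of the equation is affine in P_sss. *)
Lemma affine_t2 w : ct w 2%N = 3 * (q w ^+ 2 / 2 + beta w ^+ 2 * q w).
Proof.
have [cF eF cFE] := F_expands; have [cTh eTh cThE] := Th_expands eF.
have [F0 F1 F2] := cFE w; have [Th0 Th1 Th2] := cThE w.
rewrite f0 in F0; rewrite F0 mulr1 in Th0.
have [_ h] := H_coefs eF eTh F0 Th0; move: h.
rewrite Th2 Th1 F2 F1 F0 a10 a20 k110 k120 k220 a11 a21 b10 b20 t20 a12 a22 b11 b21.
rewrite k111 k121 k221 t21 affine_t1 q0 /q.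
by move: (ct w 2%N) (be w) (bf w) (beta w) => X x z u; lra.
Qed.

Let known := (q0, affine_t1, affine_t2, a10, a20, k110, k120, k220, a11, a21, b10,
  b20, t20, a12, a22, b11, b21, k111, k121, k221, t21).

Let knownTh : exists cF cTh, [/\ expands (fun w s => F w s) cF,
  expands (fun w s => Th w s) cTh & forall w,
  [/\ cF w 0%N = 1, cF w 1%N = 2 * beta w & cF w 2%N = 2 * q w + 3 * beta w ^+ 2] /\
  [/\ cTh w 0%N = 3, cTh w 1%N = 9 * beta w & 
  cTh w 2%N = 9 * q w + 18 * beta w ^+ 2]].
Proof.
have [cF eF cFE] := F_expands; have [cTh eTh cThE] := Th_expands eF.
exists cF, cTh; split=> // w.
have [F0 F1 F2] := cFE w; have [Th0 Th1 Th2] := cThE w.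
rewrite f0 in F0; rewrite F0 mulr1 in Th0.
have [h1 h2] := H_coefs eF eTh F0 Th0.
have F1' : cF w 1%N = 2 * beta w by rewrite F1 !known /q; field.
have F2' : cF w 2%N = 2 * q w + 3 * beta w ^+ 2 by rewrite F2 !known /q; field.
have T1' : cTh w 1%N = 9 * beta w by lra.
by split; split=> //; move: h2; rewrite F1' F2' T1'; lra.
Qed.

Lemma affine_T2 i j : exists2 c, expands (fun w s => T w s i j) c &
  forall w k, (k < 3)%N -> c w k = 0.
Proof.
have [cF [cTh [eF eTh cE]]] := knownTh.
move: i j; apply: ord3P; apply: ord3P.
all: eexists; first by entry.
all: move=> w; have [[F0 F1 F2] [Th0 Th1 Th2]] := cE w.
all: by move=> [|[|[|//]]] _ /=; rewrite !(F0, F1, F2, Th0, Th1, Th2) !known /q; field.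
Qed.

Hypothesis (k122 : forall w, c12 w 2%N = 3 * beta w * be w * bf w)
  (k112 : forall w, c11 w 2%N = 3 * beta w * be w ^+ 2 - (q w + beta w ^+ 2) * beta w)
  (k222 : forall w, c22 w 2%N = 3 * beta w * bf w ^+ 2 - (q w + beta w ^+ 2) * beta w).

(** All the terms without m cancel at order 3. *)
Lemma affine_T3 :
  (exists2 c, expands (fun w s => T w s 0 1) c & forall w, c w 3%N = - 9 * m * be w * bf w) /\
  exists2 c, expands (fun w s => T w s 0 0 - T w s 1 1) c &
    forall w, c w 3%N = - 9 * m * (be w ^+ 2 - bf w ^+ 2).
Proof.
have [cF [cTh [eF eTh cE]]] := knownTh.
split; (eexists; first by entry).
all: move=> w; have [[F0 F1 F2] [Th0 Th1 Th2]] := cE w.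
all: by rewrite /= !(F0, F1, F2, Th0, Th1, Th2) !(known, k122, k112, k222) /q; field.
Qed.

End Affine.

(** The case b = 0, where P is rotationally symmetric up to the order that
    matters. *)
Section Round.
Hypothesis (a1j : forall w j, (j < 4)%N -> ca1 w j = 0)
  (a2j : forall w j, (j < 4)%N -> ca2 w j = 0)
  (b1j : forall w j, (j < 3)%N -> cb1 w j = 0) (b2j : forall w j, (j < 3)%N -> cb2 w j = 0)
  (k11j : forall w j, (j < 3)%N -> c11 w j = 0) (k12j : forall w j, (j < 3)%N -> c12 w j = 0)
  (k22j : forall w j, (j < 3)%N -> c22 w j = 0)
  (t1 : forall w, ct w 1%N = 0) (t2' : forall w, ct w 2%N = 3 / 8)
  (t20 : forall w, ct2 w 0%N = 0) (t21 : forall w, ct2 w 1%N = 3 / 4)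
  (t22 : forall w, ct2 w 2%N = 3 * ct w 3%N).

(** The coefficient of order 3 is diagonal, with entries proportional to
    1, 1, -2 as it is traceless; ct w 3 is P_ssss / 6. *)
Lemma round_T3 i j : exists2 c, expands (fun w s => T w s i j) c & exists k : R,
  (i == j -> i != 2 -> k != 0) /\ forall w, c w 3%N = k * (ct w 3%N + 3 * m / 4).
Proof.
(* With literal coefficients, the expansions simplify by computation. *)
have ze (phi : fr -> R -> R) (c : fr -> nat -> R) : (forall w j, (j < 4)%N -> c w j = 0) -> expands phi c ->
    expands phi (fun=> (fun=> (0 : R))).
  by move=> c0 e; apply: (expands_coef e).
have z3 (phi : fr -> R -> R) (c : fr -> nat -> R) : (forall w j, (j < 3)%N -> c w j = 0) -> expands phi c ->
    expands phi (fun w j => if j is 3 then c w 3%N else 0).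
  by move=> c0 e; apply: (expands_coef e) => w [|[|[|[|//]]]] _ //; rewrite c0.
have ea1' := ze _ _ a1j ea1; have ea2' := ze _ _ a2j ea2.
have eb1' := z3 _ _ b1j eb1; have eb2' := z3 _ _ b2j eb2.
have ek11' := z3 _ _ k11j ek11; have ek12' := z3 _ _ k12j ek12.
have ek22' := z3 _ _ k22j ek22.
have t0 w : ct w 0%N = - 2^-1.
  have := f0 w; rewrite (@a1j w 0 isT) (@a2j w 0 isT) expr0n /= => e; lra.
have et' : expands t (fun w j =>
    match j with 0 => - 2^-1 | 1 => 0 | 2 => 3 / 8 | _ => ct w 3%N end).
  by apply: (expands_coef et) => w [|[|[|[|//]]]].
have et2' : expands t2 (fun w j =>
    match j with 0 => 0 | 1 => 3 / 4 | 2 => 3 * ct w 3%N | _ => ct2 w 3%N end).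
  by apply: (expands_coef et2) => w [|[|[|[|//]]]].
have [cF eF F3] : exists2 c, expands (fun w s => F w s) c & forall w,
    [/\ c w 0%N = 1, c w 1%N = 0, c w 2%N = - 1 & c w 3%N = - 2 * ct w 3%N + m / 2].
  eexists; first by rewrite /Fj; expand.
  by move=> w /=; split; field.
have [cTh eTh Th3] : exists2 c, expands (fun w s => Th w s) c & forall w,
    [/\ c w 0%N = 3, c w 1%N = 0, c w 2%N = - 9 / 2 & c w 3%N = - 9 * ct w 3%N + 9 / 4 * m].
  eexists.
    eapply expands_ext; first by move=> w s _; rewrite Thj_conformal /=; reflexivity.
    expand.
  by move=> w /=; have [-> -> -> ->] := F3 w; split; field.
move: i j; apply: ord3P; apply: ord3P.
all: eexists; first by entry.
all: [> exists 3 | exists 0 | exists 0 | exists 0 | exists 3 | exists 0 | exists 0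
     | exists 0 | exists (- 6) ].
all: split=> // w /=; have [-> -> -> ->] := F3 w; have [-> -> -> ->] := Th3 w.
all: by field.
Qed.

End Round.

End Coefficients.

(** * Functions on the sphere with pure-trace Hessian *)

Section PureTraceHessian.
Context {R : realType}.
Notation V3 := 'rV[R]_3.
Notation W := ('rV[R]_3 * R)%type.
Variables (U : set W) (U_open : open U) (s : R).
Hypothesis sU : forall z, sphere2 z -> U (z, s).
Implicit Types (F : W -> R) (y e f b : V3) (i j k : 'I_3).

Lemma delta_frame y e f i k : frame y e f ->
  (i == k)%:R = e 0 i * e 0 k + f 0 i * f 0 k + y 0 i * y 0 k.
Proof.
move=> fr; have := parseval (ebase R i) (ebase R k) fr.
have db u l : dot (ebase R l) u = u 0 l.
  rewrite /dot (bigD1 l)//= /ebase mxE !eqxx mul1r big1 ?addr0// => n nl.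
  by rewrite mxE eqxx (negbTE nl) mul0r.
by rewrite !db /ebase mxE eqxx => ->.
Qed.

Lemma bilinear_frame y e f (D : 'I_3 -> 'I_3 -> R) nu : frame y e f ->
  let B (u v : V3) := \sum_i \sum_j u 0 i * v 0 j * D i j in
  B e e = nu -> B f f = nu -> B e f = 0 -> B f e = 0 ->
  (forall v, B v y = 0) -> (forall v, B y v = 0) ->
  forall i j, D i j = nu * ((i == j)%:R - y 0 i * y 0 j).
Proof.
move=> fr B Bee Bff Bef Bfe Bvy Byv i j.
have dl := delta_frame _ _ fr.
have DE : D i j = \sum_k \sum_l (i == k)%:R * (j == l)%:R * D k l.
  rewrite (bigD1 i)//= (bigD1 j)//= !eqxx !mul1r.
  rewrite [X in _ + X + _]big1 => [|l lj]; last by rewrite eq_sym (negbTE lj) mulr0 mul0r.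
  rewrite big1 ?addr0// => k ki; rewrite big1// => l _.
  by rewrite eq_sym (negbTE ki) !mul0r.
have BE : D i j = e 0 i * e 0 j * B e e + e 0 i * f 0 j * B e f + e 0 i * y 0 j * B e y
  + f 0 i * e 0 j * B f e + f 0 i * f 0 j * B f f + f 0 i * y 0 j * B f y
  + y 0 i * e 0 j * B y e + y 0 i * f 0 j * B y f + y 0 i * y 0 j * B y y.
  rewrite DE; under eq_bigr => k _ do under eq_bigr => l _ do rewrite (dl i k) (dl j l).
  by rewrite /B !sum3; ring.
by rewrite BE Bee Bff Bef Bfe !Bvy !Byv (dl i j); ring.
Qed.

(** By differentiating y . T F = 0. *)
Lemma tt_radial F y v : Cinf U F -> sphere2 y -> tt y v F (y, s) = - tv v F (y, s).
Proof.
move=> Fs ys; have Uy := sU ys.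
have yy := sphere_dot ys.
pose r (q : W) := \sum_i q.1 0 i * tang i F q.
have rs : Cinf U r.
  by apply: Cinf_sum => // i; apply: CinfM => //; [exact: Cinf_fst|exact: Cinf_tang].
have r0 j : tang j r (y, s) = 0.
  rewrite (tang_ext j sU rs (Cinf_cst U_open 0)) ?tang_cst// => z zs.
  exact: tang_radial (sphere_dot zs).
have rE j : tang j r (y, s) =
    \sum_i (y 0 i * tang j (tang i F) (y, s)) + tang j F (y, s).
  have -> : tang j F (y, s) =
      \sum_i tang i F (y, s) * ((j == i)%:R - y 0 j * y 0 i).
    have -> : \sum_i tang i F (y, s) * ((j == i)%:R - y 0 j * y 0 i) =
        \sum_i tang i F (y, s) * (j == i)%:R - y 0 j * \sum_i y 0 i * tang i F (y, s).
      by rewrite mulr_sumr -sumrB; apply: eq_bigr => i _; ring.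
    rewrite tang_radial// mulr0 subr0 (bigD1 j)//= eqxx mulr1 big1 ?addr0// => i ij.
    by rewrite eq_sym (negbTE ij) mulr0.
  rewrite -big_split /=; apply: tang_dder; apply: dder_sum => i.
  apply: dderM.
    by rewrite -[_ - _]/(((j == i)%:R - (y, s).1 0 j * (y, s).1 0 i)) -tang_fst;
      apply: dder_tang; have [] := dder_fst (y, s) 0 i.
  by apply: dder_tang; apply: Cinf_diff Uy; exact: Cinf_tang.
rewrite /tt exchange_big /= /tv -sumrN; apply: eq_bigr => j _.
have := rE j; rewrite r0 => /esym/eqP; rewrite addr_eq0 => /eqP e.
rewrite -mulrN -[X in _ * X]opprK -e opprK mulr_sumr.
by apply: eq_bigr => i _; ring.
Qed.

(** With g_i = T_i F + y_i F, the hypothesis reads T_j g_i = nu (d_ij - y_i y_j);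
    the commutator of T_j and T_k then forces nu to be constant, so that
    g_i - nu y_i is constant, and F = y . g. *)
Lemma pure_hessian_affine F : Cinf U F ->
  (forall y e f, frame y e f ->
     tt e f F (y, s) = 0 /\ tt e e F (y, s) = tt f f F (y, s)) ->
  exists (a : R) (b : V3), forall y, sphere2 y -> F (y, s) = a + \sum_i b 0 i * y 0 i.
Proof.
move=> Fs pure.
pose g i (q : W) := tang i F q + q.1 0 i * F q.
have gs i : Cinf U (g i).
  apply: CinfD => //; first exact: Cinf_tang.
  by apply: CinfM => //; exact: Cinf_fst.
pose nu (q : W) := 2^-1 * \sum_i tang i (g i) q.
have nus : Cinf U nu.
  apply: CinfM => //; first exact: Cinf_cst.
  by apply: Cinf_sum => // i; exact: Cinf_tang.
have fd k q : dder (fun q : W => q.1 0 k) q 0 0 by apply: dder_eq (dder_fst q 0 k) _; rewrite mxE.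
have gE y i j : sphere2 y -> tang j (g i) (y, s) =
    tang j (tang i F) (y, s) + (y 0 i * tang j F (y, s)
      + F (y, s) * ((j == i)%:R - y 0 j * y 0 i)).
  move=> ys; have Uy := sU ys.
  rewrite tangD; first last.
  - by apply: Cinf_diff Uy; apply: CinfM => //; exact: Cinf_fst.
  - by apply: Cinf_diff Uy; exact: Cinf_tang.
  congr (_ + _); rewrite tangM; first last.
  - exact: Cinf_diff Fs Uy.
  - by have [] := fd i (y, s).
  by rewrite tang_fst.
have tg y i j : sphere2 y ->
    tang j (g i) (y, s) = nu (y, s) * ((i == j)%:R - y 0 i * y 0 j).
  move=> ys; have [e [f fr]] := frame_exists ys.
  have Uy := sU ys; have [efz eeff] := pure _ _ _ fr.
  have [[yy ee ff] [ye yf ef]] := fr.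
  pose D i j := tang j (g i) (y, s).
  have BE (u v : V3) : \sum_i \sum_j u 0 i * v 0 j * D i j =
      tt u v F (y, s) + dot y u * tv v F (y, s)
      + F (y, s) * (dot u v - dot y u * dot y v).
    have c1 : \sum_i \sum_j u 0 i * v 0 j * (y 0 i * tang j F (y, s)) =
        dot y u * tv v F (y, s).
      by rewrite /dot /tv !sum3; ring.
    have c2 : \sum_i \sum_j u 0 i * v 0 j * ((j == i)%:R - y 0 j * y 0 i) =
        dot u v - dot y u * dot y v.
      rewrite /dot !sum3 /=; ring.
    rewrite -c1 -c2 mulr_sumr /tt -!big_split /=; apply: eq_bigr => k _.
    rewrite mulr_sumr -!big_split /=; apply: eq_bigr => l _.
    by rewrite /D gE//; ring.
  pose n := tt e e F (y, s) + F (y, s).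
  have DE : forall i j, D i j = n * ((i == j)%:R - y 0 i * y 0 j).
    apply: (bilinear_frame fr).
    - by rewrite BE ye ee /n; ring.
    - by rewrite BE yf ff -eeff /n; ring.
    - by rewrite BE efz ye yf ef; ring.
    - by rewrite BE (tt_sym U_open fr Fs Uy) efz ye yf dotC ef; ring.
    - move=> v; rewrite BE yy.
      have -> : tt v y F (y, s) = 0.
        rewrite /tt big1// => k _; under eq_bigr do rewrite -mulrA.
        by rewrite -mulr_sumr tang_radial// mulr0.
      by rewrite [tv y F _]tang_radial// (dotC v y); ring.
    - by move=> v; rewrite BE tt_radial// yy; ring.
  rewrite -/(D i j) DE; congr (_ * _).
  rewrite /nu; under eq_bigr => k _ do rewrite -[tang k _ _]/(D k k) DE eqxx.
  rewrite -mulr_sumr sumrB -/(dot y y) yy sumr_const card_ord.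
  have -> : true%:R *+ 3 = 3 :> R by [].
  by move: n {DE} => n; lra.
have nu0 k y : sphere2 y -> tang k nu (y, s) = 0.
  move=> ys; have Uy := sU ys; have yy := sphere_dot ys.
  pose p j l := (j == l)%:R - y 0 j * y 0 l.
  have pC j l : p j l = p l j by rewrite /p eq_sym mulrC.
  have TT l j i : tang l (tang j (g i)) (y, s) =
      nu (y, s) * - (y 0 i * p l j + y 0 j * p l i) + p i j * tang l nu (y, s).
    pose h (q : W) := nu q * ((i == j)%:R - q.1 0 i * q.1 0 j).
    have hs : Cinf U h.
      apply: CinfM => //; apply: CinfB => //; first exact: Cinf_cst.
      by apply: CinfM => //; exact: Cinf_fst.
    rewrite (tang_ext l sU (Cinf_tang U_open j (gs i)) hs) => [|z zs|//].
      apply: tang_dder; apply: dderM.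
        by apply: dder_tang; exact: Cinf_diff nus Uy.
      apply: dder_eq.
        apply: dderB; first exact: dder_cst.
        by apply: dderM; apply: dder_tang; [have [] := fd i (y, s)|have [] := fd j (y, s)].
      by rewrite !tang_fst /= /p; ring.
    by rewrite /= tg.
  have sumr0 : \sum_j y 0 j * tang j nu (y, s) = 0 by exact: tang_radial.
  have key j i : p i j * tang k nu (y, s) = p i k * tang j nu (y, s).
    have := tang_comm U_open k j (gs i) Uy.
    rewrite (TT k j i) (TT j k i) /= !tg// -/(p i j) -/(p i k) (pC k j) (pC k i) (pC j i).
    by move: (tang k nu _) (tang j nu _) (nu _) => *; lra.
  have : \sum_j p j j * tang k nu (y, s) = \sum_j p j k * tang j nu (y, s).
    by apply: eq_bigr => j _; exact: key.
  rewrite -mulr_suml /p; under eq_bigr do rewrite eqxx.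
  rewrite sumrB -/(dot y y) yy sumr_const card_ord.
  have -> : \sum_j ((j == k)%:R - y 0 j * y 0 k) * tang j nu (y, s) =
     \sum_j (j == k)%:R * tang j nu (y, s) - y 0 k * \sum_j y 0 j * tang j nu (y, s).
    by rewrite mulr_sumr -sumrB; apply: eq_bigr => j _; ring.
  rewrite sumr0 mulr0 subr0 (bigD1 k)//= eqxx mul1r big1 ?addr0 => [|j jk].
    by move: (tang k nu _) => x; lra.
  by rewrite (negbTE jk) mul0r.
pose y0 : V3 := ebase R 0.
have ys0 : sphere2 y0.
  by apply: dot_sphere; rewrite /dot sum3 /y0 /ebase !mxE /=; ring.
pose a := nu (y0, s).
pose h i (q : W) := g i q - a * q.1 0 i.
have hs i : Cinf U (h i).
  apply: CinfB => //; apply: CinfM => //; [exact: Cinf_cst|exact: Cinf_fst].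
have h0 i j y : sphere2 y -> tang j (h i) (y, s) = 0.
  move=> ys; have Uy := sU ys; apply: tang_dder; apply: dder_eq.
    apply: dderB; first by apply: dder_tang; exact: Cinf_diff (gs i) Uy.
    apply: dderM; first exact: dder_cst.
    by apply: dder_tang; have [] := fd i (y, s).
  rewrite tg// tang_fst /= (tang0_cst sU nus nu0 ys ys0) -/a.
  by rewrite (eq_sym j i); ring.
exists a, (\row_i h i (y0, s)) => y ys.
have yy := sphere_dot ys.
have -> : F (y, s) = \sum_i y 0 i * g i (y, s).
  have -> : \sum_i y 0 i * g i (y, s) =
      \sum_i y 0 i * tang i F (y, s) + dot y y * F (y, s).
    by rewrite /dot mulr_suml -big_split; apply: eq_bigr => i _ /=; rewrite /g /=; ring.
  by rewrite tang_radial// yy; ring.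
have gh i : g i (y, s) = a * y 0 i + h i (y0, s).
  by rewrite -(tang0_cst sU (hs i) (h0 i) ys ys0) /h /=; ring.
under eq_bigr => i _ do rewrite gh.
rewrite -[X in X + _]mulr1 -yy /dot mulr_sumr -big_split.
by apply: eq_bigr => i _ /=; rewrite mxE; ring.
Qed.

End PureTraceHessian.

Section CubicJets.
Context {R : realType}.
Notation V3 := 'rV[R]_3.
Notation W := ('rV[R]_3 * R)%type.
Variables (U : set W) (U_open : open U) (s : R).
Hypothesis sU : forall z, sphere2 z -> U (z, s).
Variables (b : V3) (c0 c1 c2 c3 : R).

(** The s-derivatives of P at s = 0 will be polynomials of degree at most 3 in
    b.y; cubic1 and cubic2 are the derivatives of such a polynomial. *)
Definition cubic (x : R) := c0 + c1 * x + c2 * x ^+ 2 + c3 * x ^+ 3.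
Definition cubic1 (x : R) := c1 + 2 * c2 * x + 3 * c3 * x ^+ 2.
Definition cubic2 (x : R) := 2 * c2 + 6 * c3 * x.

Let B (q : W) : R := \sum_k b 0 k * q.1 0 k.

Let B_tang i q : dder B q (tdir i q) (b 0 i - q.1 0 i * B q).
Proof.
apply: dder_eq.
  by apply: dder_sum => k; apply: dderM; [exact: dder_cst|exact: dder_fst].
rewrite /tdir /= /B; under eq_bigr => k _ do rewrite rowBZ mulr0 addr0.
have -> : \sum_k b 0 k * (ebase R i 0 k - q.1 0 i * q.1 0 k) =
    \sum_k b 0 k * ebase R i 0 k - q.1 0 i * \sum_k b 0 k * q.1 0 k.
  by rewrite mulr_sumr -sumrB; apply: eq_bigr => k _; ring.
congr (_ - _); rewrite (bigD1 i)//= /ebase mxE !eqxx mulr1 big1 ?addr0// => k ki.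
by rewrite mxE eqxx (negbTE ki) mulr0.
Qed.

Let B_smooth : Cinf U B.
Proof.
apply: Cinf_sum => // k; apply: CinfM => //; [exact: Cinf_cst|exact: Cinf_fst].
Qed.

Let G q := cubic (B q).

Let G_smooth : Cinf U G.
Proof.
by do 3?apply: CinfD => //; try apply: CinfM => //; try apply: CinfX => //; exact: Cinf_cst.
Qed.

Let tangG i q : tang i G q = cubic1 (B q) * (b 0 i - q.1 0 i * B q).
Proof.
apply: tang_dder; apply: dder_eq.
  apply: dderD; first apply: dderD; first apply: dderD; first exact: dder_cst.
  - by apply: dderM; [exact: dder_cst|exact: B_tang].
  - by apply: dderM; [exact: dder_cst|apply: dderX; exact: B_tang].
  - by apply: dderM; [exact: dder_cst|apply: dderX; exact: B_tang].
by rewrite /cubic1 /=; move: (B q) => *; ring.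
Qed.

Let tang_tangG i j q : tang j (tang i G) q =
  cubic2 (B q) * (b 0 i - q.1 0 i * B q) * (b 0 j - q.1 0 j * B q)
  - cubic1 (B q) * (q.1 0 i * (b 0 j - q.1 0 j * B q)
    + B q * ((j == i)%:R - q.1 0 j * q.1 0 i)).
Proof.
have -> : tang i G = fun q => cubic1 (B q) * (b 0 i - q.1 0 i * B q).
  by apply/funext => z; exact: tangG.
have fd : dder (fun q : W => q.1 0 i) q (tdir j q) ((j == i)%:R - q.1 0 j * q.1 0 i).
  by rewrite -tang_fst; apply: dder_tang; have [] := dder_fst q 0 i.
apply: tang_dder; apply: dder_eq.
  apply: dderM.
    apply: dderD; first apply: dderD; first exact: dder_cst.
    - by apply: dderM; [exact: dder_cst|exact: B_tang].
    - by apply: dderM; [exact: dder_cst|apply: dderX; exact: B_tang].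
  by apply: dderB; [exact: dder_cst|apply: dderM; [exact: fd|exact: B_tang]].
by rewrite /cubic1 /cubic2 /=; move: (B q) => *; ring.
Qed.

Lemma cubic_jets (D : W -> R) y : Cinf U D ->
  (forall z, sphere2 z -> D (z, s) = cubic (dot b z)) -> sphere2 y ->
  (forall v, dot v y = 0 -> tv v D (y, s) = cubic1 (dot b y) * dot v b) /\
  (forall v u, dot v y = 0 -> dot u y = 0 -> tt v u D (y, s) =
     cubic2 (dot b y) * dot v b * dot u b - cubic1 (dot b y) * dot b y * dot v u).
Proof.
move=> Ds DG ys.
have t1 i z : sphere2 z -> tang i D (z, s) = tang i G (z, s).
  by move=> zs; apply: (tang_ext i sU Ds G_smooth _ zs) => x xs; rewrite DG.
have t2 i j z : sphere2 z -> tang j (tang i D) (z, s) = tang j (tang i G) (z, s).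
  move=> zs; apply: (tang_ext j sU (Cinf_tang U_open i Ds)
    (Cinf_tang U_open i G_smooth) _ zs) => x xs; exact: t1.
split=> [v vy|v u vy uy].
  have -> : tv v D (y, s) = \sum_k v 0 k * (cubic1 (dot b y) * (b 0 k - y 0 k * dot b y)).
    by apply: eq_bigr => k _; rewrite t1// tangG.
  transitivity (cubic1 (dot b y) * (dot v b - dot v y * dot b y)).
    by move: (dot b y) (cubic1 (dot b y)) => x x1; rewrite /dot !sum3; ring.
  by rewrite vy mul0r subr0.
have -> : tt v u D (y, s) = \sum_i \sum_j v 0 i * u 0 j *
    (cubic2 (dot b y) * (b 0 i - y 0 i * dot b y) * (b 0 j - y 0 j * dot b y)
     - cubic1 (dot b y) * (y 0 i * (b 0 j - y 0 j * dot b y)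
       + dot b y * ((j == i)%:R - y 0 j * y 0 i))).
  by apply: eq_bigr => i _; apply: eq_bigr => j _; rewrite t2// tang_tangG.
transitivity (cubic2 (dot b y) * (dot v b - dot v y * dot b y) * (dot u b - dot u y * dot b y)
  - cubic1 (dot b y) * (dot v y * (dot u b - dot u y * dot b y)
     + dot b y * (dot v u - dot v y * dot u y))).
  move: (dot b y) (cubic1 (dot b y)) (cubic2 (dot b y)) => x x1 x2.
  rewrite /dot !sum3 /=; ring.
by rewrite vy uy; ring.
Qed.

End CubicJets.

(** * The theorem *)

Section Assembly.
Context {R : realType}.
Notation V3 := 'rV[R]_3.
Notation W := ('rV[R]_3 * R)%type.
Variables (m : R) (m_ge0 : 0 <= m) (U : set W) (U_open : open U)
  (P : W -> R) (P_smooth : Cinf U P) (s0 : R) (s0_gt0 : 0 < s0)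
  (ms0 : 2 * m * s0 < 1) (collarU : collar s0 `<=` U)
  (P_spacelike : spacelike m s0 P)
  (H_asymp : unifO 3 (fun (w : fr) s => Hys m P (fy w) s - 1)).
Implicit Types (w : fr (R := R)) (s : R) (y e f v u : V3).
Local Notation D j := (sder P j).
Local Notation T := (jT m P).
Local Notation A := (fun w s => normAo m P (fy w) s).

Let sU z : sphere2 z -> U (z, 0).
Proof. by move=> zs; apply: collarU; split=> //=; rewrite lexx ltW. Qed.

Lemma derive1n_sder n y s : U (y, s) ->
  derive1n n (fun s => P (y, s)) s = D n (y, s).
Proof.
elim: n s => [//|n IH] s Us.
have line r : (y, 0) + r *: es = (y, r) :> W.
  by apply: injective_projections => /=; rewrite ?scaler0 ?addr0// add0r [LHS]mulr1.
rewrite derive1nS derive1E.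
have near_s : \near s, derive1n n (fun s => P (y, s)) s = D n ((y, 0) + s *: es).
  have Us' : U ((y, 0) + s *: es) by rewrite line.
  have c : {for s, continuous (fun r : R => (y, 0) + r *: es : W)}.
    by apply: differentiable_continuous; apply: differentiableD => //;
      exact: differentiableZl.
  have n1 : \near s, U ((y, 0) + s *: es) by exact: (c U (near_open U_open Us')).
  by apply: filterS n1 => r /=; rewrite line; exact: IH.
rewrite (near_eq_derive _ near_s).
have [_ ->] := @is_derive_line _ _ (D n) (y, 0) es s (Cinf_diff
  (Cinf_sder n P_smooth) (eq_ind_r U Us (line s))).
by rewrite line.
Qed.

Let D_smooth n : Cinf U (D n). Proof. exact: Cinf_sder. Qed.

Let et := expands_t P_smooth s0_gt0 collarU.
Let et2 := expands_t2 P_smooth s0_gt0 collarU.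
Let ea1 := expands_a1 U_open P_smooth s0_gt0 collarU.
Let ea2 := expands_a2 U_open P_smooth s0_gt0 collarU.
Let eb1 := expands_b1 U_open P_smooth s0_gt0 collarU.
Let eb2 := expands_b2 U_open P_smooth s0_gt0 collarU.
Let ek11 := expands_k11 U_open P_smooth s0_gt0 collarU.
Let ek12 := expands_k12 U_open P_smooth s0_gt0 collarU.
Let ek22 := expands_k22 U_open P_smooth s0_gt0 collarU.
Let H1 := Th_sq m_ge0 U_open P_smooth s0_gt0 ms0 collarU P_spacelike H_asymp.

Let Anorm n := normAo_unifO m_ge0 U_open P_smooth s0_gt0 ms0 collarU P_spacelike
  H_asymp n.

Let D1E w : D 1 (fy w, 0) =
  - (1 + tv (fe w) P (fy w, 0) ^+ 2 + tv (ff w) P (fy w, 0) ^+ 2) / 2.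
Proof.
have := F0_eq1 m_ge0 U_open P_smooth s0_gt0 ms0 collarU P_spacelike H_asymp w.
have -> : D 1 (fy w, 0) = ds P (fy w, 0) by [].
rewrite (lapF_frame _ _ _ (frP w)) /Fj expr0n /= !mul0r subr0.
by move: (ds P _) (tv (fe w) P _) (tv (ff w) P _) => *; lra.
Qed.

Let f0 w : - 2 * (sder (ds P) 0 (fy w, 0) / 0`!%:R)
  - (tv (fe w) (D 0) (fy w, 0) / 0`!%:R) ^+ 2
  - (tv (ff w) (D 0) (fy w, 0) / 0`!%:R) ^+ 2 = 1.
Proof.
rewrite fact0 !divr1 sderS (_ : D 0 = P)// D1E.
by move: (tv _ _ _) (tv _ _ _) => x z; field.
Qed.

Lemma normA_order1 : unifO 1 A.
Proof.
apply/Anorm => i j.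
have [c ec c0] := T_order0 m et et2 ea1 ea2 eb1 eb2 ek11 ek12 ek22 f0 i j.
by apply/(expands_unifO (isT : (1 <= 4)%N) ec) => w [|//] _; exact: c0.
Qed.

Lemma order2_affine : unifO 2 A -> in_first_eigenspan (fun y => P (y, 0)).
Proof.
move/Anorm => T2.
have [[c ec c1] [c' ec' c1']] := T_order1 m et et2 ea1 ea2 eb1 eb2 ek11 ek12 ek22 f0.
have z := proj1 (expands_unifO (isT : (2 <= 4)%N) ec) (T2 0 1).
have z' := proj1 (expands_unifO (isT : (2 <= 4)%N) ec') (unifOB (T2 0 0) (T2 1 1)).
apply: (pure_hessian_affine U_open sU P_smooth) => y e f fr.
have := c1 (Fr fr); have := c1' (Fr fr); rewrite z// z'// fact0 !divr1 /=.
move: (tt e e _ _) (tt f f _ _) (tt e f _ _) => x1 x2 x3 h h'.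
by split; lra.
Qed.

(** The jets needed in the coefficients are found order by order: each
    s-derivative of P at s = 0, as a function on the sphere, gives the
    tangential jets that enter the equation for the next one. *)
Section AffineData.
Variables (a : R) (b : V3).
Hypothesis Paff : forall y, sphere2 y -> P (y, 0) = a + \sum_i b 0 i * y 0 i.

Let bb := dot b b.
Let be w := dot (fe w) b.
Let bf w := dot (ff w) b.
Let beta w := dot b (fy w).
Let q w := - (1 + be w ^+ 2 + bf w ^+ 2) / 2.

Let fs w : sphere2 (fy w). Proof. exact: frame_sphere (frP w). Qed.
Let ey w : dot (fe w) (fy w) = 0. Proof. by rewrite dotC; case: (frP w) => [_ []]. Qed.
Let fy' w : dot (ff w) (fy w) = 0. Proof. by rewrite dotC; case: (frP w) => [_ []]. Qed.
Let ef w : dot (fe w) (ff w) = 0. Proof. by case: (frP w) => [_ []]. Qed.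

Let bbE w : bb = be w ^+ 2 + bf w ^+ 2 + beta w ^+ 2.
Proof.
by rewrite /bb (parseval _ _ (frP w)) !(dotC b (fe w)) !(dotC b (ff w)) !expr2.
Qed.

Let jets n c0 c1 c2 c3 (Dn : forall z, sphere2 z -> D n (z, 0) = cubic c0 c1 c2 c3 (dot b z))
    w :
  [/\ tv (fe w) (D n) (fy w, 0) = cubic1 c1 c2 c3 (beta w) * be w,
      tv (ff w) (D n) (fy w, 0) = cubic1 c1 c2 c3 (beta w) * bf w &
   [/\ tt (fe w) (fe w) (D n) (fy w, 0) =
         cubic2 c2 c3 (beta w) * be w ^+ 2 - cubic1 c1 c2 c3 (beta w) * beta w,
       tt (fe w) (ff w) (D n) (fy w, 0) = cubic2 c2 c3 (beta w) * be w * bf w &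
       tt (ff w) (ff w) (D n) (fy w, 0) =
         cubic2 c2 c3 (beta w) * bf w ^+ 2 - cubic1 c1 c2 c3 (beta w) * beta w]].
Proof.
have [tvE ttE] := cubic_jets U_open sU (D_smooth n) Dn (fs w).
split; [exact: tvE|exact: tvE|split].
- by rewrite (ttE _ _ (ey w) (ey w)) ee1 /be expr2 mulr1 mulrA.
- by rewrite (ttE _ _ (ey w) (fy' w)) ef mulr0 subr0.
- by rewrite (ttE _ _ (fy' w) (fy' w)) ff1 /bf expr2 mulr1 mulrA.
Qed.

Let D0 z : sphere2 z -> D 0 (z, 0) = cubic a 1 0 0 (dot b z).
Proof. by move=> zs; rewrite /sder /= Paff// /cubic -/(dot b z); ring. Qed.

Let bf0 w : tv (fe w) P (fy w, 0) = be w /\ tv (ff w) P (fy w, 0) = bf w.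
Proof. by have [-> -> _] := jets D0 w; rewrite /cubic1; split; ring. Qed.

Let D1w w : D 1 (fy w, 0) = q w.
Proof. by rewrite D1E; have [-> ->] := bf0 w. Qed.

Let D1 z : sphere2 z -> D 1 (z, 0) = cubic (- (1 + bb) / 2) 0 2^-1 0 (dot b z).
Proof.
move=> zs; have [e [f fr]] := frame_exists zs.
by rewrite (D1w (Fr fr)) /cubic (bbE (Fr fr)) /q /beta /=; field.
Qed.

Let a10 w : tv (fe w) (D 0) (fy w, 0) / 0`!%:R = be w.
Proof. by rewrite fact0 divr1; have [] := bf0 w. Qed.
Let a20 w : tv (ff w) (D 0) (fy w, 0) / 0`!%:R = bf w.
Proof. by rewrite fact0 divr1; have [] := bf0 w. Qed.
Let k110 w : tt (fe w) (fe w) (D 0) (fy w, 0) / 0`!%:R = - beta w.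
Proof. by rewrite fact0 divr1; have [_ _ [-> _ _]] := jets D0 w; rewrite /cubic1 /cubic2; ring. Qed.
Let k120 w : tt (fe w) (ff w) (D 0) (fy w, 0) / 0`!%:R = 0.
Proof. by rewrite fact0 divr1; have [_ _ [_ -> _]] := jets D0 w; rewrite /cubic2; ring. Qed.
Let k220 w : tt (ff w) (ff w) (D 0) (fy w, 0) / 0`!%:R = - beta w.
Proof. by rewrite fact0 divr1; have [_ _ [_ _ ->]] := jets D0 w; rewrite /cubic1 /cubic2; ring. Qed.
Let a11 w : tv (fe w) (D 1) (fy w, 0) / 1`!%:R = beta w * be w.
Proof. by rewrite divr1; have [-> _ _] := jets D1 w; rewrite /cubic1; field. Qed.
Let a21 w : tv (ff w) (D 1) (fy w, 0) / 1`!%:R = beta w * bf w.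
Proof. by rewrite divr1; have [_ -> _] := jets D1 w; rewrite /cubic1; field. Qed.
Let b10 w : tv (fe w) (sder (ds P) 0) (fy w, 0) / 0`!%:R = beta w * be w.
Proof. by rewrite sderS -a11 fact0. Qed.
Let b20 w : tv (ff w) (sder (ds P) 0) (fy w, 0) / 0`!%:R = beta w * bf w.
Proof. by rewrite sderS -a21 fact0. Qed.
Let t20 w : sder (ds (ds P)) 0 (fy w, 0) / 0`!%:R = sder (ds P) 1 (fy w, 0) / 1`!%:R.
Proof. by rewrite !sderS fact0. Qed.

Let D2w w : D 2 (fy w, 0) = 2 * beta w * q w.
Proof.
have := affine_t1 et et2 ea1 ea2 eb1 eb2 ek11 ek12 ek22 f0 H1 a10 a20 k110 k120 k220
  a11 a21 b10 b20 t20 w.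
by rewrite sderS divr1.
Qed.

Let D2 z : sphere2 z -> D 2 (z, 0) = cubic 0 (- (1 + bb)) 0 1 (dot b z).
Proof.
move=> zs; have [e [f fr]] := frame_exists zs.
by rewrite (D2w (Fr fr)) /cubic (bbE (Fr fr)) /q /beta /=; field.
Qed.

Let two : 2`!%:R = 2 :> R. Proof. by []. Qed.

Let a12 w : tv (fe w) (D 2) (fy w, 0) / 2`!%:R = (q w + beta w ^+ 2) * be w.
Proof. by rewrite two; have [-> _ _] := jets D2 w; rewrite /cubic1 (bbE w) /q; field. Qed.
Let a22 w : tv (ff w) (D 2) (fy w, 0) / 2`!%:R = (q w + beta w ^+ 2) * bf w.
Proof. by rewrite two; have [_ -> _] := jets D2 w; rewrite /cubic1 (bbE w) /q; field. Qed.
Let b11 w : tv (fe w) (sder (ds P) 1) (fy w, 0) / 1`!%:R = 2 * (q w + beta w ^+ 2) * be w.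
Proof. by rewrite sderS divr1 -mulrA -a12 two mulrC divfK. Qed.
Let b21 w : tv (ff w) (sder (ds P) 1) (fy w, 0) / 1`!%:R = 2 * (q w + beta w ^+ 2) * bf w.
Proof. by rewrite sderS divr1 -mulrA -a22 two mulrC divfK. Qed.
Let k111 w : tt (fe w) (fe w) (D 1) (fy w, 0) / 1`!%:R = be w ^+ 2 - beta w ^+ 2.
Proof. by rewrite divr1; have [_ _ [-> _ _]] := jets D1 w; rewrite /cubic1 /cubic2; field. Qed.
Let k121 w : tt (fe w) (ff w) (D 1) (fy w, 0) / 1`!%:R = be w * bf w.
Proof. by rewrite divr1; have [_ _ [_ -> _]] := jets D1 w; rewrite /cubic2; field. Qed.
Let k221 w : tt (ff w) (ff w) (D 1) (fy w, 0) / 1`!%:R = bf w ^+ 2 - beta w ^+ 2.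
Proof. by rewrite divr1; have [_ _ [_ _ ->]] := jets D1 w; rewrite /cubic1 /cubic2; field. Qed.
Let t21 w : sder (ds (ds P)) 1 (fy w, 0) / 1`!%:R = 2 * (sder (ds P) 2 (fy w, 0) / 2`!%:R).
Proof. by rewrite !sderS divr1 two mulrC divfK. Qed.
Let k122 w : tt (fe w) (ff w) (D 2) (fy w, 0) / 2`!%:R = 3 * beta w * be w * bf w.
Proof. by rewrite two; have [_ _ [_ -> _]] := jets D2 w; rewrite /cubic2; field. Qed.
Let k112 w : tt (fe w) (fe w) (D 2) (fy w, 0) / 2`!%:R =
  3 * beta w * be w ^+ 2 - (q w + beta w ^+ 2) * beta w.
Proof.
by rewrite two; have [_ _ [-> _ _]] := jets D2 w; rewrite /cubic1 /cubic2 (bbE w) /q; field.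
Qed.
Let k222 w : tt (ff w) (ff w) (D 2) (fy w, 0) / 2`!%:R =
  3 * beta w * bf w ^+ 2 - (q w + beta w ^+ 2) * beta w.
Proof.
by rewrite two; have [_ _ [_ _ ->]] := jets D2 w; rewrite /cubic1 /cubic2 (bbE w) /q; field.
Qed.

Lemma affine_order3 : unifO 3 A.
Proof.
apply/Anorm => i j.
have [c ec c0] := affine_T2 et et2 ea1 ea2 eb1 eb2 ek11 ek12 ek22 f0 H1 a10 a20 k110 k120 k220
  a11 a21 b10 b20 t20 a12 a22 b11 b21 k111 k121 k221 t21 i j.
by apply/(expands_unifO (isT : (3 <= 4)%N) ec) => w k; exact: c0.
Qed.

Let D3w w : D 3 (fy w, 0) = 6 * (q w ^+ 2 / 2 + beta w ^+ 2 * q w).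
Proof.
have := affine_t2 et et2 ea1 ea2 eb1 eb2 ek11 ek12 ek22 f0 H1 a10 a20 k110 k120 k220
  a11 a21 b10 b20 t20 a12 a22 b11 b21 k111 k121 k221 t21 w.
rewrite sderS two => /(congr1 (fun x => x * 2)); rewrite divfK// => ->.
by rewrite -/(q w); move: (q w) (beta w) => *; field.
Qed.

(** The traceless part of the projection of b (x) b vanishes on every tangent
    plane, hence so does the projection of b; and every vector is tangent
    somewhere. *)
Lemma order4_round : 0 < m -> unifO 4 A -> b = 0.
Proof.
move=> m0 /Anorm T4.
have [[c ec c3] [c' ec' c3']] := affine_T3 et et2 ea1 ea2 eb1 eb2 ek11 ek12 ek22 f0 H1
  a10 a20 k110 k120 k220 a11 a21 b10 b20 t20 a12 a22 b11 b21 k111 k121 k221 t21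
  k122 k112 k222.
have z := proj1 (expands_unifO (leqnn 4) ec) (T4 0 1).
have z' := proj1 (expands_unifO (leqnn 4) ec') (unifOB (T4 0 0) (T4 1 1)).
have be0 w : be w = 0.
  have := c3 w; have := c3' w; rewrite z// z'//.
  move: (be w) (bf w) => x1 x2 /esym/eqP; rewrite mulf_eq0 => /orP[/eqP|/eqP h]; first lra.
  move=> /esym/eqP; rewrite mulf_eq0 => /orP[|/eqP x20]; last by nra.
  by rewrite mulf_eq0 => /orP[/eqP|/eqP//]; lra.
apply/rowP => i; rewrite mxE.
pose z0 : V3 := ebase R i.
have zz : dot z0 z0 = 1.
  rewrite /dot (bigD1 i)//= /z0 /ebase mxE !eqxx mulr1 big1 ?addr0// => k ki.
  by rewrite mxE eqxx (negbTE ki) mul0r.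
have [e [f [[_ ee ff] [ze zf ef0]]]] := frame_exists (dot_sphere zz).
have fr : frame e z0 f by split; split=> //; rewrite dotC.
have := be0 (Fr fr); rewrite /be /= /dot (bigD1 i)//= /z0 /ebase mxE !eqxx mul1r.
by rewrite big1 ?addr0// => k ki; rewrite mxE eqxx (negbTE ki) mul0r.
Qed.

Section RoundData.
Hypothesis b0 : b = 0.

Let be0 w : be w = 0. Proof. by rewrite /be b0 /dot big1// => i _; rewrite mxE mulr0. Qed.
Let bf00 w : bf w = 0. Proof. by rewrite /bf b0 /dot big1// => i _; rewrite mxE mulr0. Qed.
Let beta0 w : beta w = 0. Proof. by rewrite /beta b0 /dot big1// => i _; rewrite mxE mul0r. Qed.
Let q0 w : q w = - 2^-1. Proof. by rewrite /q be0 bf00; field. Qed.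

Let D3 z : sphere2 z -> D 3 (z, 0) = cubic (3 / 4) 0 0 0 (dot b z).
Proof.
move=> zs; have [e [f fr]] := frame_exists zs.
by rewrite (D3w (Fr fr)) q0 beta0 /cubic; field.
Qed.

Let tv1 j w : (j < 4)%N -> tv (fe w) (D j) (fy w, 0) = 0 /\ tv (ff w) (D j) (fy w, 0) = 0.
Proof.
case: j => [|[|[|[|//]]]] _.
- by have [-> -> _] := jets D0 w; rewrite be0 bf00 !mulr0.
- by have [-> -> _] := jets D1 w; rewrite be0 bf00 !mulr0.
- by have [-> -> _] := jets D2 w; rewrite be0 bf00 !mulr0.
- by have [-> -> _] := jets D3 w; rewrite be0 bf00 !mulr0.
Qed.

Let tt1 j w : (j < 3)%N -> [/\ tt (fe w) (fe w) (D j) (fy w, 0) = 0,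
  tt (fe w) (ff w) (D j) (fy w, 0) = 0 & tt (ff w) (ff w) (D j) (fy w, 0) = 0].
Proof.
have cut x1 x2 : x1 * 0 ^+ 2 - x2 * 0 = 0 :> R by ring.
case: j => [|[|[|//]]] _.
- by have [_ _ [-> -> ->]] := jets D0 w; rewrite be0 bf00 beta0 !cut mulr0.
- by have [_ _ [-> -> ->]] := jets D1 w; rewrite be0 bf00 beta0 !cut mulr0.
- by have [_ _ [-> -> ->]] := jets D2 w; rewrite be0 bf00 beta0 !cut mulr0.
Qed.

Lemma round_order4 : unifO 4 A <-> forall w, D 4 (fy w, 0) = - (9 * m / 2).
Proof.
have six : 3`!%:R = 6 :> R by [].
have T3 := proj1 (Anorm 3) affine_order3.
have key i j : exists2 c, expands (fun w s => T w s i j) c & exists k : R,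
    (i == j -> i != 2 -> k != 0) /\ forall w, c w 3%N =
      k * (D 4 (fy w, 0) / 6 + 3 * m / 4).
  have [|||||||||||| c ec [k [k0 ck]]] := round_T3 m
    et et2 ea1 ea2 eb1 eb2 ek11 ek12 ek22 f0 _ _ _ _ _ _ _ _ _ _ _ _ i j.
  - by move=> w n /(tv1 w)[-> _]; rewrite mul0r.
  - by move=> w n /(tv1 w)[_ ->]; rewrite mul0r.
  - by move=> w n n3; rewrite sderS; have [-> _] := tv1 w (n3 : (n.+1 < 4)%N); rewrite mul0r.
  - by move=> w n n3; rewrite sderS; have [_ ->] := tv1 w (n3 : (n.+1 < 4)%N); rewrite mul0r.
  - by move=> w n /(tt1 w)[-> _ _]; rewrite mul0r.
  - by move=> w n /(tt1 w)[_ -> _]; rewrite mul0r.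
  - by move=> w n /(tt1 w)[_ _ ->]; rewrite mul0r.
  - by move=> w; rewrite sderS D2w beta0 mulr0 !mul0r.
  - by move=> w; rewrite sderS D3w q0 beta0 two; field.
  - by move=> w; rewrite !sderS D2w beta0 mulr0 !mul0r.
  - by move=> w; rewrite !sderS D3w q0 beta0 divr1; field.
  - by move=> w; rewrite !sderS six two; field.
  by exists c => //; exists k.
split=> [/Anorm T4 w|D4].
  have [c ec [k [k0 ck]]] := key 0 0.
  have := proj1 (expands_unifO (leqnn 4) ec) (T4 0 0) w 3%N isT.
  rewrite ck => /eqP; rewrite mulf_eq0 (negbTE (k0 _ _))//= => /eqP.
  by move: (ds _ _) => x; lra.
apply/Anorm => i j; have [c ec [k [_ ck]]] := key i j.
apply/(expands_unifO (leqnn 4) ec) => w n; rewrite ltnS leq_eqVlt => /orP[/eqP->|n3].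
  by rewrite ck D4 [X in k * X](_ : _ = 0) ?mulr0//; field.
exact: (proj1 (expands_unifO (isT : (3 <= 4)%N) ec) (T3 i j)).
Qed.

End RoundData.

End AffineData.

(** By the Gauss equation S + 6 is the square of the norm. *)
Lemma normA_sqr : (forall w s, 0 < s <= s0 -> Hys m P (fy w) s = 1) ->
  unifO 3 A <-> unifO 6 (fun w s => Sys m P (fy w) s + 6).
Proof.
move=> H1'.
have [d /andP[d0 ds] near_d] := near_infinity m_ge0 U_open P_smooth s0_gt0 ms0 collarU
  P_spacelike H_asymp.
have SE w s : 0 < s <= d -> Sys m P (fy w) s + 6 = normAo m P (fy w) s ^+ 2.
  move=> sd; have /andP[sp sd'] := sd; have [F1 _ t4] := near_d w s sd.
  have ss : s <= s0 by exact: le_trans ds.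
  have Us : U (fy w, s) by apply: (collar_pt collarU); rewrite ltW.
  have Fp : 0 < jF m P w s by apply: lt_le_trans F1; rewrite invr_gt0.
  have t0 : jt P w s != 0 by rewrite lt_eqF// (le_lt_trans t4)// oppr_lt0 invr_gt0.
  apply: (Sys_frame m_ge0 U_open P_smooth (frP w) sp Us (ms_lt1 m_ge0 ms0 ss) Fp t0).
  by apply: H1'; rewrite sp.
split=> [hA|[C [d' [C0 d0' h]]]].
  have := unifOM hA hA; apply: (unifO_norm d0) => w s sd.
  by rewrite SE// expr2.
exists (Num.sqrt C), (Num.min d d'); split; rewrite ?sqrtr_ge0 ?lt_min ?d0//.
move=> w s /andP[sp]; rewrite le_min => /andP[sd sd'].
have := h w s; rewrite sp sd' => /(_ isT); rewrite SE ?sp// normrX => hs.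
rewrite -(@ler_pXn2r _ 2) ?nnegrE ?mulr_ge0 ?sqrtr_ge0 ?exprn_ge0 ?(ltW sp)//.
by rewrite exprMn sqr_sqrtr// -exprM.
Qed.

End Assembly.

Lemma smoothO_unifO (R : realType) (s0 : R) k (phi : 'rV[R]_3 -> R -> R) : 0 < s0 ->
  smoothO s0 k phi -> unifO k (fun w s => phi (fy w) s).
Proof.
move=> s0_gt0 [psi [V [V_open collarV psi_s]] h].
have [C C0 hC] := bounded_collar collarV (Cinf_iter psi_s).
exists C, s0; split=> // w s s01; have /andP[sp ss] := s01.
have := hC w s; rewrite ltW// ss => /(_ isT).
rewrite -h//; last exact: frame_sphere (frP w).
rewrite normrM ger0_norm; last by rewrite invr_ge0 exprn_ge0// ltW.
by rewrite mulrC ler_pdivrMr ?exprn_gt0.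
Qed.

Theorem theorem1p2 (R : realType) (m s0 : R) (P : 'rV[R]_3 * R -> R)
    (m_ge0 : 0 <= m) (s0_gt0 : 0 < s0) (s0_exterior : 2 * m * s0 < 1)
    (P_smooth : smooth_near (collar s0) P)
    (Sigma_spacelike : spacelike m s0 P)
    (H_asymp : smoothO s0 3 (fun y s => Hys m P y s - 1)) :
  [/\ boundO 1 (normAo m P),
      [/\ boundO 2 (normAo m P) <->
            in_first_eigenspan (fun y => P (y, 0)),
          in_first_eigenspan (fun y => P (y, 0)) <->
            boundO 3 (normAo m P) &
          (forall (y : 'rV[R]_3) (s : R), sphere2 y -> 0 < s <= s0 -> Hys m P y s = 1) ->
            (boundO 3 (normAo m P) <->
             boundO 6 (fun y s => Sys m P y s + 6))] &
      0 < m ->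
        (boundO 4 (normAo m P) <->
         (exists c : R, forall y, sphere2 y -> P (y, 0) = c) /\
         (forall y, sphere2 y ->
            derive1n 4 (fun s => P (y, s)) 0 = - (9 * m / 2)))].
Proof.
have [U [U_open collarU /Cinf_iter Ps]] := P_smooth.
have Hu := smoothO_unifO s0_gt0 H_asymp.
have aff : in_first_eigenspan (fun y => P (y, 0)) -> unifO 3 (fun w s => normAo m P (fy w) s).
  by move=> [a [b Pab]]; exact: (affine_order3 m_ge0 U_open Ps s0_gt0 s0_exterior collarU
    Sigma_spacelike Hu Pab).
have aff2 := order2_affine m_ge0 U_open Ps s0_gt0 s0_exterior collarU Sigma_spacelike Hu.
have d4 y : sphere2 y -> derive1n 4 (fun s => P (y, s)) 0 = sder P 4 (y, 0).
  move=> ys; apply: (derive1n_sder U_open Ps); apply: collarU.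
  by split=> //=; rewrite lexx ltW.
split; first by apply/boundO_unifO; exact: (normA_order1 m_ge0 U_open Ps s0_gt0 s0_exterior collarU).
  split.
  - split=> [/boundO_unifO/aff2//|/aff h]; apply/boundO_unifO; exact: unifO_le h.
  - split=> [/aff h|/boundO_unifO h]; first exact/boundO_unifO.
    by apply: aff2; exact: unifO_le h.
  - move=> H1; apply: iff_trans (boundO_unifO _ _) _.
    apply: iff_trans (iff_sym (boundO_unifO _ _)).
    apply: (normA_sqr m_ge0 U_open Ps s0_gt0 s0_exterior collarU) => // w s s01.
    by apply: H1 => //; exact: frame_sphere (frP w).
move=> m_gt0; apply: iff_trans (boundO_unifO _ _) _.
have round (a : R) (b : 'rV[R]_3) (Pab : forall y, sphere2 y -> P (y, 0) = a + \sum_i b 0 i * y 0 i) :=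
  round_order4 m_ge0 U_open Ps s0_gt0 s0_exterior collarU Sigma_spacelike Hu Pab.
split=> [h|[[c Pc] P4]].
  have [a [b Pab]] := aff2 (unifO_le (isT : (2 <= 4)%N) h).
  have b0 := order4_round m_ge0 U_open Ps s0_gt0 s0_exterior collarU Sigma_spacelike Hu
    Pab m_gt0 h.
  have R4 := proj1 (round a b Pab b0) h; split.
    exists a => y ys; rewrite Pab// b0 big1 ?addr0// => i _.
    by rewrite mxE mul0r.
  move=> y ys; rewrite d4//; have [e [f fr]] := frame_exists ys; exact: (R4 (Fr fr)).
have Pc' y : sphere2 y -> P (y, 0) = c + \sum_i (0 : 'rV[R]_3) 0 i * y 0 i.
  by move=> ys; rewrite Pc// big1 ?addr0// => i _; rewrite mxE mul0r.
apply/(round c 0 Pc' erefl) => w.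
by rewrite -d4 ?P4//; exact: frame_sphere (frP w).
Qed.
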